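(* Let $X_0=0$, $T_0=0$, $T_i=\inf\{k>T_{i-1}:X_k=0\}$ for $i\ge1$, $N(t)=\max\{k\ge0:T_k\le t\}$, and $V_n=\sum_{i=T_{N(n)}+1}^{n}X_i^p$ (the area of the last busy period). Then for any $b\ge0$, $$\lim_{n\to\infty}\frac1{n^\alpha}\log\mathbf P(V_n\ge nb)=-\mathcal B_0^*\cdot b^\alpha.$$
   Context: Fix $p>0$ and set $\alpha=1/(1+p)$. Let $U,U_1,U_2,\dots$ be i.i.d. real random variables with $\mu=\mathbf E U<0$, and let $X_{n+1}=\max(X_n+U_{n+1},0)$, $n\ge0$, with $X_0=0$. Let $\theta_+$ and $\theta_-$ be the supremum and infimum of $\{\theta:\mathbf E e^{\theta U}<\infty\}$. Standing assumptions: $-\infty\le\theta_-<0<\theta_+\le\infty$; $\lim_{n\to\infty}\frac{\log\mathbf P(U\ge n)}{n}=-\theta_+$ and $\lim_{n\to\infty}\frac{\log\mathbf P(-U\ge n)}{n}=\theta_-$; $\mathbf P(U>0)>0$. An empty sum is zero. Definition of $\mathcal B_0^*$. $\mathbb D[0,\infty)$ is the space of real càdlàg paths on $[0,\infty)$, and $\mathbb{BV}[0,\infty)$ is the set of $\xi\in\mathbb D[0,\infty)$ of bounded variation on compact intervals; such $\xi$ is decomposed as $\xi=\xi^{(a)}+\xi^{(u)}+\xi^{(d)}$ with $\xi^{(a)}$ absolutely continuous, $\xi^{(u)}$ the non-decreasing and $\xi^{(d)}$ the non-increasing part of the singular part (Lebesgue and Hahn decompositions), normalized by $\xi^{(u)}(0)=\xi^{(d)}(0)=0$.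 $\Lambda^*(y)=\sup_{\theta\in\mathbb R}\{\theta y-\log\mathbf E e^{\theta U}\}$; $\Psi(\xi)(t)=\xi(t)-\inf_{s\in[0,t]}\{\xi(s)\wedge0\}$; $\mathcal T(\xi)=\inf\{t>0:\Psi(\xi)(t)=0\}$. For $y\ge0$, $B_y=\{\xi\in\mathbb{BV}[0,\infty):\xi(0)=y,\ \int_0^{\mathcal T(\xi)}\Psi(\xi)(s)^pds\ge1\}$; $I_y(\xi)=\int_0^{\mathcal T(\xi)}\Lambda^*(\dot\xi^{(a)}(s))ds+\theta_+\xi^{(u)}(\mathcal T(\xi))+\theta_-\xi^{(d)}(\mathcal T(\xi))$ if $\xi(0)=y$ and $\xi\in\mathbb{BV}[0,\infty)$, and $I_y(\xi)=\infty$ otherwise; $\mathcal B_y^*=\inf_{\xi\in B_y}I_y(\xi)$. Conventions: $\pm\infty\cdot0=0$; if $\mathcal T(\xi)=\infty$, values at $\mathcal T(\xi)$ are limits at infinity. *)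

(* Defs.v *)
From HB Require Import structures.
From mathcomp Require Import all_boot all_order all_algebra finmap.
From mathcomp Require Import all_classical all_reals all_analysis.

Set Implicit Arguments.
Unset Strict Implicit.
Unset Printing Implicit Defensive.

Import Order.TTheory GRing.Theory Num.Theory.
Import numFieldNormedType.Exports.

Local Open Scope classical_set_scope.
Local Open Scope ring_scope.

Section probability.
Context d (Omega : measurableType d) (R : realType) (P : probability Omega R).
Implicit Types (U : nat -> {RV P >-> R}) (X : {RV P >-> R}).

Definition mutually_independent U : Prop :=
  forall (J : {fset nat}) (A : nat -> set R), (forall i, measurable (A i)) ->
    P (\bigcap_(i in [set` J]) (U i @^-1` A i)) =
    (\prod_(i <- J) P (U i @^-1` A i))%E.

Definition identically_distributed U : Prop :=
  forall (i j : nat) (A : set R), measurable A ->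
    distribution P (U i) A = distribution P (U j) A.

Definition iid U : Prop := mutually_independent U /\ identically_distributed U.

Definition theta_plus X : \bar R :=
  ereal_sup [set theta%:E | theta in [set theta : R | ('M_P X theta < +oo)%E]].

Definition theta_minus X : \bar R :=
  ereal_inf [set theta%:E | theta in [set theta : R | ('M_P X theta < +oo)%E]].

Definition Lambda_star X (y : R) : \bar R :=
  ereal_sup (range (fun theta : R =>
    ((theta * y)%:E - lne ('M_P X theta))%E)).

End probability.

Section walk.
Context (Omega : Type) (R : realType) (U : nat -> Omega -> R).

Fixpoint reflected_walk (n : nat) (w : Omega) : R :=
  if n is m.+1 then Num.max (reflected_walk m w + U m.+1 w) 0 else 0.

Local Notation X := reflected_walk.

(* The value is +oo when the walk does not return to 0 after the previous
   renewal time. *)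
Fixpoint renewal_time (i : nat) (w : Omega) : \bar R :=
  if i is j.+1 then
    ereal_inf [set k%:R%:E | k in
      [set k : nat | (renewal_time j w < k%:R%:E)%E /\ X k w = 0]]
  else 0%E.

(* The renewal times increase strictly in nat, so k <= T_k, and T_k <= n forces
   k < n.+1. *)
Definition renewal_count (n : nat) (w : Omega) : nat :=
  (\max_(k < n.+1 | (renewal_time k w <= n%:R%:E)%E) k)%N.

Definition last_busy_area (p : R) (n : nat) (w : Omega) : R :=
  \sum_(1 <= i < n.+1 | (renewal_time (renewal_count n w) w < i%:R%:E)%E)
    X i w `^ p.

End walk.

Section paths.
Context (R : realType).
Local Notation mu := (@lebesgue_measure R).
Implicit Types (xi a : R -> R).

(* A path on [0, +oo[ is a function on R; its values at negative times are
   never used. *)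

Definition cadlag xi : Prop :=
  (forall t, 0 <= t -> xi x @[x --> t^'+] --> xi t) /\
  (forall t, 0 < t -> cvg (xi x @[x --> t^'-])).

Definition BV_path xi : Prop :=
  cadlag xi /\ forall t, 0 <= t -> bounded_variation 0 t xi.

Definition abs_continuous_on (t : R) (f : R -> R) : Prop :=
  forall e : R, 0 < e -> exists2 dlt : R, 0 < dlt &
    forall (n : nat) (l r : 'I_n -> R),
      (forall i, 0 <= l i /\ l i <= r i /\ r i <= t) ->
      trivIset setT (fun i => `]l i, r i[%classic) ->
      \sum_(i < n) (r i - l i) < dlt ->
      \sum_(i < n) `|f (r i) - f (l i)| < e.

Definition mutually_singular (m1 m2 : set (measurableTypeR R) -> \bar R) : Prop :=
  exists2 A, measurable A & m1 A = 0%E /\ m2 (~` A) = 0%E.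

(* xi = xi^(a) + xi^(u) + xi^(d) with xi^(a) = a, xi^(u) = u and xi^(d) = - v:
   Lebesgue decomposition of the Stieltjes measure of xi, followed by the Hahn
   decomposition of its singular part. Vanishing of u and v on ]-oo, 0] is the
   normalization at 0, and makes their measures live on ]0, +oo[. *)
Definition BV_decomposition xi a (u v : cumulative R R) : Prop :=
  [/\ forall t, 0 <= t -> xi t = a t + u t - v t,
      forall t, 0 <= t -> abs_continuous_on t a,
      forall t, t <= 0 -> u t = 0 /\ v t = 0,
      mutually_singular (lebesgue_stieltjes_measure u) mu /\
      mutually_singular (lebesgue_stieltjes_measure v) mu
    & mutually_singular (lebesgue_stieltjes_measure u)
                        (lebesgue_stieltjes_measure v)].

Definition reflection xi (t : R) : R :=
  xi t - inf [set Num.min (xi s) 0 | s in `[0, t]].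

Definition hitting_time xi : \bar R :=
  ereal_inf [set t%:E | t in [set t : R | 0 < t /\ reflection xi t = 0]].

Definition upto (T : \bar R) : set R := [set s | 0 <= s /\ (s%:E <= T)%E].

Definition value_at (f : R -> R) (T : \bar R) : \bar R :=
  match T with
  | t%:E => (f t)%:E
  | +oo%E => lim ((f t)%:E @[t --> +oo])
  | -oo%E => 0%E
  end.

Definition B_set (p y : R) : set (R -> R) :=
  [set xi | [/\ BV_path xi, xi 0 = y &
    (1 <= \int[mu]_(s in upto (hitting_time xi)) (reflection xi s `^ p)%:E)%E]].

End paths.

Section rate.
Context d (Omega : measurableType d) (R : realType) (P : probability Omega R).
Local Notation mu := (@lebesgue_measure R).
Local Open Scope ereal_scope.

Definition decomposition_cost (X : {RV P >-> R}) (T : \bar R)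
    (a u v : R -> R) : \bar R :=
  \int[mu]_(s in upto T) Lambda_star X (a^`()%classic s)
  + theta_plus X * value_at u T
  + theta_minus X * value_at (fun t => - v t)%R T.

(* The decomposition of a path of BV_path is unique on [0, +oo[, so for
   xi in BV_path with xi 0 = y this is the infimum of a singleton; it is +oo,
   the infimum of the empty set, for every other path. *)
Definition path_rate (X : {RV P >-> R}) (y : R) (xi : R -> R) : \bar R :=
  ereal_inf [set c | [/\ xi 0%R = y, BV_path xi &
    exists (a : R -> R) (u v : cumulative R R), BV_decomposition xi a u v /\
      c = decomposition_cost X (hitting_time xi) a u v]].

Definition B_star (X : {RV P >-> R}) (p y : R) : \bar R :=
  ereal_inf (path_rate X y @` B_set p y).

End rate.

(* Main.v *)
Require Import Defs.
From HB Require Import structures.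
From mathcomp Require Import all_boot all_order all_algebra finmap.
From mathcomp Require Import all_classical all_reals all_analysis.
From mathcomp Require Import measurable_realfun ring lra zify.

(** Write x = n^alpha, so that x^(1+p) = n. A busy period with area n b lasts a time of order x
    and reaches heights of order x, and along it the walk follows, after division of space and
    time by x, a path xi with cost I(xi); the area of the path scales by the power 1 + p of the
    dilation, so a path of area 1 dilated by b^alpha has area b and its cost is multiplied by
    b^alpha. The probability of following the path is exp(- x I(xi)), whence the limit.

    The last busy period starts at the last zero of the reflected walk, and from there on the
    reflected walk is the free walk as long as the partial sums are positive. Therefore
    [busy_area_event] the event V_n >= n b is the union over m <= n of the events that the m
    last increments have positive partial sums and area at least n b. By stationarity their
    probabilities are those of the sets [pos_area p m (n b)] under one law Q on sequences
    ([iid_canonical]), so that the limit follows from bounds on these n + 1 numbers.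

    Lower bound. A path xi of cost less than c and area at least 1 stays positive before its
    hitting time ([path_gt0]). It is stopped slightly earlier and cut into J blocks of equal
    duration D. The area is nearly the sum over the blocks of D times the p-th power of the
    smaller endpoint ([area_riemann], because the total variation is finite). The cost dominates
    the sum of the costs of the increments of the blocks ([block_costs]): the absolutely
    continuous part is handled by Jensen's inequality, which needs that an absolutely continuous
    function is the integral of its derivative ([ac_FTC]); an upward singular increment costs
    theta_+ per unit, which is at least what any exponential tilt charges; downward singular
    increments only help. Each block is then realized by Cramer's lower bound ([cramer_lower])
    for the probability that a sum of k increments exceeds k y, and the blocks are concatenated
    ([pos_area_lower]); a first stretch of bounded length of positive increments keeps the walk
    positive.

    Upper bound. Outside two events of negligible probability the stretch is shorter than K x
    (negative drift) and the increments have absolute sum at most C x (exponential moments). Cut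
    it into blocks of delta x increments: up to a small error the area is again the sum over
    blocks of the p-th power of the smaller endpoint ([area_blocks]). For block sums D_j, the
    polygonal path through the partial sums is an admissible path, and its cost is the sum of
    the costs of the blocks, since the last half-line, which comes down at the mean slope, is
    free ([B_star_le_blocks]). By Chernoff's bound, the product of the two-sided tails of the
    block sums, evaluated at the block sums themselves, is then at most exp(- x (B b^alpha -
    eps)). A tail evaluated at its own variable is stochastically larger than half a uniform
    variable, so such a product is at most exp(- t) with probability at most exp(- t) times a
    power of t with bounded exponent ([small_prod_bound]), which is the required estimate
    ([pos_area_upper]). *)

Import Order.TTheory GRing.Theory Num.Theory.
Import numFieldNormedType.Exports.
Local Open Scope classical_set_scope.
Local Open Scope ring_scope.
Set Implicit Arguments.
Unset Strict Implicit.
Unset Printing Implicit Defensive.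

(** * Total variation of absolutely continuous functions *)

Section ac_variation.
Context {R : realType}.
Implicit Types (a : R -> R) (s : seq (R * R)).

(** Pairs stand for intervals with the right endpoint first, as in [zip s (l :: s)] for a
    partition s. *)
Definition apart (x y : R * R) := (x.1 <= y.2) || (y.1 <= x.2).

(** Absolute continuity for lists of intervals instead of families indexed by ordinals: lists
    can be concatenated. *)
Lemma ac_seq (t : R) a : abs_continuous_on t a ->
  forall e, 0 < e -> exists2 dlt : R, 0 < dlt & forall s : seq (R * R),
    all (fun x => (0 <= x.2) && (x.2 <= x.1) && (x.1 <= t)) s ->
    pairwise apart s ->
    \sum_(x <- s) (x.1 - x.2) < dlt ->
    \sum_(x <- s) `|a x.1 - a x.2| < e.
Proof.
move=> ac e e0; have [d d0 H] := ac e e0; exists d => // s /(all_nthP (0, 0)) al pw.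
rewrite !(big_nth (0, 0)) !big_mkord => sd.
apply: (H _ (fun i : 'I_(size s) => (nth (0, 0) s i).2)
            (fun i : 'I_(size s) => (nth (0, 0) s i).1)) => //.
  by move=> i; have /andP[/andP[]] := al i (ltn_ord i).
apply/trivIsetP => i j _ _ ij.
wlog lij : i j ij / (i < j)%N.
  move=> W; case: (ltngtP i j) => [/W|/W|/val_inj]; [exact| |]; last by move/eqP: ij.
  by rewrite setIC eq_sym; apply.
have /(pairwiseP (0, 0))/(_ i j)/= := pw.
rewrite !inE => /(_ (ltn_ord i) (ltn_ord j) lij) /orP aij.
rewrite -subset0 => x [/=]; rewrite !in_itv/= => /andP[x1 x2] /andP[x3 x4].
by case: aij => h; lra.
Qed.

Lemma partition_pairs (l b : R) (s : seq R) : itv_partition l b s ->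
  [/\ all (fun x => (l <= x.2) && (x.2 <= x.1) && (x.1 <= b)) (zip s (l :: s)),
      pairwise apart (zip s (l :: s)) &
      \sum_(x <- zip s (l :: s)) (x.1 - x.2) = b - l].
Proof.
elim: s l => [l [_ /= /eqP ->]|h t ih l p]; first by rewrite big_nil subrr.
have hb := itv_partition_le (itv_partition_cons p).
have [lh _] : l < h /\ true by case: p => /= /andP[].
have [al pw sm] := ih _ (itv_partition_cons p).
split => /=.
- rewrite lexx (ltW lh) hb /=; apply: sub_all al => x /andP[/andP[x1 ->] ->].
  by rewrite (le_trans (ltW lh) x1).
- rewrite pw andbT; apply: sub_all al => x /andP[/andP[x1 _] _].
  by rewrite /apart /= x1.
- by rewrite big_cons sm /=; lra.
Qed.

(** The total variation of each interval is a supremum over its partitions, so a refinement of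
    the family of intervals nearly attains the sum of the total variations without changing the
    total length. *)
Lemma variation_approx a s (eta : R) : 0 < eta ->
  all (fun x => x.2 <= x.1) s ->
  (forall x, x \in s -> total_variation x.2 x.1 a \is a fin_num) ->
  pairwise apart s ->
  exists s', [/\ forall y, y \in s' -> exists2 x, x \in s &
                   [/\ x.2 <= y.2, y.2 <= y.1 & y.1 <= x.1],
     pairwise apart s',
     \sum_(x <- s') (x.1 - x.2) = \sum_(x <- s) (x.1 - x.2) &
     \sum_(x <- s) fine (total_variation x.2 x.1 a) - eta <=
     \sum_(x <- s') `|a x.1 - a x.2|].
Proof.
elim: s eta => [|[r l] s ih] eta e0 /=.
  by exists [::]; rewrite !big_nil; split => //; lra.
move=> /andP[lr al] fin /andP[al1 pw].
have fs : forall x, x \in s -> total_variation x.2 x.1 a \is a fin_num.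
  by move=> x xs; apply: fin; rewrite inE xs orbT.
have e20 : 0 < eta / 2 by lra.
have [s1 [h1 h2 h3 h4]] := ih _ e20 al fs pw.
have fin0 := fin (r, l) (mem_head _ _).
have [_ [_ [p pp <-] <-] hp] := ub_ereal_sup_adherent e20 fin0.
have [/= q1 q2 q3] := partition_pairs pp.
exists (zip p (l :: p) ++ s1); split.
- move=> y; rewrite mem_cat => /orP[/(allP q1)/andP[/andP[y1 y2] y3]|].
    by exists (r, l); [exact: mem_head|split].
  by move=> /h1[x xs hx]; exists x => //; rewrite inE xs orbT.
- rewrite pairwise_cat q2 h2 !andbT; apply/allrelP => x y /(allP q1)/andP[/andP[x1 x2] x3].
  move=> /h1[z zs [z1 z2 z3]]; have := allP al1 _ zs; rewrite /apart/=.
  move=> /orP[h|h]; apply/orP; [left|right]; lra.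
- by rewrite big_cat big_cons /= q3 h3.
- rewrite big_cat big_cons /= -(variation_zip _ pp).
  have : fine (total_variation l r a) - eta / 2 <= variation l r a p.
    rewrite -lee_fin EFinB fineK//; exact: ltW.
  move: h4; lra.
Qed.

Lemma ac_bounded_variation (t : R) a : 0 <= t -> abs_continuous_on t a ->
  bounded_variation 0 t a.
Proof.
move=> t0 ac.
have [d d0 H] := ac_seq ac ltr01.
have loc : forall l r, 0 <= l -> l <= r -> r <= t -> r - l < d ->
    total_variation l r a \is a fin_num.
  move=> l r l0 lr rt rl; apply/bounded_variationP => //.
  exists 1 => _ [p pp <-]; have [q1 q2 q3] := partition_pairs pp.
  rewrite variation_zip//; apply/ltW/H => //; last by rewrite q3.
  apply: sub_all q1 => x /andP[/andP[x1 ->] x3].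
  by rewrite (le_trans l0 x1) (le_trans x3 rt).
have [N Nd] : exists N : nat, t / N.+1%:R < d.
  exists (Num.bound (t / d)).
  rewrite ltr_pdivrMr ?ltr0n// mulrC -ltr_pdivrMr//.
  have : 0 <= t / d by rewrite divr_ge0// ltW.
  move=> /archi_boundP /lt_le_trans; apply; by rewrite ler_nat.
have h0 : 0 <= t / N.+1%:R by rewrite divr_ge0.
suff K : forall k, (k <= N.+1)%N -> total_variation 0 (k%:R * (t / N.+1%:R)) a \is a fin_num.
  apply/bounded_variationP => //.
  by have := K N.+1 (leqnn _); rewrite mulrC divfK// pnatr_eq0.
elim=> [_|k ih kN]; first by rewrite mul0r total_variationxx.
have k0 : 0 <= k%:R * (t / N.+1%:R) by rewrite mulr_ge0.
have E : k.+1%:R * (t / N.+1%:R) = k%:R * (t / N.+1%:R) + t / N.+1%:R by rewrite -natr1 mulrDl mul1r.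
rewrite E (@total_variationD _ _ _ (k%:R * (t / N.+1%:R)))//; last by rewrite lerDl.
rewrite fin_numD ih 1?ltnW//=; apply: loc => //; [by rewrite lerDl| |by rewrite [ltLHS]addrAC subrr add0r].
rewrite -E -[leRHS](_ : N.+1%:R * (t / N.+1%:R) = t); last by rewrite mulrC divfK// pnatr_eq0.
by rewrite ler_wpM2r// ler_nat.
Qed.

(** The intervals of a family of small length are refined so that the variation sums nearly
    reach the total variations; the refined family is still short, so absolute continuity bounds
    its sum. *)
Lemma ac_total_variation (t : R) a : 0 <= t -> abs_continuous_on t a ->
  forall e, 0 < e -> exists2 dlt : R, 0 < dlt & forall s : seq (R * R),
    all (fun x => (0 <= x.2) && (x.2 <= x.1) && (x.1 <= t)) s ->
    pairwise apart s ->
    \sum_(x <- s) (x.1 - x.2) < dlt ->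
    \sum_(x <- s) fine (total_variation x.2 x.1 a) < e.
Proof.
move=> t0 ac e e0; have e20 : 0 < e / 2 by lra.
have [d d0 H] := ac_seq ac e20; exists d => // s al pw sd.
have bv := ac_bounded_variation t0 ac.
have fin x : x \in s -> total_variation x.2 x.1 a \is a fin_num.
  move=> /(allP al)/andP[/andP[x1 x2] x3]; apply/bounded_variationP => //.
  by apply: (bounded_variationl x2 x3); apply: (bounded_variationr x1 _ bv); exact: le_trans x3.
have [|s' [h1 h2 h3 h4]] := variation_approx e20 _ fin pw.
  by apply: sub_all al => x /andP[/andP[]].
have : \sum_(x <- s') `|a x.1 - a x.2| < e / 2.
  apply: H => //; last by rewrite h3.
  apply/allP => y /h1[x /(allP al)/andP[/andP[x1 x2] x3] [? ? ?]].
  by apply/andP; split; first (apply/andP; split); lra.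
by lra.
Qed.

End ac_variation.


(** * Absolutely continuous functions are integrals of their derivatives *)

Section ac_density.
Context {R : realType}.
Notation mu := (@lebesgue_measure R).

(** Extends a function from [0, T] to the line by constants. *)
Definition clamp (T x : R) : R := Num.min (Num.max x 0) T.

Lemma clamp_itv T x : 0 <= T -> 0 <= clamp T x <= T.
Proof.
by move=> T0; rewrite /clamp ge_min lexx orbT andbT le_min T0 andbT le_max lexx orbT.
Qed.

Lemma clamp_id T x : 0 <= x <= T -> clamp T x = x.
Proof. by move=> /andP[x0 xT]; rewrite /clamp; rewrite max_l// min_l. Qed.

Lemma clamp_le T x y : x <= y -> clamp T x <= clamp T y.
Proof.
move=> xy; rewrite /clamp le_min !ge_min lexx orbT andbT.
by rewrite ge_max !le_max xy lexx !orbT.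
Qed.

Lemma clamp_lip T x y : x <= y -> clamp T y - clamp T x <= y - x.
Proof.
move=> xy; rewrite /clamp /Num.min /Num.max.
case: (ltrP y 0) => ?; case: (ltrP x 0) => ?; case: ltrP => ?; case: ltrP => ?; lra.
Qed.

Lemma open_itvE (I : set R) (c e : R) : open I -> is_interval I -> I `<=` `[c, e] ->
  c <= e -> exists l r, [/\ c <= l, l < r \/ (l = c /\ r = c), r <= e & I = `]l, r[%classic].
Proof.
move=> oI iI Ice ce; have [->|/set0P[x Ix]] := eqVneq I set0.
  by exists c, c; split => //; [right|rewrite set_itvE].
have hl : has_lbound I by exists c => y /Ice /=; rewrite in_itv/= => /andP[].
have hu : has_ubound I by exists e => y /Ice /=; rewrite in_itv/= => /andP[].
have IE : I = [set r | inf I < r < sup I].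
  by rewrite -interval_bounded_interior//; exact/esym/interior_id.
have : inf I < x < sup I by rewrite IE in Ix.
move=> /andP[x1 x2].
exists (inf I), (sup I); split.
- apply: lb_le_inf; first by exists x.
  by move=> y /Ice /=; rewrite in_itv/= => /andP[].
- left; lra.
- apply: ge_sup; first by exists x.
  by move=> y /Ice /=; rewrite in_itv/= => /andP[].
- by rewrite {1}IE; apply/seteqP; split => y /=; rewrite in_itv/=.
Qed.

(** The Stieltjes measure of G is dominated by Lebesgue measure: a null set is
    covered by disjoint open intervals of small total length, on which G has a small increment by
    absolute continuity. The density is given by the Radon-Nikodym theorem. *)
Lemma nondecreasing_ac_density (T : R) (G : R -> R) : 0 < T ->
  {in `[0, T] &, nondecreasing_fun G} ->
  (forall e, 0 < e -> exists2 dlt : R, 0 < dlt & forall s : seq (R * R),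
    all (fun x => (0 <= x.2) && (x.2 <= x.1) && (x.1 <= T)) s ->
    pairwise apart s ->
    \sum_(x <- s) (x.1 - x.2) < dlt ->
    \sum_(x <- s) (G x.1 - G x.2) < e) ->
  exists f : R -> R, mu.-integrable setT (EFin \o f) /\
    forall s t, 0 <= s -> s <= t -> t <= T ->
      (\int[mu]_(x in `]s, t]) (f x)%:E = (G t - G s)%:E)%E.
Proof.
move=> T0 ndG acG.
have cin x : clamp T x \in `[0, T] by rewrite in_itv/= clamp_itv// ltW.
pose Gc x := G (clamp T x).
have nd : nondecreasing Gc by move=> x y xy; apply: ndG => //; exact: clamp_le.
have rc : right_continuous Gc.
  move=> x; apply/cvgrPdist_lt => e e0; have [d d0 H] := acG e e0.
  near=> y; have xy : x < y by near: y; exact: nbhs_right_gt.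
  rewrite ler0_norm; last by rewrite subr_le0 nd// ltW.
  have := H [:: (clamp T y, clamp T x)]; rewrite /= !big_seq1/= andbT opprB.
  apply => //.
    move: (cin x) (cin y); rewrite !in_itv/= => /andP[-> _] /andP[_ ->].
    by rewrite clamp_le// ltW.
  apply: le_lt_trans (clamp_lip _ (ltW xy)) _; rewrite ltrBlDl.
  by near: y; apply: nbhs_right_lt; rewrite ltrDl.
pose C : cumulative R R := HB.pack Gc (isCumulative.Build R _ R Gc nd rc).
pose nu := lebesgue_stieltjes_measure C.
have nuE a b : a <= b -> nu `]a, b]%classic = (Gc b - Gc a)%:E.
  move=> ab; apply: etrans (measurable_mu_extE (wlength C) (is_ocitv a b)) _.
  exact: wlength_itv_bnd.
pose D : set (measurableTypeR R) := `]0, T]%classic.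
have mD : measurable D by exact: measurable_itv.
have nuD : (nu D < +oo)%E by rewrite nuE ?ltW// ltry.
have dom : mfrestr mD nuD `<< mu.
  move=> A Anull B mB BA; apply/eqP; rewrite eq_le measure_ge0 andbT.
  rewrite /mfrestr /mrestr.
  have mBD : measurable (B `&` D) by exact: measurableI.
  have muBD : mu (B `&` D) = 0%E.
    by apply: Anull => //; apply: subset_trans BA; exact: subIsetl.
  apply/lee_addgt0Pr => e e0; rewrite add0e; have [d d0 H] := acG e e0.
  have [|U0 [oU0 BU0 U0d]] := lebesgue_regularity_outer mBD _ d0.
    by rewrite [ltLHS]muBD ltry.
  pose U := U0 `&` `](-1), (T + 1)[%classic.
  have oU : open U by apply: openI => //; exact: interval_open.
  have mU : measurable U by exact: open_measurable.
  have BU : B `&` D `<=` U.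
    move=> x [Bx Dx]; split; first by apply: BU0.
    by move: Dx; rewrite /D /= !in_itv/= => /andP[x1 x2]; apply/andP; split; lra.
  have Ud : (mu U < d%:E)%E.
    have mU0 : measurable U0 by exact: open_measurable.
    apply: le_lt_trans U0d.
    apply: (@le_trans _ _ (mu ((U0 `\` (B `&` D)) `|` (B `&` D)))).
      apply: le_measure; rewrite ?inE//; first by apply: measurableU => //; exact: measurableD.
      move=> x [Ux _]; have [h|h] := pselect ((B `&` D) x); [by right|by left; split].
    apply: le_trans (measureU2 _ _ _) _ => //; first exact: measurableD.
    by rewrite [X in (_ + X)%E]muBD adde0.
  pose I := open_disjoint_itv oU.
  have IU k : I k `<=` U.
    by rewrite [X in _ `<=` X](open_disjoint_itv_bigcup oU); exact: bigcup_sup.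
  have mI k : measurable (I k) by apply: open_measurable; exact: open_disjoint_itv_open.
  have /choice[lr Hlr] : forall k, exists lr : R * R,
      [/\ -1 <= lr.2, lr.2 < lr.1 \/ (lr.2 = -1 /\ lr.1 = -1), lr.1 <= T + 1 & I k = `]lr.2, lr.1[%classic].
    move=> k; have Ik : I k `<=` `[(-1), (T + 1)].
      by move=> x /IU[_] /=; rewrite !in_itv/= => /andP[x1 x2]; apply/andP; split; lra.
    have T1 : -1 <= T + 1 by lra.
    have oIk : open (I k) by exact: open_disjoint_itv_open.
    have iIk : is_interval (I k) by exact: open_disjoint_itv_is_interval.
    by have [l [r [h1 h2 h3 h4]]] := open_itvE oIk iIk Ik T1; exists (r, l).
  have tI : trivIset setT I by exact: open_disjoint_itv_trivIset.
  have mID k : measurable (I k `&` D : set (measurableTypeR R)).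
    exact: (measurableI _ _ (mI k) mD).
  have ndlr k : (lr k).2 <= (lr k).1 by have [_ [/ltW//|[-> ->]//] _ _] := Hlr k.
  have ap i j : (i < j)%N -> apart (lr i) (lr j).
    move=> ij; apply/negP => /negP; rewrite /apart !negb_or -!ltNge => /andP[h1 h2].
    have /trivIsetP/(_ i j Logic.I Logic.I) := tI; rewrite ltn_eqF// => /(_ isT).
    rewrite -/(I i) -/(I j) -subset0.
    have [i0 [i2|[_ i2]] i1 ->] := Hlr i; have [j0 [j2|[_ j2]] j1 ->] := Hlr j; try lra.
    pose m := Num.max (lr i).2 (lr j).2; pose M := Num.min (lr i).1 (lr j).1.
    have mM : m < M by rewrite /m /M lt_min !gt_max i2 j2 h1 h2.
    move=> /(_ ((m + M) / 2)); apply.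
    have m1 : (lr i).2 <= m by rewrite /m le_max lexx.
    have m2 : (lr j).2 <= m by rewrite /m le_max lexx orbT.
    have M1 : M <= (lr i).1 by rewrite /M ge_min lexx.
    have M2 : M <= (lr j).1 by rewrite /M ge_min lexx orbT.
    have [mid1 mid2] := midf_lt mM.
    by split; rewrite /= in_itv/=; apply/andP; split;
      [exact: le_lt_trans m1 mid1|exact: lt_le_trans mid2 M1
      |exact: le_lt_trans m2 mid1|exact: lt_le_trans mid2 M2].
  have step n : (\sum_(0 <= k < n) nu (I k `&` D) <= e%:E)%E.
    pose s := [seq (clamp T (lr k).1, clamp T (lr k).2) | k <- index_iota 0 n].
    apply: (@le_trans _ _ (\sum_(x <- s) (G x.1 - G x.2))%:E).
      rewrite /s big_map /= -sumEFin; apply: lee_sum => k _.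
      rewrite -nuE//; apply: le_measure; rewrite ?inE//.
      have [_ _ _ ->] := Hlr k; move=> x [/=]; rewrite !in_itv/= => /andP[-> x2] _.
      exact: ltW.
    rewrite lee_fin; apply/ltW/H.
    - apply/allP => _ /mapP[k _ ->] /=.
      move: (cin (lr k).1) (cin (lr k).2); rewrite !in_itv/= => /andP[_ ->] /andP[-> _].
      by rewrite clamp_le.
    - rewrite /s pairwise_map.
      have : pairwise ltn (index_iota 0 n).
        by rewrite -sorted_pairwise; [exact: iota_ltn_sorted|exact: ltn_trans].
      apply: sub_pairwise => i j ij /=; rewrite /apart/=.
      by case/orP: (ap i j ij) => h; rewrite (clamp_le _ h) ?orbT.
    - rewrite -lte_fin; apply: le_lt_trans Ud.
      apply: (@le_trans _ _ (\sum_(0 <= k < n) mu (I k))%E).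
        rewrite /s big_map /= -sumEFin; apply: lee_sum => k _.
        have [_ _ _ ->] := Hlr k; rewrite lebesgue_measure_itv /= lte_fin.
        case: ifPn => [h|]; first by rewrite lee_fin clamp_lip// ltW.
        rewrite -leNgt => h; have -> : (lr k).1 = (lr k).2 by apply/eqP; rewrite eq_le h ndlr.
        by rewrite subrr.
      rewrite big_mkord -measure_bigsetU//.
      have mIn : measurable (\big[setU/set0]_(i < n) I i) by exact: bigsetU_measurable.
      apply: le_measure; rewrite ?inE//.
      by move=> x; rewrite -bigcup_mkord => -[k _ /IU].
  apply: (@le_trans _ _ (\sum_(0 <= k <oo) nu (I k `&` D))%E).
    apply: (@le_trans _ _ (nu (\bigcup_k (I k `&` D)))).
      apply: le_measure; rewrite ?inE//.
        by apply: bigcup_measurable => k _; exact: mID.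
      move=> x BDx; have := BU _ BDx; rewrite [X in X x](open_disjoint_itv_bigcup oU).
      by move=> [k _ Ikx]; exists k => //; split => //; case: BDx.
    apply: measure_sigma_subadditive => //.
    by apply: bigcup_measurable => k _; exact: mID.
  apply: lime_le; first by apply: is_cvg_nneseries.
  by apply: nearW => n; exact: step.
have [f [f0 ffin intf fE]] := radon_nikodym_sigma_finite dom.
exists (fine \o f); split.
  by rewrite [X in _.-integrable _ X](_ : _ = f)//; apply/funext => x /=; rewrite fineK.
move=> s t s0 st tT.
under eq_integral do rewrite fineK//.
apply: etrans (esym (fE _ (measurable_itv _))) _.
change (nu (`]s, t]%classic `&` D) = (G t - G s)%:E); rewrite setIidl.
  by rewrite nuE// /Gc !clamp_id// ?s0 ?(le_trans st)//= ?(le_trans s0).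
move=> x; rewrite /D /= !in_itv/= => /andP[h1 h2]; apply/andP; split; lra.
Unshelve. all: by end_near. Qed.

(** The function is V - (V - a) with V its total variation, and both terms are nondecreasing and
    absolutely continuous, so each is the integral of a density. Lebesgue's differentiation theorem
    identifies the derivative with the difference of the densities almost everywhere. *)
Lemma ac_FTC (T : R) (a : R -> R) : 0 < T -> abs_continuous_on T a ->
  exists g : R -> R, [/\ mu.-integrable setT (EFin \o g),
    forall s t, 0 <= s -> s <= t -> t <= T ->
      (\int[mu]_(x in `]s, t]) (g x)%:E = (a t - a s)%:E)%E &
    {ae mu, forall x, 0 < x < T -> a^`()%classic x = g x}].
Proof.
move=> T0 ac; have bv := ac_bounded_variation (ltW T0) ac.
have fin l r : 0 <= l -> l <= r -> r <= T -> total_variation l r a \is a fin_num.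
  move=> l0 lr rT; apply/bounded_variationP => //.
  by apply: (bounded_variationl lr rT); apply: (bounded_variationr l0 _ bv); exact: le_trans rT.
pose V x := fine (total_variation 0 x a).
have VD l r : 0 <= l -> l <= r -> r <= T -> V r - V l = fine (total_variation l r a).
  move=> l0 lr rT; rewrite /V (total_variationD _ l0 lr) fineD ?fin//; last by rewrite (le_trans lr).
  by rewrite addrAC subrr add0r.
have aV l r : 0 <= l -> l <= r -> r <= T -> `|a r - a l| <= V r - V l.
  move=> l0 lr rT; rewrite VD// -lee_fin fineK ?fin//.
  exact: total_variation_ge.
have acV := ac_total_variation (ltW T0) ac.
have [f1 [intf1 f1E]] : exists f : R -> R, mu.-integrable setT (EFin \o f) /\
    forall s t, 0 <= s -> s <= t -> t <= T ->
      (\int[mu]_(x in `]s, t]) (f x)%:E = (V t - V s)%:E)%E.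
  apply: nondecreasing_ac_density => //.
    move=> x y; rewrite !in_itv/= => /andP[x0 xT] /andP[y0 yT] xy.
    by rewrite -subr_ge0 (le_trans _ (aV _ _ _ _ _)).
  move=> e e0; have [d d0 H] := acV _ e0; exists d => // s al pw sd.
  rewrite big_seq (eq_bigr (fun x => fine (total_variation x.2 x.1 a))) -?big_seq.
    exact: H.
  by move=> x /(allP al)/andP[/andP[x1 x2] x3]; rewrite VD.
have [f2 [intf2 f2E]] : exists f : R -> R, mu.-integrable setT (EFin \o f) /\
    forall s t, 0 <= s -> s <= t -> t <= T ->
      (\int[mu]_(x in `]s, t]) (f x)%:E = ((V t - a t) - (V s - a s))%:E)%E.
  apply: (@nondecreasing_ac_density _ (fun x => V x - a x)) => //.
    move=> x y; rewrite !in_itv/= => /andP[x0 xT] /andP[y0 yT] xy.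
    have := aV _ _ x0 xy yT; have := ler_norm (a y - a x); lra.
  move=> e e0; have e20 : 0 < e / 2 by lra.
  have [d d0 H] := acV _ e20; exists d => // s al pw sd.
  apply: (@le_lt_trans _ _ (\sum_(x <- s) 2 * fine (total_variation x.2 x.1 a))).
    rewrite big_seq [leRHS]big_seq; apply: ler_sum => x /(allP al)/andP[/andP[x1 x2] x3].
    rewrite -VD//; have := aV _ _ x1 x2 x3.
    have := ler_norm (- (a x.1 - a x.2)); rewrite normrN; lra.
  by rewrite -mulr_sumr; have := H s al pw sd; lra.
pose g x := f1 x - f2 x.
have intg : mu.-integrable setT (EFin \o g).
  rewrite [X in _.-integrable _ X](_ : _ = (EFin \o f1) \- (EFin \o f2))%E//.
  exact: integrableB.
have gE s t : 0 <= s -> s <= t -> t <= T ->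
      (\int[mu]_(x in `]s, t]) (g x)%:E = (a t - a s)%:E)%E.
  move=> s0 st tT; under eq_integral do rewrite /g EFinB.
  rewrite integralB//; last 2 first.
    by apply: integrableS intf1.
    by apply: integrableS intf2.
  by rewrite f1E// f2E// -EFinB; congr (_%:E); lra.
exists g; split => //.
pose F x := (\int[mu]_(t in `]-oo, x]) g t)%R.
have locg : locally_integrable setT g.
  by have := integrable_locally measurableT intg; rewrite patch_setT.
have intS (A : set R) : measurable A -> mu.-integrable A (EFin \o g).
  by move=> mA; apply: integrableS intg.
have := FTC1Ny (fun y => intS _ (measurable_itv _)) locg.
apply: filterS; first exact: (ae_filter_ringOfSetsType mu).
move=> x [dF FE] /andP[x0 xT]; rewrite -FE.
have FaE y : 0 < y <= T -> F y = a y - a 0 + F 0.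
  move=> /andP[y0 yT]; rewrite /F.
  have -> : `]-oo, y]%classic = `]-oo, (0:R)] `|` `]0, y] :> set R.
    by rewrite -itv_bndbnd_setU// bnd_simp ltW.
  rewrite Rintegral_setU//=.
  - by rewrite addrC; congr (_ + _); rewrite /Rintegral gE// ltW.
  - by apply: intS; apply: measurableU.
  - by apply/disj_setPS => z /=; rewrite !in_itv/= => -[z1 /andP[z2 _]]; lra.
rewrite !derive1E.
have -> : 'D_1 F x = 'D_1 (fun y => a y - a 0 + F 0) x.
  apply: near_eq_derive; near=> y; apply: FaE; apply/andP; split.
    by rewrite -oppr_lt0; near: y; apply: Nlt_nbhsl; rewrite oppr_lt0.
  by apply/ltW; near: y; exact: lt_nbhsl.
have shiftE (b : R -> R) (c : R) : 'D_1 (fun y => b y + c) x = 'D_1 b x.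
  rewrite /derive; set p := (X in lim (X @ _)); set q := (X in _ = lim (X @ _)).
  suff -> : p = q by [].
  by apply/funext => h; rewrite /p /q /=; congr (_ *: _); lra.
rewrite -[RHS](shiftE _ (a 0 - F 0)); congr ('D_1 _ x); apply/funext => y.
by rewrite /=; lra.
Unshelve. all: by end_near. Qed.

End ac_density.


(** * The law of an i.i.d. sequence *)

Section seq_space.
Context {R : realType}.

Definition cylinders : set (set (nat -> R)) :=
  [set B | exists k (A : nat -> set R), (forall i, measurable (A i)) /\
     B = [set x | forall i, (i < k)%N -> A i (x i)]].

Definition seqR := g_sigma_algebraType cylinders.

Definition shift (k : nat) (x : nat -> R) : nat -> R := fun i => x (k + i)%N.
Definition determined (k : nat) (B : set seqR) :=
  forall x y : seqR, (forall i, (i < k)%N -> x i = y i) -> B x -> B y.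

Lemma cylinders_setI : setI_closed cylinders.
Proof.
move=> _ _ [k [A [mA ->]]] [l [B [mB ->]]].
exists (maxn k l), (fun i => (if (i < k)%N then A i else setT) `&`
                             (if (i < l)%N then B i else setT)); split.
  by move=> i; apply: measurableI; case: ifP.
apply/seteqP; split => x /=.
  by move=> [h1 h2] i; split; case: ifP => // ?; [apply: h1|apply: h2].
move=> h; split => i ik.
  by have [] := h i (leq_trans ik (leq_maxl _ _)); rewrite ik.
by have [] := h i (leq_trans ik (leq_maxr _ _)); rewrite ik.
Qed.

Lemma cylindersT : cylinders setT.
Proof. by exists 0%N, (fun=> setT); split => //; apply/seteqP; split. Qed.

(** The cylinders form a pi-system that generates the measurable sets. *)
Lemma seqR_unique (m1 m2 : {measure set seqR -> \bar R}) : (m1 setT < +oo)%E ->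
  (forall B, cylinders B -> m1 B = m2 B) -> forall B, measurable B -> m1 B = m2 B.
Proof.
move=> m1oo m12 B mB; apply: (@measure_unique _ R seqR cylinders (fun=> setT) _ _ _ _ m1 m2) => //.
- exact: cylinders_setI.
- by move=> _; exact: cylindersT.
- by rewrite bigcup_const.
Qed.

Lemma measurable_coord (i : nat) : measurable_fun setT (fun x : seqR => x i).
Proof.
move=> _ A mA; rewrite setTI; apply: sub_sigma_algebra.
exists i.+1, (fun j => if j == i then A else setT); split.
  by move=> j; case: ifP.
apply/seteqP; split => x /=.
  by move=> Ax j _; case: ifP => // /eqP ->.
by move=> /(_ i (leqnn _)); rewrite eqxx.
Qed.

Lemma measurable_toseq d (T : measurableType d) (f : T -> seqR) :
  (forall i, measurable_fun setT (fun w => f w i)) -> measurable_fun setT f.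
Proof.
move=> mf; apply: (@measurability _ _ T seqR setT f cylinders) => // _ [_ [k [A [mA ->]]] <-].
rewrite setTI (_ : _ @^-1` _ = \bigcap_(i in [set i | (i < k)%N]) ((fun w => f w i) @^-1` A i)).
  apply: bigcap_measurableType => i _; rewrite -[X in measurable X]setTI; exact: mf.
by apply/seteqP; split => x /= h i; exact: h.
Qed.

Lemma measurable_shift k : measurable_fun setT (shift k : seqR -> seqR).
Proof. by apply: measurable_toseq => i; exact: measurable_coord. Qed.

Lemma measurable_preshift k (B : set seqR) : measurable B ->
  measurable (shift k @^-1` B : set seqR).
Proof. by move=> mB; rewrite -[X in measurable X]setTI; exact: measurable_shift. Qed.

Definition trunc (k : nat) (x : nat -> R) : nat -> R := fun i => if (i < k)%N then x i else 0.

Lemma measurable_trunc k : measurable_fun setT (trunc k : seqR -> seqR).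
Proof.
apply: measurable_toseq => i; rewrite /trunc.
by have [_|_] := boolP (i < k)%N; [exact: measurable_coord|exact: measurable_cst].
Qed.

(** The law of an i.i.d. sequence is characterized by the renewal property: an event depending
    on the first k terms is independent of the sequence shifted by k, which has the same law. *)
Definition iid_law (Q : probability seqR R) :=
  forall k (B C : set seqR), measurable B -> measurable C -> determined k B ->
    Q (B `&` shift k @^-1` C) = (Q B * Q C)%E.

Section canonical.
Context d (Omega : measurableType d) (P : probability Omega R)
  (U : nat -> {RV P >-> R}).
Hypothesis U_iid : iid U.

(** The increments after time a; the walk at time a + 1 uses the increment of index a + 1. *)
Definition blk (a : nat) (w : Omega) : seqR := fun i => U (a + i).+1 w.

Lemma measurable_blk a : measurable_fun setT (blk a).
Proof. by apply: measurable_toseq => i; rewrite /blk. Qed.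

Lemma cylinder_prob a k (A : nat -> set R) : (forall i, measurable (A i)) ->
  P (blk a @^-1` [set x | forall i, (i < k)%N -> A i (x i)]) =
  (\prod_(i < k) P (U 0%N @^-1` A i))%E.
Proof.
move=> mA; have [ind idd] := U_iid.
pose J := [fset i in iota a.+1 k]%fset.
have := ind J (fun i => A (i - a.+1)%N) (fun i => mA _).
have -> : \bigcap_(i in [set` J]) (U i @^-1` A (i - a.+1)%N) =
          blk a @^-1` [set x | forall i, (i < k)%N -> A i (x i)].
  apply/seteqP; split => w /=.
    move=> h i ik; have := h (a.+1 + i)%N; rewrite /= addKn; apply.
    by rewrite /J !inE mem_iota leq_addr ltn_add2l.
  move=> h i; rewrite /J /= !inE mem_iota => /andP[ai iak].
  have := h (i - a.+1)%N; rewrite /blk -addSn subnKC//; apply.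
  by rewrite ltn_subLR.
move=> ->; rewrite (perm_big (iota a.+1 k)) /=; last first.
  by apply: uniq_perm; rewrite ?fset_uniq ?iota_uniq// => i; rewrite !inE.
rewrite -[a.+1]addn0 iotaDl big_map /=.
have -> : iota 0 k = index_iota 0 k by rewrite /index_iota subn0.
rewrite big_mkord; apply: eq_bigr => i _; rewrite addn0 addKn; exact: (idd _ 0%N _ (mA i)).
Qed.

(** The joint law of past and future is a product by two applications of uniqueness: first for
    cylinders of the future and an arbitrary event of the past, then for cylinders of the past.
    An event that depends on the first k terms is the preimage of itself under truncation, hence
    determined by the past. *)
Lemma iid_canonical : exists Q : probability seqR R, iid_law Q /\
  forall a B, measurable B -> P (blk a @^-1` B) = Q B.
Proof.
pose f (a : nat) : {mfun Omega >-> seqR} := HB.pack (blk a) (isMeasurableFun.Build _ _ _ _ (blk a) (measurable_blk a)).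
have mpre (h : Omega -> seqR) (B : set seqR) : measurable_fun setT h -> measurable B -> measurable (h @^-1` B).
  by move=> mh mB; rewrite -[X in measurable X]setTI; exact: mh.
exists (distribution P (f 0%N)).
have stat a B : measurable B -> P (blk a @^-1` B) = distribution P (f 0%N) B.
  move=> mB; apply: (@seqR_unique (distribution P (f a)) (distribution P (f 0%N))) => //.
    by change (P (f a @^-1` setT) < +oo)%E; rewrite preimage_setT probability_setT ltry.
  by move=> _ [k [A [mA ->]]]; exact: etrans (cylinder_prob _ _ mA) (esym (cylinder_prob _ _ mA)).
split=> // k B C mB mC detB.
pose tb : Omega -> seqR := trunc k \o blk 0.
have key (B' C' : set seqR) : measurable B' -> measurable C' ->
   P (tb @^-1` B' `&` blk k @^-1` C') =
   (P (tb @^-1` B') * P (blk k @^-1` C'))%E.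
  move=> mB' mC'.
  have mt : measurable_fun setT tb.
    by apply: measurableT_comp; [exact: measurable_trunc|exact: measurable_blk].
  pose E := tb @^-1` B'; have mE : measurable E by exact: mpre.
  have PE : P E \is a fin_num by exact: fin_num_measure.
  pose c : {nonneg R} := NngNum (fine_ge0 (measure_ge0 P E)).
  have -> : (P E * P (blk k @^-1` C') = mscale c (distribution P (f k)) C')%E.
    change (P E * P (blk k @^-1` C') = (fine (P E))%:E * P (blk k @^-1` C'))%E.
    by rewrite fineK.
  pose m1 := pushforward (mrestr P mE) (f k).
  rewrite setIC; change (m1 C' = mscale c (distribution P (f k)) C').
  apply: (@seqR_unique m1 (mscale c (distribution P (f k)))) => //.
    by change (P (f k @^-1` setT `&` E) < +oo)%E; rewrite preimage_setT setTI ltey_eq PE.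
  move=> _ [l [A [mA ->]]].
  pose D := [set x : seqR | forall i, (i < l)%N -> A i (x i)].
  have mD : measurable D by apply: sub_sigma_algebra; exists l, A.
  have mF : measurable (blk k @^-1` D) by exact: mpre (measurable_blk _) mD.
  have PF : P (blk k @^-1` D) \is a fin_num by exact: fin_num_measure.
  pose c' : {nonneg R} := NngNum (fine_ge0 (measure_ge0 P (blk k @^-1` D))).
  pose g : {mfun Omega >-> seqR} := HB.pack tb (isMeasurableFun.Build _ _ _ _ _ mt).
  change (P (blk k @^-1` D `&` E) = (fine (P E))%:E * P (blk k @^-1` D))%E.
  rewrite fineK// setIC.
  have -> : (P E * P (blk k @^-1` D) = mscale c' (distribution P g) B')%E.
    change (P E * P (blk k @^-1` D) = (fine (P (blk k @^-1` D)))%:E * P E)%E.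
    by rewrite fineK// muleC.
  pose m2 := pushforward (mrestr P mF) g.
  change (m2 B' = mscale c' (distribution P g) B').
  apply: (@seqR_unique m2 (mscale c' (distribution P g))) => //.
    by change (P (g @^-1` setT `&` (blk k @^-1` D)) < +oo)%E; rewrite preimage_setT setTI ltey_eq PF.
  move=> _ [j [G [mG ->]]].
  change (P (tb @^-1` [set x | forall i, (i < j)%N -> G i (x i)] `&` blk k @^-1` D) =
    (fine (P (blk k @^-1` D)))%:E * P (tb @^-1` [set x | forall i, (i < j)%N -> G i (x i)]))%E.
  rewrite fineK// muleC.
  have [G0|G0] := pselect (forall i, (k <= i < j)%N -> G i 0); last first.
    have -> : tb @^-1` [set x | forall i, (i < j)%N -> G i (x i)] = set0.
      apply/seteqP; split => // w /= h; apply: G0 => i /andP[ki ij].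
      by have := h i ij; rewrite /tb /= /trunc ltnNge ki.
    by rewrite set0I measure0 mul0e.
  pose G' i := if (i < k)%N then (if (i < j)%N then G i else setT) else setT.
  have mG' i : measurable (G' i) by rewrite /G'; case: ifP => // _; case: ifP.
  have -> : tb @^-1` [set x | forall i, (i < j)%N -> G i (x i)] =
            blk 0 @^-1` [set x | forall i, (i < k)%N -> G' i (x i)].
    apply/seteqP; split => w /= h i ik.
      rewrite /G' ik; case: ifP => // ij.
      by have := h i ij; rewrite /tb /= /trunc ik.
    rewrite /tb /= /trunc; case: ifPn => ik'.
      by have := h i ik'; rewrite /G' ik' ik.
    by apply: G0; rewrite leqNgt ik'.
  pose H i := if (i < k)%N then G' i else A (i - k)%N.
  have mH i : measurable (H i) by rewrite /H; case: ifP.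
  have -> : blk 0 @^-1` [set x | forall i, (i < k)%N -> G' i (x i)] `&` blk k @^-1` D =
            blk 0 @^-1` [set x | forall i, (i < k + l)%N -> H i (x i)].
    apply/seteqP; split => w /=.
      move=> [h1 h2] i ikl; rewrite /H; case: ifPn => ik; first exact: h1.
      rewrite -leqNgt in ik; have := h2 (i - k)%N; rewrite /blk subnKC//; apply.
      by rewrite ltn_subLR.
    move=> h; split => i il.
      by have := h i (leq_trans il (leq_addr _ _)); rewrite /H il.
    have := h (k + i)%N; rewrite ltn_add2l => /(_ il).
    by rewrite /H ltnNge leq_addr /= addKn.
  rewrite !cylinder_prob// big_split_ord /=; congr (_ * _)%E.
    by apply: eq_bigr => i _; rewrite /H ltn_ord.
  by apply: eq_bigr => i _; rewrite /H ltnNge leq_addr /= addKn.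
have detE : blk 0 @^-1` B = tb @^-1` B.
  by apply/seteqP; split => w /=; apply: detB => i ik; rewrite /tb /= /trunc ik.
apply: etrans _ (congr1 (fun z => (distribution P (f 0%N) B * z)%E) (stat k C mC)).
change (P (blk 0 @^-1` B `&` blk k @^-1` C) = P (blk 0 @^-1` B) * P (blk k @^-1` C))%E.
by rewrite [in LHS]detE [in RHS]detE -key.
Qed.

End canonical.
End seq_space.


(** * Independence, moment generating function and Chernoff's bound *)

Section iid_law.
Context {R : realType} (Q : probability (@seqR R) R).
Hypothesis Qiid : iid_law Q.
Notation seqR := (@seqR R).

Lemma determinedT k : determined k (setT : set seqR). Proof. by []. Qed.

Lemma iid_law_shift k (C : set seqR) : measurable C -> Q (shift k @^-1` C) = Q C.
Proof.
move=> mC; have := Qiid measurableT mC (@determinedT k).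
by rewrite setTI probability_setT mul1e.
Qed.

Lemma measurable_blocks k N (B : nat -> set seqR) : (forall r, measurable (B r)) ->
  measurable ([set x : seqR | forall r, (r < N)%N -> B r (shift (r * k)%N x)]).
Proof.
move=> mB; rewrite (_ : [set x : seqR | _] =
    \bigcap_(r in [set r | (r < N)%N]) (shift (r * k)%N @^-1` B r)).
  by apply: bigcap_measurableType => i _; exact: measurable_preshift.
by apply/seteqP; split => x /= h i; exact: h.
Qed.

Lemma blocks_prob k N (B : nat -> set seqR) : (forall r, measurable (B r)) ->
  (forall r, determined k (B r)) ->
  Q [set x : seqR | forall r, (r < N)%N -> B r (shift (r * k)%N x)] =
  (\prod_(r < N) Q (B r))%E.
Proof.
move=> mB dB; elim: N B mB dB => [|N ih] B mB dB.
  rewrite big_ord0 -[RHS](@probability_setT _ _ _ Q); congr (Q _).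
  by apply/seteqP; split.
rewrite big_ord_recl /= -(ih (fun r => B r.+1)) => //.
apply: etrans (Qiid (mB 0%N) (measurable_blocks k N (fun r => mB r.+1)) (dB 0%N)).
congr (Q _); apply/seteqP; split => x /=.
  move=> h; split; first by have := h 0%N isT; rewrite mul0n.
  move=> r rN; have := h r.+1 rN; congr (B _ _).
  by apply/funext => i; rewrite /shift mulSn addnA.
move=> [h0 h] [|r] rN; first by rewrite mul0n.
have := h r rN; congr (B _ _).
by apply/funext => i; rewrite /shift mulSn addnA.
Qed.

(** Independence is given for events; the integral is computed in the product of the two
    marginal laws. *)
Lemma integral_indep (h : R -> R) (g : seqR -> R) :
  measurable_fun setT h -> measurable_fun setT g ->
  (forall x, 0 <= h x) -> (forall x, 0 <= g x) ->
  (\int[Q]_x (h (x 0%N) * g (shift 1 x))%:E =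
   \int[Q]_x (h (x 0%N))%:E * \int[Q]_x (g x)%:E)%E.
Proof.
move=> mh mg h0 g0.
have mf1 : measurable_fun setT (fun x : seqR => h (x 0%N)).
  by apply: measurableT_comp mh _; exact: measurable_coord.
have mf2 : measurable_fun setT (fun x : seqR => g (shift 1 x)).
  by apply: measurableT_comp mg _; exact: measurable_shift.
pose phi (x : seqR) : R * R := (h (x 0%N), g (shift 1 x)).
have mphi : measurable_fun setT phi by exact: measurable_fun_pair.
pose F : {mfun seqR >-> R} := HB.pack (fun x : seqR => h (x 0%N)) (isMeasurableFun.Build _ _ _ _ _ mf1).
pose G : {mfun seqR >-> R} := HB.pack g (isMeasurableFun.Build _ _ _ _ _ mg).
pose m1 : probability R R := distribution Q F.
pose m2 : probability R R := distribution Q G.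
pose m' := pushforward Q phi.
pose PHI : {mfun seqR >-> (R * R)%type} := HB.pack phi (isMeasurableFun.Build _ _ _ _ _ mphi).
have uniq X : measurable X -> (m1 \x m2)%E X = distribution Q PHI X.
  apply: product_measure_unique => A B mA mB.
  change (Q (phi @^-1` (A `*` B)) = Q (F @^-1` A) * Q (g @^-1` B))%E.
  have mFA : measurable (F @^-1` A) by rewrite -[X in measurable X]setTI; exact: (mf1 measurableT _ mA).
  have mgB : measurable (g @^-1` B) by rewrite -[X in measurable X]setTI; exact: (mg measurableT _ mB).
  have dF : determined 1 (F @^-1` A) by move=> x y xy /=; rewrite /F /= -(xy 0%N).
  exact: etrans (Qiid mFA mgB dF).
pose psi (z : R * R) : \bar R := (`|z.1| * `|z.2|)%:E.
have mpsi : measurable_fun setT psi.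
  apply/measurable_EFinP; apply: measurable_funM.
    by apply: measurableT_comp.
  by apply: measurableT_comp.
have psi0 z : (0 <= psi z)%E by rewrite lee_fin mulr_ge0.
transitivity (\int[distribution Q PHI]_z psi z)%E.
  rewrite ge0_integral_distribution//; apply: eq_integral => x _ /=.
  by rewrite /psi /PHI /= !ger0_norm.
transitivity (\int[m1 \x m2]_z psi z)%E.
  apply: eq_measure_integral => A mA _; exact/esym/uniq.
rewrite fubini_tonelli1//.
transitivity (\int[m1]_x (`|x|%:E * \int[m2]_y `|y|%:E))%E.
  apply: eq_integral => x _; rewrite /fubini_F /psi /=.
  under eq_integral do rewrite EFinM.
  rewrite ge0_integralZl//.
  - apply/measurable_EFinP; exact: normr_measurable.
rewrite ge0_integralZr//; last 2 first.
- by apply/measurable_EFinP; exact: normr_measurable.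
- exact: integral_ge0.
congr (_ * _)%E.
  rewrite ge0_integral_distribution//.
    by apply: eq_integral => x _ /=; rewrite ger0_norm.
  by apply/measurable_EFinP; exact: normr_measurable.
rewrite ge0_integral_distribution//.
  by apply: eq_integral => x _ /=; rewrite ger0_norm.
by apply/measurable_EFinP; exact: normr_measurable.
Qed.

Lemma integral_prod (h : R -> R) m : measurable_fun setT h -> (forall x, 0 <= h x) ->
  (\int[Q]_x (\prod_(i < m) h (x i))%:E = (\int[Q]_x (h (x 0%N))%:E) ^+ m)%E.
Proof.
move=> mh h0; elim: m => [|m ih].
  under eq_integral do rewrite big_ord0.
  apply: etrans (integral_cst Q measurableT 1%E) _; apply: etrans (mul1e _) _.
  exact: (@probability_setT _ _ _ Q).
under eq_integral => x _.
  rewrite big_ord_recl.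
  rewrite (_ : \prod_(i < m) _ = \prod_(i < m) h (shift 1 x i)); last by [].
  over.
rewrite (@integral_indep h (fun x => \prod_(i < m) h (x i)))//.
- by rewrite ih expeS.
- apply: measurable_prod => i _; apply: measurableT_comp mh _.
  exact: measurable_coord.
- by move=> x; apply: prodr_ge0.
Qed.

Definition psum (m : nat) (x : seqR) : R := \sum_(i < m) x i.

Lemma measurable_psum m : measurable_fun setT (psum m).
Proof. by apply: measurable_sum => i; exact: measurable_coord. Qed.

Lemma psumD k l x : psum (k + l) x = psum k x + psum l (shift k x).
Proof. by rewrite /psum big_split_ord. Qed.

(** The moment generating function of one increment. *)
Definition mgf (t : R) : \bar R := (\int[Q]_x (expR (t * x 0%N))%:E)%E.

Lemma mgf_psum t m : (\int[Q]_x (expR (t * psum m x))%:E = mgf t ^+ m)%E.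
Proof.
rewrite -(@integral_prod (fun y => expR (t * y))).
- by apply: eq_integral => x _; rewrite /psum mulr_sumr expR_sum.
- by apply: measurableT_comp => //; exact: measurable_funM.
- by move=> y; exact: expR_ge0.
Qed.

Lemma measurable_psum_ge m a : measurable [set x : seqR | a <= psum m x].
Proof.
rewrite -[X in measurable X]setTI; have := @measurable_psum m measurableT _ (measurable_itv `[a, +oo[).
by congr (measurable (_ `&` _)); apply/seteqP; split => x /=; rewrite in_itv/= andbT.
Qed.

Lemma determined_psum_ge m a : determined m [set x : seqR | a <= psum m x].
Proof.
move=> x y xy /=; rewrite /psum (eq_bigr (fun i : 'I_m => y i))// => i _.
exact: xy.
Qed.

Lemma markov_ge (f : seqR -> R) (c : R) (A : set seqR) : measurable_fun setT f ->
  (forall x, 0 <= f x) -> 0 < c -> measurable A -> (forall x, A x -> c <= f x) ->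
  (Q A <= \int[Q]_x (f x)%:E * (c^-1)%:E)%E.
Proof.
move=> mf f0 c0 mA Af.
rewrite -(setIT A) -integral_indic//.
apply: (@le_trans _ _ (\int[Q]_x ((c^-1)%:E * (f x)%:E)))%E.
  apply: ge0_le_integral => //.
  - by apply/measurable_EFinP.
  - by apply: measurable_funeM; apply/measurable_EFinP.
  - move=> x _; rewrite -EFinM lee_fin indicE; have [|] := boolP (x \in A).
      by rewrite inE => /Af h; rewrite mulrC ler_pdivlMr// mul1r.
    by move=> _; rewrite mulr_ge0// invr_ge0 ltW.
rewrite ge0_integralZl//; first by rewrite muleC.
- by apply/measurable_EFinP.
- by move=> x _; rewrite lee_fin.
- by rewrite lee_fin invr_ge0 ltW.
Qed.

(** An integral of a positive function vanishes only on a null space. *)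
Lemma mgf_gt0 t : (0 < mgf t)%E.
Proof.
rewrite lt_neqAle integral_ge0 ?andbT; last by move=> x _; rewrite lee_fin expR_ge0.
apply/eqP => /esym M0.
have mf : measurable_fun setT (fun x : seqR => (expR (t * x 0%N))%:E).
  apply/measurable_EFinP; apply: measurableT_comp => //.
  by apply: measurable_funM => //; exact: measurable_coord.
have [h _] := ae_eq_integral_abs Q measurableT mf.
have : (\int[Q]_x `|(expR (t * x 0%N))%:E| = 0)%E.
  by rewrite -[RHS]M0; apply: eq_integral => x _; rewrite gee0_abs// lee_fin expR_ge0.
move=> /h [N [mN N0 /= TN]].
have : (Q setT <= Q N)%E.
  apply: le_measure; rewrite ?inE// => x _; apply: TN => /= /(_ Logic.I) /eqP.
  by rewrite eqe gt_eqF// expR_gt0.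
by rewrite N0 (@probability_setT _ _ _ Q) lee_fin ler10.
Qed.

Lemma chernoff_psum t m a :
  (Q [set x : seqR | (a <= t * psum m x)%R] <= mgf t ^+ m * (expR (- a))%:E)%E.
Proof.
rewrite -mgf_psum expRN; apply: markov_ge.
- apply: measurableT_comp => //; apply: measurable_funM => //; exact: measurable_psum.
- by move=> x; exact: expR_ge0.
- exact: expR_gt0.
- rewrite -[X in measurable X]setTI.
  have mt : measurable_fun setT (fun x : seqR => t * psum m x).
    by apply: measurable_funM => //; exact: measurable_psum.
  have := mt measurableT _ (measurable_itv `[a, +oo[).
  by congr (measurable (_ `&` _)); apply/seteqP; split => x /=; rewrite in_itv/= andbT.
- by move=> x /= h; rewrite ler_expR.
Qed.

Lemma psum_ge_prob k l a b :
  (Q [set x : seqR | (a <= psum k x)%R] * Q [set x : seqR | (b <= psum l x)%R] <=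
   Q [set x : seqR | (a + b <= psum (k + l) x)%R])%E.
Proof.
rewrite -(Qiid (measurable_psum_ge k a) (measurable_psum_ge l b) (@determined_psum_ge k a)).
apply: le_measure; rewrite ?inE.
- by apply: measurableI; [exact: measurable_psum_ge|apply: measurable_preshift; exact: measurable_psum_ge].
- exact: measurable_psum_ge.
- by move=> x [/= h1 h2]; rewrite psumD lerD.
Qed.

Lemma psum_ge_probX k a n :
  (Q [set x : seqR | (a <= psum k x)%R] ^+ n <=
   Q [set x : seqR | (n%:R * a <= psum (n * k)%N x)%R])%E.
Proof.
elim: n => [|n ih].
  rewrite expe0 mul0r mul0n -(@probability_setT _ _ _ Q); apply: le_measure; rewrite ?inE//.
    exact: measurable_psum_ge.
  by move=> x _ /=; rewrite /psum big_ord0.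
rewrite expeS mulSn; apply: le_trans (lee_wpmul2l _ ih) _ => //.
apply: le_trans (psum_ge_prob _ _ _ _) _.
by rewrite (_ : a + n%:R * a = n.+1%:R * a)// -natr1 mulrDl mul1r addrC.
Qed.

End iid_law.


(** * Cramer's lower bound *)

Section cramer.
Context {R : realType} (Q : probability (@seqR R) R).
Hypothesis Qiid : iid_law Q.
Notation seqR := (@seqR R).

(** The Archimedean property. *)
Lemma le0_arch (u v : R) : (forall m, m%:R * u <= v) -> u <= 0.
Proof.
move=> h; rewrite leNgt; apply/negP => u0.
have := h (Num.bound (`|v| / u)); apply/negP; rewrite -ltNge.
apply: le_lt_trans (ler_norm v) _; rewrite -ltr_pdivrMr//.
by apply: archi_boundP; rewrite divr_ge0// ltW.
Qed.

(** The level is split into a slope y1 and an offset t because the offset acts as the dual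
    variable of the exponent. *)
Definition tail (y1 : R) (k : nat) (t : R) : R :=
  fine (Q [set x : seqR | k%:R * y1 + t <= psum k x]).

Lemma tailE y1 k t : (Q [set x : seqR | (k%:R * y1 + t <= psum k x)%R] = (tail y1 k t)%:E)%E.
Proof. by rewrite fineK// fin_num_measure//; exact: measurable_psum_ge. Qed.

Lemma tail_ge0 y1 k t : 0 <= tail y1 k t.
Proof. by rewrite fine_ge0. Qed.

Lemma tail_le y1 k s t : s <= t -> tail y1 k t <= tail y1 k s.
Proof.
move=> st; rewrite -lee_fin -!tailE; apply: le_measure; rewrite ?inE; try exact: measurable_psum_ge.
by move=> x /=; apply: le_trans; rewrite lerD2l.
Qed.

(** Superadditivity of the logarithm of the tail: consecutive stretches of the walk are
    independent. *)
Lemma tailM y1 k l s t : tail y1 k s * tail y1 l t <= tail y1 (k + l) (s + t).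
Proof.
rewrite -lee_fin EFinM -!tailE; apply: le_trans (psum_ge_prob Qiid _ _ _ _) _.
by rewrite natrD mulrDl addrACA.
Qed.

Lemma tailX y1 k s m : tail y1 k s ^+ m <= tail y1 (m * k) (m%:R * s).
Proof.
rewrite -lee_fin EFin_expe -!tailE; apply: le_trans (psum_ge_probX Qiid _ _ _) _.
by rewrite natrM mulrDr mulrA.
Qed.

(** If no level with slope y1 is reached with probability larger than exp(- k c), then a
    fixed exponent theta controls all offsets at once. Combining m stretches with offset - a and n
    stretches with offset t, where n t >= m a, gives a stretch with nonnegative offset, to
    which the hypothesis applies. Therefore the slopes of the logarithm of the tail on the negative
    side lie below those on the positive side, and theta is a number separating the two. *)
Lemma tail_dual (y1 c b : R) :
  (forall k, (0 < k)%N -> tail y1 k 0 <= expR (- (k%:R * c))) ->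
  0 < b -> 0 < tail y1 1 b ->
  exists2 theta, 0 <= theta & forall k t, (0 < k)%N ->
    tail y1 k t <= expR (- (k%:R * c) - theta * t).
Proof.
move=> H b0 pb.
pose L k t := ln (tail y1 k t) + k%:R * c.
have Lle0 l t : (0 < l)%N -> 0 <= t -> 0 < tail y1 l t -> L l t <= 0.
  move=> l0 t0 p0; rewrite /L -lerBrDr sub0r.
  rewrite -ler_expR lnK ?posrE//; apply: le_trans (H _ l0); exact: tail_le.
have comp k l a t : (0 < k)%N -> (0 < l)%N -> 0 < a -> 0 < t ->
    0 < tail y1 k (- a) -> 0 < tail y1 l t -> L k (- a) / a <= - (L l t / t).
  move=> k0 l0 a0 t0 pk pl.
  rewrite -subr_le0 opprK.
  suff h : L k (- a) + a / t * L l t <= 0.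
    rewrite (_ : _ + _ = (L k (- a) + a / t * L l t) / a); last by field; lra.
    by rewrite pmulr_lle0// invr_gt0.
  apply: (@le0_arch _ (- L l t)) => m.
  have [->|m0] := posnP m; first by rewrite mul0r oppr_ge0 Lle0// ltW.
  have x0 : 0 <= m%:R * a / t by rewrite divr_ge0// ?mulr_ge0// ltW.
  (* n stretches upwards compensate m stretches downwards: n t >= m a *)
  pose n := (Num.trunc (m%:R * a / t)).+1.
  have n1 : m%:R * a / t <= n%:R by rewrite ltW// truncnS_gt.
  have n2 : n%:R <= m%:R * a / t + 1.
    by rewrite /n -natr1 lerD2r; have /andP[] := truncn_itv x0.
  have key : m%:R * ln (tail y1 k (- a)) + n%:R * ln (tail y1 l t) <= - ((m * k + n * l)%:R * c).
    rewrite -ler_expR expRD !expRM_natl !lnK ?posrE//.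
    apply: (@le_trans _ _ (tail y1 (m * k) (m%:R * (- a)) * tail y1 (n * l) (n%:R * t))).
      by apply: ler_pM; rewrite ?exprn_ge0 ?tail_ge0// tailX.
    apply: le_trans (tailM _ _ _ _ _) _; apply: le_trans (H _ _); last by rewrite addn_gt0 muln_gt0 m0 k0.
    apply: tail_le; rewrite mulrN addrC subr_ge0.
    by rewrite -ler_pdivrMr.
  have Ll := Lle0 l t l0 (ltW t0) pl.
  have : m%:R * L k (- a) + n%:R * L l t <= 0.
    move: key; rewrite /L natrD !natrM; lra.
  have : (m%:R * a / t + 1) * L l t <= n%:R * L l t by rewrite ler_wnM2r.
  have -> : m%:R * (L k (- a) + a / t * L l t) = m%:R * L k (- a) + m%:R * a / t * L l t by field; rewrite gt_eqF.
  lra.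
(* 0 is added to make theta nonnegative *)
pose A := [set 0] `|` [set z | exists k a, [/\ (0 < k)%N, 0 < a, 0 < tail y1 k (- a) & z = L k (- a) / a]].
have ubA l t : (0 < l)%N -> 0 < t -> 0 < tail y1 l t -> ubound A (- (L l t / t)).
  move=> l0 t0 pl z [->|[k [a [k0 a0 pk ->]]]]; last exact: comp.
  by rewrite -mulNr divr_ge0 ?oppr_ge0 ?Lle0// ltW.
have supA : has_sup A.
  by split; [exists 0; left|exists (- (L 1%N b / b)); exact: ubA].
exists (sup A); first by apply: ub_le_sup; [exact: supA.2|left].
move=> k t k0; have [p0|p0] := leP (tail y1 k t) 0.
  by rewrite (le_trans p0)// expR_ge0.
have lnle u : L k t <= u -> tail y1 k t <= expR (- (k%:R * c) + u).
  by rewrite /L => h; rewrite -[leLHS]lnK ?posrE// ler_expR; lra.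
apply: lnle; have [t0|t0|t0] := ltgtP t 0.
- rewrite -mulrN -ler_pdivrMr ?oppr_gt0//.
  apply: ub_le_sup; first exact: supA.2.
  by right; exists k, (- t); rewrite opprK oppr_gt0; split.
- have := sup_le_ub supA.1 (ubA k t k0 t0 p0).
  by rewrite -mulNr ler_pdivlMr// => h; lra.
- have := p0; rewrite t0 mulr0 oppr0 => p00; exact: Lle0.
Qed.

(** Powers of a number greater than 1 grow faster than linearly, by Bernoulli's inequality for
    q^(2 k). *)
Lemma pow_linear_le1 (q C : R) : 0 <= q -> (forall k, q ^+ k <= C * k.+1%:R) -> q <= 1.
Proof.
move=> q0 H; rewrite leNgt; apply/negP => q1.
pose h := q - 1; have h0 : 0 < h by rewrite subr_gt0.
have bern k : 1 + k%:R * h <= q ^+ k.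
  elim: k => [|k ih]; first by rewrite mul0r addr0 expr0.
  rewrite exprS -natr1 mulrDl mul1r.
  apply: (@le_trans _ _ (q * (1 + k%:R * h))); last by rewrite ler_wpM2l.
  have : 0 <= k%:R * h * h by rewrite !mulr_ge0// ltW.
  have qE : q = 1 + h by rewrite /h; lra.
  by rewrite qE; lra.
have C0 : 0 <= C by have := H 0%N; rewrite expr0 mulr1; lra.
have quad k : (k%:R * h) ^+ 2 <= C * (2 * k%:R + 1).
  have := H (2 * k)%N; rewrite mulnC exprM -natr1 natrM [k%:R * 2]mulrC.
  move=> hq; apply: le_trans hq; apply: lerXn2r; rewrite ?nnegrE.
  - by rewrite mulr_ge0// ltW.
  - exact: exprn_ge0.
  - by apply: le_trans (bern k); rewrite lerDr.
have : h ^+ 2 <= 0.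
  apply: (@le0_arch _ (3 * C)) => m.
  have [->|m0] := posnP m; first by rewrite mul0r mulr_ge0.
  have := quad m; rewrite exprMn.
  have m1 : 1 <= m%:R :> R by rewrite ler1n.
  have mp : 0 < m%:R :> R by lra.
  move=> hq; rewrite -(ler_pM2l mp).
  have : C <= C * m%:R by rewrite ler_peMr.
  lra.
by rewrite leNgt exprn_gt0.
Qed.

(** A bounded exponential is dominated by a sum over unit slices of its range. *)
Lemma expR_slices (theta t : R) (K J : nat) : 0 <= theta -> t <= J%:R - K%:R ->
  expR (theta * t) <= expR (- (theta * K%:R)) +
    \sum_(j < J.+1) expR (theta * (j%:R + 1 - K%:R)) * (j%:R - K%:R <= t)%R%:R.
Proof.
move=> th0 tJ; have [tK|tK] := ltP t (- K%:R).
  apply: (@le_trans _ _ (expR (- (theta * K%:R)))).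
    by rewrite ler_expR -mulrN ler_wpM2l// ltW.
  by rewrite lerDl; apply: sumr_ge0 => j _; rewrite mulr_ge0 ?expR_ge0.
have tK0 : 0 <= t + K%:R by lra.
have /andP[n1 n2] := truncn_itv tK0.
set n := Num.trunc _ in n1 n2.
have nJ : (n < J.+1)%N by rewrite ltnS -(ler_nat R); lra.
rewrite (bigD1 (Ordinal nJ))//= addrCA; apply: (@le_trans _ _ (expR (theta * (n%:R + 1 - K%:R)))).
  by rewrite ler_expR ler_wpM2l//; rewrite -natr1 in n2; lra.
have -> : (n%:R - K%:R <= t) by lra.
rewrite mulr1 lerDl addr_ge0 ?expR_ge0//.
by apply: sumr_ge0 => j _; rewrite mulr_ge0 ?expR_ge0.
Qed.

Lemma integral_cstQ (r : R) : (\int[Q]_x r%:E = r%:E)%E.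
Proof.
apply: etrans (integral_cst Q measurableT _) _.
by rewrite [X in (_ * X)%E](_ : _ = 1%E) ?mule1//; exact: (@probability_setT _ _ _ Q).
Qed.

Lemma integral_indicZ (r : R) (A : set seqR) : 0 <= r -> measurable A ->
  (\int[Q]_x (r * \1_A x)%:E = r%:E * Q A)%E.
Proof.
move=> r0 mA; under eq_integral do rewrite EFinM.
rewrite ge0_integralZl ?integral_indic ?setIT//.
by apply/measurable_EFinP; exact: measurable_indic.
Qed.

(** Truncation of the increment from above at M makes the moment finite. The k-th power of the
    truncated moment is an integral over k increments. Slicing the value of the sum in unit
    slices, the tail bound makes every slice contribute at most a constant times exp(- k c), and
    there are linearly many slices; the k-th root of this estimate gets rid of the linear
    factor. Finally M tends to infinity. *)
Lemma mgf_of_tail (y1 c theta : R) : 0 <= c -> 0 < theta ->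
  (forall k t, (0 < k)%N -> tail y1 k t <= expR (- (k%:R * c) - theta * t)) ->
  (mgf Q theta <= (expR (theta * y1 - c))%:E)%E.
Proof.
move=> c0 th0 H.
pose h (M : nat) (u : R) := expR (theta * Num.min (u - y1) M%:R).
have mh M : measurable_fun setT (h M).
  apply: measurableT_comp => //; apply: measurable_funM => //.
  by apply: measurable_minr => //; apply: measurable_funB.
have h0 M u : 0 <= h M u by exact: expR_ge0.
have mhx M i : measurable_fun setT (fun x : seqR => h M (x i)).
  by apply: measurableT_comp (mh M) _; exact: measurable_coord.
have mexph M i : measurable_fun setT (fun x : seqR => (h M (x i))%:E) by apply/measurable_EFinP.
(* below - k L the exponential is at most exp(- k c), so no slices are needed there *)
pose L := Num.bound (c / theta).
have Lc : c <= theta * L%:R.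
  rewrite mulrC -ler_pdivrMr//; apply/ltW/archi_boundP; by rewrite divr_ge0// ltW.
have hb M : (\int[Q]_x (h M (x 0%N))%:E <= (expR (- c))%:E)%E.
  pose r := (\int[Q]_x (h M (x 0%N))%:E)%E.
  have r0 : (0 <= r)%E by apply: integral_ge0 => x _; rewrite lee_fin.
  have rfin : r \is a fin_num.
    rewrite ge0_fin_numE//; apply: (@le_lt_trans _ _ (\int[Q]_x (expR (theta * M%:R))%:E)%E).
      apply: ge0_le_integral => //.
      - by move=> x _; rewrite lee_fin.
      - by move=> x _; rewrite lee_fin ler_expR ler_pM2l// ge_min lexx orbT.
    apply: le_lt_trans (ltry (expR (theta * M%:R))).
    by rewrite integral_cstQ.
  have main k : (0 < k)%N ->
      (r ^+ k <= (((k * (L + M)).+2)%:R * expR theta * expR (- (k%:R * c)))%:E)%E.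
    move=> k0; rewrite /r -(integral_prod Qiid k (mh M) (h0 M)).
    pose K := (k * L)%N; pose J := (k * (L + M))%N.
    pose g (x : seqR) := expR (- (theta * K%:R)) +
      \sum_(j < J.+1) expR (theta * (j%:R + 1 - K%:R)) * \1_[set x : seqR | k%:R * y1 + (j%:R - K%:R) <= psum k x] x.
    apply: (@le_trans _ _ (\int[Q]_x (g x)%:E)%E).
      apply: ge0_le_integral => //.
      - by move=> x _; rewrite lee_fin prodr_ge0.
      - by apply/measurable_EFinP; apply: measurable_prod => i _; exact: mhx.
      - apply/measurable_EFinP; apply: measurable_funD => //.
        apply: measurable_sum => j; apply: measurable_funM => //.
        by apply: measurable_indic; exact: measurable_psum_ge.
      move=> x _; rewrite lee_fin /h -expR_sum -mulr_sumr.
      set t := \sum_(i < k) _.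
      have t1 : t <= k%:R * M%:R.
        apply: (@le_trans _ _ (\sum_(i < k) M%:R)); last by rewrite sumr_const card_ord mulr_natl.
        by apply: ler_sum => i _; rewrite ge_min lexx orbT.
      have t2 : t <= psum k x - k%:R * y1.
        apply: (@le_trans _ _ (\sum_(i < k) (x i - y1))).
          by apply: ler_sum => i _; rewrite ge_min lexx.
        by rewrite sumrB sumr_const card_ord mulr_natl.
      have tJ : t <= J%:R - K%:R by rewrite /J /K mulnDr natrD addrAC subrr add0r natrM.
      apply: le_trans (expR_slices (ltW th0) tJ) _.
      rewrite lerD2l; apply: ler_sum => j _; rewrite ler_wpM2l ?expR_ge0//.
      rewrite indicE; case: (leP (j%:R - K%:R) t) => // ht.
      by rewrite mem_set//= ; lra.
    have gE : (\int[Q]_x (g x)%:E = (expR (- (theta * K%:R)))%:E +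
        \sum_(j < J.+1) (expR (theta * (j%:R + 1 - K%:R)))%:E *
          Q [set x : seqR | (k%:R * y1 + (j%:R - K%:R) <= psum k x)%R])%E.
      rewrite -{1}integral_cstQ.
      have -> : (\sum_(j < J.+1) (expR (theta * (j%:R + 1 - K%:R)))%:E *
          Q [set x : seqR | (k%:R * y1 + (j%:R - K%:R) <= psum k x)%R] =
          \int[Q]_x \sum_(j < J.+1) (expR (theta * (j%:R + 1 - K%:R)) * \1_[set x : seqR | k%:R * y1 + (j%:R - K%:R) <= psum k x] x)%:E)%E.
        rewrite ge0_integral_sum//.
        - apply: eq_bigr => j _; rewrite integral_indicZ ?expR_ge0//; exact: measurable_psum_ge.
        - move=> j; apply/measurable_EFinP; apply: measurable_funM => //.
          by apply: measurable_indic; exact: measurable_psum_ge.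
      rewrite -ge0_integralD//.
      - by apply: eq_integral => x _; rewrite /g EFinD sumEFin.
      - by move=> x _; apply: sume_ge0 => j _; rewrite lee_fin mulr_ge0// expR_ge0.
      - apply: emeasurable_sum => j; apply/measurable_EFinP; apply: measurable_funM => //.
        by apply: measurable_indic; exact: measurable_psum_ge.
    rewrite gE; under eq_bigr do rewrite tailE -EFinM.
    rewrite sumEFin -EFinD lee_fin.
    have e1 : expR (- (theta * K%:R)) <= expR theta * expR (- (k%:R * c)).
      rewrite -expRD ler_expR /K natrM.
      have : k%:R * c <= k%:R * (theta * L%:R) by rewrite ler_wpM2l.
      lra.
    have e2 (j : 'I_J.+1) : expR (theta * (j%:R + 1 - K%:R)) * tail y1 k (j%:R - K%:R) <=
                  expR theta * expR (- (k%:R * c)).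
      apply: le_trans (ler_wpM2l (expR_ge0 _) (H k _ k0)) _.
      by rewrite -!expRD ler_expR; lra.
    apply: le_trans (lerD e1 (ler_sum _ (fun j _ => e2 j))) _.
    by rewrite sumr_const card_ord -mulrS -[X in X <= _]mulr_natl mulrA.
  have rE : r = (fine r)%:E by rewrite fineK.
  rewrite -/r rE lee_fin expRN -[leRHS]mul1r ler_pdivlMr ?expR_gt0//.
  pose C := (L + M).+2%:R * expR theta.
  apply: (@pow_linear_le1 _ C).
    by rewrite mulr_ge0 ?expR_ge0// fine_ge0.
  move=> k; have [->|k0] := posnP k.
    rewrite expr0 mulr1 /C; apply: (@le_trans _ _ (1 * 1)); first by rewrite mulr1.
    apply: ler_pM => //; first by rewrite ler1n.
    by rewrite -expR0 ler_expR ltW.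
  have := main k k0; rewrite rE -EFin_expe lee_fin => hk.
  rewrite exprMn -expRM_natl.
  apply: le_trans (ler_wpM2r (expR_ge0 _) hk) _.
  rewrite -[leLHS]mulrA -expRD addrC subrr expR0 mulr1 /C mulrAC ler_wpM2r ?expR_ge0//.
  rewrite -natrM ler_nat; nia.
have -> : mgf Q theta = ((expR (theta * y1))%:E * \int[Q]_x (expR (theta * (x 0%N - y1)))%:E)%E.
  rewrite -ge0_integralZl//.
  - by apply: eq_integral => x _; rewrite -EFinM -expRD; congr (expR _)%:E; lra.
  - apply/measurable_EFinP; apply: measurableT_comp => //; apply: measurable_funM => //.
    by apply: measurable_funB => //; exact: measurable_coord.
rewrite expRD EFinM lee_wpmul2l ?lee_fin ?expR_ge0//.
have cv : (\int[Q]_x (h n (x 0%N))%:E)%E @[n --> \oo] --> (\int[Q]_x (expR (theta * (x 0%N - y1)))%:E)%E.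
  pose f (x : seqR) := (expR (theta * (x 0%N - y1)))%:E.
  have flim x : (h n (x 0%N))%:E @[n --> \oo] --> f x.
    apply: cvg_near_cst; near=> n; rewrite /h min_l//.
    near: n; exact: nbhs_infty_ger.
  have := @cvg_monotone_convergence _ _ _ Q setT measurableT (fun n x => (h n (x 0%N))%:E).
  move=> /(_ (fun n => mexph n 0%N)) cvm.
  have {cvm} := cvm _ _.
  rewrite (eq_integral f); last by move=> x _; apply/cvg_lim.
  apply => //.
  - by move=> n x _; rewrite lee_fin.
  - move=> x _ m n mn; rewrite lee_fin ler_expR ler_pM2l//.
    by rewrite le_min !ge_min lexx/= ler_nat mn orbT.
by apply: (@cvge_le _ _ _ _ _ _ _ _ cv); apply: nearW => n; exact: hb.
Unshelve. all: by end_near. Qed.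

Lemma mgf_of_tail0 (y1 c : R) :
  (forall k t, (0 < k)%N -> tail y1 k t <= expR (- (k%:R * c))) -> c <= 0.
Proof.
move=> H; suff : (1 <= (expR (- c))%:E)%E by rewrite lee_fin -expR0 ler_expR; lra.
pose F n := [set x : seqR | 1%:R * y1 + (- n%:R) <= psum 1 x].
have mF n : measurable (F n) by exact: measurable_psum_ge.
have FT : \bigcup_n F n = setT.
  apply/seteqP; split => // x _; exists (Num.bound `|y1 - psum 1 x|) => //=.
  have := archi_boundP (normr_ge0 (y1 - psum 1 x)); have := ler_norm (y1 - psum 1 x); rewrite /F/=; lra.
have ndF : {homo F : n m / (n <= m)%N >-> (n <= m)%O}.
  by move=> n m nm; apply/subsetPset => x; rewrite /F /= -(ler_nat R) in nm *; lra.
have := nondecreasing_cvg_mu (mu := Q) mF (bigcupT_measurable F mF) ndF.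
have e1 : Q (\bigcup_n F n) = 1%E by rewrite FT; exact: probability_setT.
move=> cv; rewrite -[X in (X <= _)%E]e1; apply: (cvge_le _ cv); apply: nearW => n /=.
rewrite /F -[X in (_ <= (expR (- X))%:E)%E]mul1r.
by have := H 1%N (- n%:R) isT; rewrite -lee_fin -tailE.
Qed.

(** The argument is by contradiction and needs no change of measure: if every k fails, then the
    tail is exponentially small with a fixed exponent theta in the offset by [tail_dual], so the
    moment generating function at theta is too small by [mgf_of_tail]. When the increment is
    bounded by y - eps / 2 almost surely, theta tending to infinity contradicts the hypothesis
    directly. *)
Lemma cramer_lower (y c eps : R) : 0 < eps -> 0 <= c ->
  (forall theta, 0 <= theta -> ((expR (theta * y))%:E <= (expR c)%:E * mgf Q theta)%E) ->
  exists2 k, (0 < k)%N & expR (- (k%:R * (c + eps))) <= tail (y - eps) k 0.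
Proof.
move=> e0 c0 H; apply: contrapT => N.
have Hk k : (0 < k)%N -> tail (y - eps) k 0 <= expR (- (k%:R * (c + eps))).
  by move=> k0; rewrite leNgt; apply/negP => h; apply: N; exists k => //; exact: ltW.
pose b := eps / 2; have b0 : 0 < b by rewrite /b; lra.
have [pb|pb] := ltP 0 (tail (y - eps) 1 b).
  have [theta th0 Hth] := tail_dual Hk b0 pb.
  have [th1|th1] := eqVneq theta 0.
    have : c + eps <= 0.
      by apply: (@mgf_of_tail0 (y - eps)) => k t k0; apply: le_trans (Hth k t k0) _; rewrite th1 mul0r subr0.
    lra.
  have thp : 0 < theta by rewrite lt_neqAle eq_sym th1.
  have ce0 : 0 <= c + eps by lra.
  have := mgf_of_tail ce0 thp Hth => hm.
  have := le_trans (H _ th0) (lee_wpmul2l (_ : (0 <= (expR c)%:E)%E) hm).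
  rewrite lee_fin expR_ge0 => /(_ isT); rewrite -EFinM lee_fin -expRD ler_expR.
  have : 0 <= theta * eps by rewrite mulr_ge0// ltW.
  lra.
(* remaining case: the increments are at most y - eps + b = y - b almost surely *)
have p0 : tail (y - eps) 1 b = 0 by apply/eqP; rewrite eq_le pb tail_ge0.
pose z := y - b.
have mz theta : 0 <= theta -> (mgf Q theta <= (expR (theta * z))%:E)%E.
  move=> th0; rewrite -integral_cstQ; apply: ae_ge0_le_integral => //.
  - apply/measurable_EFinP; apply: measurableT_comp => //; apply: measurable_funM => //.
    exact: measurable_coord.
  - exists [set x : seqR | 1%:R * (y - eps) + b <= psum 1 x]; split.
    + exact: measurable_psum_ge.
    + exact: etrans (tailE _ 1 _) (congr1 EFin p0).
    + move=> x /= h; rewrite leNgt; apply/negP => h2; apply: h => _.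
      rewrite lee_fin ler_expR ler_wpM2l//; move: h2.
      by rewrite /psum big_ord1 /z /b; lra.
have {}mz theta : 0 <= theta -> theta * b <= c.
  move=> th0; have := le_trans (H _ th0) (lee_wpmul2l (_ : (0 <= (expR c)%:E)%E) (mz _ th0)).
  rewrite lee_fin expR_ge0 => /(_ isT); rewrite -EFinM lee_fin -expRD ler_expR /z; lra.
have h : 0 <= (c + 1) / b by rewrite divr_ge0 ?(ltW b0)//; lra.
by have := mz _ h; rewrite divfK ?gt_eqF//; lra.
Qed.

End cramer.


(** * Lower bound for a walk following a broken line *)

Section walk_lower.
Context {R : realType} (Q : probability (@seqR R) R).
Hypothesis Qiid : iid_law Q.
Notation seqR := (@seqR R).

Definition pos_area (p : R) (m : nat) (a : R) : set seqR :=
  [set x : seqR | (forall i, (0 < i <= m)%N -> 0 < psum i x) /\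
                  a <= \sum_(i < m) psum i.+1 x `^ p].

Lemma measurable_ge_fun (f : seqR -> R) a : measurable_fun setT f ->
  measurable [set x | a <= f x].
Proof.
move=> mf; rewrite -[X in measurable X]setTI.
have := mf measurableT _ (measurable_itv `[a, +oo[).
by congr (measurable (_ `&` _)); apply/seteqP; split => x /=; rewrite in_itv/= andbT.
Qed.

Lemma measurable_pos_area p m a : measurable (pos_area p m a).
Proof.
have -> : pos_area p m a =
    (\bigcap_(i in [set i | (0 < i <= m)%N]) (psum i @^-1` `]0, +oo[%classic)) `&`
    [set x | a <= \sum_(i < m) psum i.+1 x `^ p].
  by apply/seteqP; split => x /= [h1 h2]; split => // i im; have := h1 i im; rewrite /= in_itv/= andbT.
apply: measurableI.
  apply: bigcap_measurableType => i _; rewrite -[X in measurable X]setTI.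
  by apply: measurable_psum.
apply: measurable_ge_fun; apply: measurable_sum => i.
by apply: (measurableT_comp (measurable_powR p)); exact: measurable_psum.
Qed.

(** In a block that realizes a large sum the walk may go down in between; a uniform lower bound
    on the increments limits the depth by a constant. *)
Definition bounded_below (k M : nat) : set seqR := [set x : seqR | forall i, (i < k)%N -> - M%:R <= x i].

Lemma measurable_bounded_below k M : measurable (bounded_below k M).
Proof.
have -> : bounded_below k M = \bigcap_(i in [set i | (i < k)%N]) [set x : seqR | - M%:R <= x i].
  by apply/seteqP; split => x /= h i; exact: h.
by apply: bigcap_measurableType => i _; apply: measurable_ge_fun; exact: measurable_coord.
Qed.

Lemma bounded_below_approx k (A : set seqR) (r : R) : measurable A -> (r%:E < Q A)%E ->
  exists M0, forall M, (M0 <= M)%N -> (r%:E <= Q (A `&` bounded_below k M))%E.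
Proof.
move=> mA rA; pose F M := A `&` bounded_below k M.
have mF M : measurable (F M) by apply: measurableI => //; exact: measurable_bounded_below.
have FA : \bigcup_M F M = A.
  apply/seteqP; split => [x [M _ []]//|x Ax].
  exists (\max_(i < k) Num.bound `|x i|)%N => //; split => // i ik.
  have := archi_boundP (normr_ge0 (x i)); have := ler_norm (- x i); rewrite normrN => h1 h2.
  have : (Num.bound `|x i| <= \max_(i < k) Num.bound `|x i|)%N.
    exact: (leq_bigmax (Ordinal ik)).
  rewrite -(ler_nat R); lra.
have ndF : {homo F : n m / (n <= m)%N >-> (n <= m)%O}.
  move=> n m nm; apply/subsetPset => x [Ax h]; split => // i ik.
  by apply: le_trans (h i ik); rewrite lerN2 ler_nat.
have := nondecreasing_cvg_mu (mu := Q) mF (bigcupT_measurable F mF) ndF.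
rewrite FA => cv; apply: contrapT => N.
have : (Q A <= r%:E)%E.
  apply: (cvge_le _ cv); apply: nearW => n /=; rewrite leNgt; apply/negP => h.
  apply: N; exists n => M nM; apply/ltW/(lt_le_trans h).
  have /subsetPset nMs := ndF _ _ nM.
  by apply: le_measure; rewrite ?inE//; exact: mF.
by rewrite leNgt rA.
Qed.

Lemma psum_recr i (x : seqR) : psum i.+1 x = psum i x + x i.
Proof. by rewrite /psum big_ord_recr. Qed.

Lemma psum_lower k M i x : (i <= k)%N -> bounded_below k M x -> - (i%:R * M%:R) <= psum i x.
Proof.
elim: i => [|i ih] ik bb; first by rewrite /psum big_ord0 mul0r oppr0.
rewrite psum_recr -natr1 mulrDl mul1r opprD; apply: lerD; first by apply: ih => //; exact: ltnW.
exact: bb.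
Qed.

Lemma sum_blocks (V : nmodType) (J L : nat) (F : nat -> V) :
  \sum_(i < J * L) F i = \sum_(j < J) \sum_(t < L) F (j * L + t)%N.
Proof.
elim: J => [|J ih]; first by rewrite mul0n !big_ord0.
by rewrite mulSnr big_split_ord /= ih big_ord_recr.
Qed.

(** The partial sums of a drift that is constant on blocks of n steps. *)
Lemma drift_blocks (z : nat -> R) (n j s : nat) : (s <= n)%N ->
  \sum_(r < j * n + s) z (r %/ n)%N = n%:R * \sum_(i < j) z i + s%:R * z j.
Proof.
elim: j s => [|j ihj] s sn.
  rewrite big_ord0 mulr0 add0r mul0n add0n (eq_bigr (fun=> z 0%N)).
    by rewrite sumr_const card_ord mulr_natl.
  by move=> i _; rewrite divn_small//; exact: leq_trans sn.
elim: s sn => [_|s ihs sn].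
  by rewrite addn0 mul0r addr0 mulSnr ihj// big_ord_recr /= mulrDr.
rewrite addnS big_ord_recr /= ihs 1?ltnW// -natr1 mulrDl mul1r addrA; congr (_ + z _).
by rewrite divnMDl ?divn_small ?addn0//; exact: leq_ltn_trans sn.
Qed.

Section path_event.
Variables (k N0 n M J : nat) (eta : R) (z : nat -> R) (x : seqR).
Hypotheses (k0 : (0 < k)%N) (n0 : (0 < n)%N) (eta0 : 0 < eta).
Hypothesis MN : M%:R < N0%:R * eta.
Let Z j := \sum_(i < j) z i.
Hypothesis Zpos : forall j, (0 < j <= J)%N -> 0 < Z j.
Hypothesis pre : forall r, (r < N0)%N -> forall i, (i < k)%N -> eta <= shift (r * k) x i.
Hypothesis main : forall r, (r < J * n)%N ->
  k%:R * z (r %/ n)%N <= psum k (shift ((N0 + r) * k) x) /\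
  bounded_below k M (shift ((N0 + r) * k) x).

(** During the first N0 k steps every increment is at least eta. *)
Lemma path_pre i : (i <= N0 * k)%N -> i%:R * eta <= psum i x.
Proof.
elim: i => [|i ih] ik; first by rewrite /psum big_ord0 mul0r.
rewrite psum_recr -natr1 mulrDl mul1r; apply: lerD; first by apply: ih; exact: ltnW.
have := @pre (i %/ k)%N _ (i %% k)%N (ltn_pmod _ k0).
by rewrite /shift -divn_eq; apply; rewrite ltn_divLR.
Qed.

Lemma path_main q : (q <= J * n)%N ->
  N0%:R * k%:R * eta + k%:R * \sum_(r < q) z (r %/ n)%N <= psum ((N0 + q) * k) x.
Proof.
elim: q => [|q ih] qJ.
  by rewrite big_ord0 mulr0 addr0 addn0 -natrM; exact: path_pre.
rewrite big_ord_recr /= mulrDr addrA addnS mulSnr psumD; apply: lerD.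
  by apply: ih; exact: ltnW.
by have [] := main qJ.
Qed.

(** The walk stays above the line between the two endpoints of the block, and a fortiori above
    the smaller one; the head start N0 k eta exceeds the loss of at most k M inside a group of k
    steps. *)
Lemma path_lower j t : (j < J)%N -> (t <= n * k)%N ->
  k%:R * n%:R * Num.min (Z j) (Z j.+1) < psum (N0 * k + j * (n * k) + t) x.
Proof.
move=> jJ tn; pose s := (t %/ k)%N; pose rho := (t %% k)%N.
have tE : t = (s * k + rho)%N by exact: divn_eq.
have rk : (rho < k)%N by exact: ltn_pmod.
have sn : (s <= n)%N by rewrite /s -(mulnK n k0); exact: leq_div2r.
have -> : (N0 * k + j * (n * k) + t = (N0 + (j * n + s)) * k + rho)%N by nia.
rewrite psumD.
have qJ : (j * n + s <= J * n)%N by nia.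
have h1 := path_main qJ; rewrite drift_blocks// -/(Z j) in h1.
have h2 : - (k%:R * M%:R) <= psum rho (shift ((N0 + (j * n + s)) * k) x).
  have [r0|r0] := posnP rho; first by rewrite r0 /psum big_ord0 oppr_le0 mulr_ge0.
  have sn' : (s < n)%N by nia.
  have qJ' : (j * n + s < J * n)%N by nia.
  have [_ bb] := main qJ'; apply: le_trans (psum_lower (ltnW rk) bb).
  by rewrite lerN2 ler_wpM2r// ler_nat ltnW.
have h3 : n%:R * Num.min (Z j) (Z j.+1) <= n%:R * Z j + s%:R * z j.
  have sn1 : s%:R <= n%:R :> R by rewrite ler_nat.
  have s0 : 0 <= s%:R :> R by [].
  have n1 : 0 < n%:R :> R by rewrite ltr0n.
  have ZE : Z j.+1 = Z j + z j by rewrite /Z big_ord_recr.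
  have [zj|zj] := leP 0 (z j).
    by rewrite min_l; [rewrite lerDl mulr_ge0|rewrite ZE lerDl].
  rewrite min_r; last by rewrite ZE gerDl ltW.
  rewrite ZE mulrDr lerD2l; apply: ler_wnM2r => //; exact: ltW.
have kp : 0 < k%:R :> R by rewrite ltr0n.
have h4 : k%:R * (n%:R * Num.min (Z j) (Z j.+1)) <= k%:R * (n%:R * Z j + s%:R * z j) by rewrite ler_pM2l.
have h5 : k%:R * M%:R < k%:R * (N0%:R * eta) by rewrite ltr_pM2l.
lra.
Qed.

Lemma Zmin_ge0 j : (j < J)%N -> 0 <= Num.min (Z j) (Z j.+1).
Proof.
move=> jJ; rewrite le_min; apply/andP; split; last by apply/ltW/Zpos.
case: j jJ => [|j] jJ; first by rewrite /Z big_ord0.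
by apply: ltW; apply: Zpos; rewrite /= ltnW.
Qed.

Lemma path_pos_area p : 0 < p ->
  pos_area p ((N0 + J * n) * k)
    (\sum_(j < J) (k * n)%:R * (k%:R * n%:R * Num.min (Z j) (Z j.+1)) `^ p) x.
Proof.
move=> p0; split.
  move=> i /andP[i0 im]; have [iN|iN] := leqP i (N0 * k).
    by apply: lt_le_trans (path_pre iN); rewrite mulr_gt0// ltr0n.
  pose d := (i - N0 * k).-1; pose j := (d %/ (n * k))%N.
  have nk : (0 < n * k)%N by rewrite muln_gt0 n0 k0.
  have iE : (i = N0 * k + j * (n * k) + (d %% (n * k)).+1)%N.
    by rewrite /j -addnA addnS -divn_eq /d; lia.
  have jJ : (j < J)%N by rewrite /j ltn_divLR// /d; nia.
  rewrite iE; apply: le_lt_trans (path_lower jJ (ltn_pmod _ nk)).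
  by rewrite mulr_ge0// Zmin_ge0.
rewrite mulnDl -mulnA big_split_ord /=.
rewrite -[leLHS]add0r; apply: lerD; first by apply: sumr_ge0 => i _; exact: powR_ge0.
rewrite (sum_blocks J (n * k) (fun i => psum (N0 * k + i).+1 x `^ p)).
apply: ler_sum => j _.
rewrite [(k * n)%N]mulnC mulr_natl.
rewrite -[X in _ *+ X]card_ord -sumr_const; apply: ler_sum => t _.
have h0 : 0 <= k%:R * n%:R * Num.min (Z j) (Z j.+1) by rewrite mulr_ge0// Zmin_ge0.
apply: ge0_ler_powR; rewrite ?nnegrE ?(ltW p0)//.
  by apply: le_trans h0 _; rewrite addnA -addnS; apply/ltW/path_lower.
by rewrite addnA -addnS; apply/ltW/path_lower.
Qed.

End path_event.

Lemma powR_large (beta K : R) : 0 < beta ->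
  exists N, forall n, (N <= n)%N -> K <= n%:R `^ beta.
Proof.
move=> b0; exists (Num.bound (`|K| `^ beta^-1)) => n Nn.
apply: le_trans (ler_norm K) _.
have h : `|K| `^ beta^-1 <= n%:R.
  apply/ltW/(lt_le_trans (archi_boundP (powR_ge0 _ _))).
  by rewrite ler_nat.
have := ge0_ler_powR (ltW b0) (powR_ge0 _ _ : `|K| `^ beta^-1 \in Num.nneg) (ler0n _ n) h.
by rewrite -powRrM mulVf ?gt_eqF// powRr1.
Qed.

Lemma powR_sublinear (alpha K : R) : alpha < 1 ->
  exists N, forall n, (N <= n)%N -> K * n%:R `^ alpha <= n%:R.
Proof.
move=> a1; have b0 : 0 < 1 - alpha by lra.
have [N HN] := powR_large K b0.
exists N.+1 => n Nn; have n0 : n%:R != 0 :> R by rewrite pnatr_eq0; lia.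
have e1 : n%:R = n%:R `^ (1 - alpha) * n%:R `^ alpha :> R.
  by rewrite -powRD ?n0 ?implybT// subrK powRr1.
rewrite [leRHS]e1.
by rewrite ler_wpM2r ?powR_ge0// HN// ltnW.
Qed.

Lemma lee_prod_nat (n : nat) (w : nat -> R) (F : nat -> \bar R) :
  (forall r, (r < n)%N -> 0 <= w r) ->
  (forall r, (r < n)%N -> ((w r)%:E <= F r)%E) -> ((\prod_(r < n) w r)%:E <= \prod_(r < n) F r)%E.
Proof.
elim: n => [|n ih] w0 wF; first by rewrite !big_ord0.
rewrite !big_ord_recr /= EFinM; apply: lee_pmul.
- rewrite lee_fin; apply: prodr_ge0 => i _; apply: w0; exact: ltn_trans (ltn_ord i) _.
- by rewrite lee_fin w0.
- apply: ih => r rn; [exact/w0/ltnW|exact/wF/ltnW].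
- exact: wF.
Qed.

Lemma prode_const_ord (k : nat) (q : R) : (\prod_(i < k) q%:E)%E = (q ^+ k)%:E.
Proof.
elim: k => [|k ih]; first by rewrite big_ord0.
by rewrite big_ord_recr /= ih exprSr EFinM.
Qed.

(** By superadditivity the estimates persist for multiples of k, so a common k serves all blocks. *)
Lemma tail_common (z c : nat -> R) (J : nat) :
  (forall j, (j < J)%N -> 0 <= c j /\
     exists2 k, (0 < k)%N & expR (- (k%:R * c j)) <= tail Q (z j) k 0) ->
  exists2 k, (0 < k)%N & forall j, (j < J)%N -> expR (- (k%:R * c j)) <= tail Q (z j) k 0.
Proof.
elim: J => [|J ih] H; first by exists 1%N.
have [|k k0 Hk] := ih; first by move=> j jJ; apply: H; exact: ltnW.
have [cJ [l l0 Hl]] := H J (ltnSn J).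
have mult (y d : R) (i q : nat) : (0 < q)%N -> 0 <= d -> expR (- (i%:R * d)) <= tail Q y i 0 ->
    expR (- ((q * i)%:R * d)) <= tail Q y (q * i) 0.
  move=> q0 d0 h; apply: (@le_trans _ _ (tail Q y i 0 ^+ q)); last first.
    by have := tailX Qiid y i 0 q; rewrite mulr0.
  rewrite natrM -mulrA -mulrN expRM_natl; apply: lerXn2r => //; rewrite nnegrE ?expR_ge0//.
  exact: tail_ge0.
exists (k * l)%N; first by rewrite muln_gt0 k0 l0.
move=> j; rewrite ltnS leq_eqVlt => /orP[/eqP ->|jJ]; first exact: mult.
rewrite mulnC; apply: mult => //; last exact: Hk.
by have [] := H j (ltnW jJ).
Qed.

Lemma common_trunc (J k : nat) (A : nat -> set seqR) (r : nat -> R) :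
  (forall j, (j < J)%N -> measurable (A j)) -> (forall j, (j < J)%N -> ((r j)%:E < Q (A j))%E) ->
  exists M, forall j, (j < J)%N -> ((r j)%:E <= Q (A j `&` bounded_below k M))%E.
Proof.
elim: J => [|J ih] mA rA; first by exists 0%N.
have [M HM] := ih (fun j jJ => mA j (ltnW jJ)) (fun j jJ => rA j (ltnW jJ)).
have [M' HM'] := bounded_below_approx k (mA J (ltnSn J)) (rA J (ltnSn J)).
exists (maxn M M') => j; rewrite ltnS leq_eqVlt => /orP[/eqP ->|jJ].
  by apply: HM'; exact: leq_maxr.
have mAj := mA j (ltnW jJ).
apply: le_trans (HM j jJ) _; apply: le_measure; rewrite ?inE.
- exact: (measurableI _ _ mAj (measurable_bounded_below k M)).
- exact: (measurableI _ _ mAj (measurable_bounded_below k (maxn M M'))).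
- move=> x [Ax bx]; split => // i ik; apply: le_trans (bx i ik).
  by rewrite lerN2 ler_nat leq_maxl.
Qed.

(** Block j consists of m groups of k steps, and each group makes a gain of at least k z_j with
    probability at least exp(- k c_j). The area is at least (k m)^(1+p) S, so k m has to be
    about n^alpha (b / S)^alpha. The initial groups of positive increments have a probability
    that does not depend on n. *)
Lemma pos_area_lower (p b eps eta : R) (z c : nat -> R) (J : nat) :
  let Z j := \sum_(i < j) z i in
  let S := \sum_(j < J) Num.min (Z j) (Z j.+1) `^ p in
  let alpha := 1 / (1 + p) in
  0 < p -> 0 < b -> 0 < eps -> 0 < eta -> (0 < Q [set x : seqR | (eta <= x 0%N)%R])%E ->
  (forall j, (0 < j <= J)%N -> 0 < Z j) ->
  (forall j, (j < J)%N -> 0 <= c j /\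
     exists2 k, (0 < k)%N & expR (- (k%:R * c j)) <= tail Q (z j) k 0) ->
  0 < S ->
  exists N, forall n, (N <= n)%N -> exists2 m, (m <= n)%N &
    ((expR (- (n%:R `^ alpha * ((b / S) `^ alpha * (\sum_(j < J) c j) + eps))))%:E <=
     Q (pos_area p m (n%:R * b)))%E.
Proof.
move=> Z S alpha p0 b0 e0 eta0 Qeta Zpos Hc S0.
have a0 : 0 < alpha by rewrite /alpha divr_gt0//; lra.
have a1 : alpha < 1 by rewrite /alpha ltr_pdivrMr; lra.
have J0 : (0 < J)%N by rewrite lt0n; apply/eqP => J0; move: S0; rewrite /S J0 big_ord0 ltxx.
have [k k0 Hk] := tail_common Hc.
have kp : 0 < k%:R :> R by rewrite ltr0n.
have Jp : 0 < J%:R :> R by rewrite ltr0n.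
pose X := (b / S) `^ alpha.
have X0 : 0 < X by rewrite powR_gt0// divr_gt0.
(* the strict margin e1 in the rates makes the truncation of the increments possible *)
pose e1 := eps / (2 * X * J%:R).
have e10 : 0 < e1 by rewrite divr_gt0// !mulr_gt0.
pose A j := [set x : seqR | k%:R * z j + 0 <= psum k x].
have mA j : measurable (A j) by exact: measurable_psum_ge.
have [M HM] : exists M, forall j, (j < J)%N ->
    ((expR (- (k%:R * (c j + e1))))%:E <= Q (A j `&` bounded_below k M))%E.
  apply: common_trunc => // j jJ; rewrite /A tailE lte_fin; apply: lt_le_trans (Hk j jJ).
  by rewrite ltr_expR ltrN2 ltr_pM2l// ltrDl.
pose Bpre := [set x : seqR | forall r, (r < k)%N -> [set y : seqR | eta <= y 0%N] (shift (r * 1)%N x)].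
have mE : measurable [set y : seqR | eta <= y 0%N] by apply: measurable_ge_fun; exact: measurable_coord.
have dE : determined 1 [set y : seqR | eta <= y 0%N] by move=> x y xy /=; rewrite xy.
have mBpre : measurable Bpre by exact: (measurable_blocks 1 k (fun=> mE)).
pose q1 := fine (Q [set y : seqR | eta <= y 0%N]).
have q1E : Q [set y : seqR | eta <= y 0%N] = q1%:E by rewrite fineK// fin_num_measure.
have q10 : 0 < q1 by rewrite -lte_fin -q1E.
have QBpre : Q Bpre = (q1 ^+ k)%:E.
  apply: etrans (blocks_prob Qiid k (fun=> mE) (fun=> dE)) _.
  rewrite (eq_bigr (fun=> q1%:E)) => [|i _]; last exact: q1E.
  by rewrite prode_const_ord.
pose N0 := (Num.bound (M%:R / eta)).
have MN : M%:R < N0%:R * eta.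
  rewrite -ltr_pdivrMr//; apply: archi_boundP; by rewrite divr_ge0// ltW.
pose q0 := q1 ^+ k; have q00 : 0 < q0 by exact: exprn_gt0.
pose C := \sum_(j < J) c j.
(* the part of the exponent that does not grow with n *)
pose K0 := k%:R * (C + J%:R * e1) - N0%:R * ln q0.
have [N1 HN1] := powR_large (2 * K0 / eps) a0.
have [N2 HN2] := powR_sublinear (2 * (J%:R * X)) a1.
exists (maxn 1 (maxn N1 (maxn N2 (2 * (N0 * k + J * k))))) => n.
rewrite !geq_max => /and4P[n1 nN1 nN2 nN3].
have np : 0 < n%:R :> R by rewrite ltr0n.
pose x := n%:R `^ alpha; have x0 : 0 < x by exact: powR_gt0.
have xX0 : 0 <= x * X / k%:R by rewrite divr_ge0// mulr_ge0// ltW.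
(* the number of groups per block, rounded up so that the area is not too small *)
pose m := (Num.trunc (x * X / k%:R)).+1.
have m1 : x * X <= k%:R * m%:R by rewrite [leRHS]mulrC -ler_pdivrMr// ltW// truncnS_gt.
have m2 : k%:R * m%:R <= x * X + k%:R.
  rewrite mulrC -ler_pdivlMr// mulrDl divff ?gt_eqF// /m -natr1 lerD2r.
  by have /andP[] := truncn_itv xX0.
exists ((N0 + J * m) * k)%N.
  rewrite -(ler_nat R) natrM natrD natrM.
  have := HN2 n nN2; rewrite -/x; move: nN3; rewrite -(ler_nat R) natrM natrD !natrM => h3 h2.
  have : J%:R * (k%:R * m%:R) <= J%:R * (x * X + k%:R) by rewrite ler_pM2l.
  lra.
pose B r := if (r < N0)%N then Bpre else A ((r - N0) %/ m)%N `&` bounded_below k M.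
have mB r : measurable (B r).
  by rewrite /B; case: ifP => // _; apply: measurableI => //; exact: measurable_bounded_below.
have dB r : determined k (B r).
  move=> u v uv; rewrite /B; case: ifP => _.
    by move=> h i ik; have := h i ik; rewrite /shift/= muln1 addn0 uv.
  move=> [h1 h2]; split; first exact: (determined_psum_ge uv).
  by move=> i ik; rewrite -uv//; exact: h2.
have sub : [set u : seqR | forall r, (r < N0 + J * m)%N -> B r (shift (r * k)%N u)] `<=`
    pos_area p ((N0 + J * m) * k) (n%:R * b).
  move=> u hu; have [||h1 h2] := @path_pos_area k N0 m M J eta z u k0 isT eta0 MN Zpos _ _ p p0.
  - move=> r rN i ik; have := hu r (leq_trans rN (leq_addr _ _)); rewrite /B rN => /(_ i ik).
    by rewrite /shift /= muln1 addn0.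
  - move=> r rJ; have := hu (N0 + r)%N; rewrite ltn_add2l => /(_ rJ).
    by rewrite /B ltnNge leq_addr /= addKn => -[]; rewrite /A /= addr0.
  split => //; apply: le_trans h2.
  rewrite -mulr_sumr.
  have -> : \sum_(j < J) (k%:R * m%:R * Num.min (\sum_(i < j) z i) (\sum_(i < j.+1) z i)) `^ p =
       (k%:R * m%:R) `^ p * S.
    rewrite /S mulr_sumr; apply: eq_bigr => j _.
    by rewrite [LHS]powRM ?mulr_ge0//; exact: (Zmin_ge0 Zpos).
  have nS : n%:R * b = (x * X) `^ (1 + p) * S.
    rewrite /x /X -powRM//; last by rewrite divr_ge0// ltW.
    rewrite -powRrM /alpha divfK ?gt_eqF//; last by lra.
    rewrite powRr1; last by rewrite mulr_ge0// divr_ge0// ltW.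
    by rewrite -mulrA divfK// gt_eqF.
  rewrite nS mulrA ler_pM2r// natrM -[X in _ <= X * _]powRr1 ?mulr_ge0//.
  rewrite -[leRHS]powRD; last by rewrite mulf_neq0 ?implybT// gt_eqF// ltr0n.
  by apply: ge0_ler_powR; rewrite ?nnegrE ?mulr_ge0// ?(ltW x0) ?(ltW X0)//; lra.
apply: (@le_trans _ _ (Q [set u : seqR | forall r, (r < N0 + J * m)%N -> B r (shift (r * k)%N u)])); last first.
  apply: le_measure; rewrite ?inE//; first exact: measurable_blocks.
  exact: measurable_pos_area.
rewrite blocks_prob//.
pose w r := if (r < N0)%N then q0 else expR (- (k%:R * (c ((r - N0) %/ m)%N + e1))).
apply: (@le_trans _ _ (\prod_(r < N0 + J * m) w r)%:E); last first.
  apply: (@lee_prod_nat (N0 + J * m) w (fun r => Q (B r))) => r rR; first by rewrite /w; case: ifP => _; rewrite ?expR_ge0// ltW.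
  rewrite /w /B; case: ifPn => rN; first by rewrite QBpre.
  have rJ : ((r - N0) %/ m < J)%N.
    by rewrite ltn_divLR // -(ltn_add2l N0) subnKC // leqNgt.
  exact: (HM _ rJ).
rewrite lee_fin big_split_ord /=.
have -> : \prod_(i < N0) w i = q0 ^+ N0.
  rewrite -[in RHS](card_ord N0) -prodr_const; apply: eq_bigr => i _.
  by rewrite /w ltn_ord.
have -> : \prod_(i < J * m) w (N0 + i)%N = \prod_(r < J * m) expR (- (k%:R * (c (r %/ m)%N + e1))).
  by apply: eq_bigr => i _; rewrite /w ltnNge leq_addr /= addKn.
rewrite -expR_sum sumrN -mulr_sumr big_split /= sumr_const card_ord.
have -> : \sum_(i < J * m) c (i %/ m)%N = m%:R * C.
  by have := drift_blocks c J (leq0n m); rewrite addn0 mul0r addr0.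
rewrite -[q0](@lnK R) ?posrE// -expRM_natl -expRD ler_expR.
rewrite -[e1 *+ _]mulr_natl natrM.
have h1 : k%:R * m%:R * (C + J%:R * e1) <= (x * X + k%:R) * (C + J%:R * e1).
  rewrite ler_wpM2r// addr_ge0//; last by rewrite mulr_ge0// ltW.
  by apply: sumr_ge0 => j _; have [] := Hc j (ltn_ord j).
have h2 : K0 <= eps / 2 * x.
  have := HN1 n nN1; rewrite -/x ler_pdivrMr// => h; lra.
have h3 : x * X * (J%:R * e1) = x * eps / 2.
  by rewrite /e1; field; rewrite !gt_eqF.
move: h2 h1; rewrite /K0 -/C -/X -/x; lra.
Qed.

End walk_lower.


(** * The last busy period *)

Section renewals.
Context (Omega : Type) (R : realType) (U : nat -> Omega -> R) (w : Omega).
Local Notation X k := (reflected_walk U k w).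
Local Notation T i := (renewal_time U i w).

Lemma reflected_walk_ge0 k : 0 <= X k.
Proof. by case: k => //= k; rewrite le_max lexx orbT. Qed.

Lemma renewal_timeS i : T i.+1 = ereal_inf [set k%:R%:E | k in
      [set k : nat | (T i < k%:R%:E)%E /\ X k = 0]].
Proof. by []. Qed.

(** The zeros after a renewal form a set of natural numbers, so the infimum is attained. *)
Lemma renewal_next (m k i : nat) : T i = m%:R%:E -> (m < k)%N -> X k = 0 ->
  exists2 l, (m < l <= k)%N & X l = 0 /\ T i.+1 = l%:R%:E.
Proof.
move=> Ti mk Xk.
have ex : exists l, (m < l)%N && (X l == 0) by exists k; rewrite mk Xk eqxx.
case: (ex_minnP ex) => l /andP[ml' /eqP Xl'] lmin.
exists l; first by rewrite ml' lmin// mk Xk eqxx.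
split => //; rewrite renewal_timeS; apply/eqP; rewrite eq_le; apply/andP; split.
  by apply: ereal_inf_lbound; exists l => //=; split => //; rewrite Ti lte_fin ltr_nat.
apply: le_ereal_inf_tmp => _ [j [+ Xj] <-]; rewrite Ti lte_fin ltr_nat => mj.
by rewrite lee_fin ler_nat lmin// mj Xj eqxx.
Qed.

Lemma renewal_time_nat i : T i = +oo%E \/
  exists2 m, (i <= m)%N & X m = 0 /\ T i = m%:R%:E.
Proof.
elim: i => [|i ih]; first by right; exists 0%N.
have [[k [Tk Xk]]|N] := pselect (exists k, (T i < k%:R%:E)%E /\ X k = 0); last first.
  left; rewrite renewal_timeS; apply/ereal_inf_pinfty => y [k h _].
  by exfalso; apply: N; exists k.
case: ih Tk => [->|[m im [Xm Tm]]]; first by rewrite ltNge leey.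
rewrite Tm lte_fin ltr_nat => mk.
have [l /andP[ml _] [Xl Tl]] := renewal_next Tm mk Xk.
by right; exists l => //; exact: leq_ltn_trans ml.
Qed.

(** The renewal before n with the largest index is the last zero before n: a later zero would
    give one more renewal before n. *)
Lemma last_renewal n : exists2 m, (m <= n)%N &
  [/\ T (renewal_count U n w) = m%:R%:E, X m = 0 &
      forall k, (m < k <= n)%N -> X k != 0].
Proof.
pose c := renewal_count U n w.
have cmax k : (k <= n)%N -> (T k <= n%:R%:E)%E -> (k <= c)%N.
  move=> kn Tk; rewrite /c /renewal_count.
  exact: (@leq_bigmax_cond _ (fun k : 'I_n.+1 => (T k <= n%:R%:E)%E) (fun k => nat_of_ord k) (Ordinal (kn : (k < n.+1)%N))).
have Tc : (T c <= n%:R%:E)%E.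
  rewrite /c /renewal_count; apply: (big_ind (fun k => (T k <= n%:R%:E)%E)).
  - exact: (ler0n R n).
  - by move=> k l hk hl; rewrite /maxn; case: ifP.
  - by move=> k; exact.
have [Too|[m cm [Xm Tm]]] := renewal_time_nat c.
  by move: Tc; rewrite Too leye_eq.
have mn : (m <= n)%N by move: Tc; rewrite Tm lee_fin ler_nat.
exists m => //; split => // k /andP[mk kn]; apply/negP => /eqP Xk.
have [l /andP[ml lk] [Xl Tl]] := renewal_next Tm mk Xk.
have := cmax c.+1; rewrite Tl lee_fin ler_nat (leq_trans lk kn) ltnn.
have cn : (c < n)%N by lia.
by move=> /(_ cn isT).
Qed.

End renewals.

Section busy_event.
Context d (Omega : measurableType d) (R : realType) (P : probability Omega R).
Variable U : nat -> {RV P >-> R}.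
Local Notation V := (fun k => U k : Omega -> R).
Local Notation X := (reflected_walk V).

(** Reflection only pushes upwards. *)
Lemma psum_le_walk m i w : psum i (blk U m w) <= X (m + i) w.
Proof.
elim: i => [|i ih]; first by rewrite /psum big_ord0 reflected_walk_ge0.
by rewrite psum_recr addnS /= le_max; apply/orP; left; rewrite lerD2r.
Qed.

Lemma walk_psum m n w : X m w = 0 -> (forall k, (m < k <= n)%N -> X k w != 0) ->
  forall i, (m + i <= n)%N -> X (m + i) w = psum i (blk U m w).
Proof.
move=> Xm Xn; elim=> [|i ih] min; first by rewrite addn0 /psum big_ord0.
rewrite psum_recr -ih ?(leq_trans _ min)// ?leq_add2l//.
have : X (m + i.+1) w != 0 by apply: Xn; lia.
rewrite addnS /= /blk; case: leP => // _; by rewrite eqxx.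
Qed.

Lemma last_area_sum p n m w : renewal_time V (renewal_count V n w) w = m%:R%:E -> (m <= n)%N ->
  last_busy_area V p n w = \sum_(i < n - m) X (m + i.+1)%N w `^ p.
Proof.
move=> Tm mn; rewrite /last_busy_area Tm.
rewrite (eq_bigl (fun i => (m < i)%N)); last by move=> i; rewrite lte_fin ltr_nat.
rewrite (@big_cat_nat _ _ _ m.+1)//= big_nat_cond big1 ?add0r; last by move=> i; lia.
rewrite big_nat_cond (eq_bigl (fun i => m < i < n.+1)%N); last by move=> i /=; lia.
have -> : \sum_(m.+1 <= i < n.+1 | (m < i < n.+1)%N) X i w `^ p = \sum_(m.+1 <= i < n.+1) X i w `^ p.
  by rewrite [RHS]big_nat_cond; apply: eq_bigl => i; rewrite andbT.
rewrite -[m.+1]add0n big_addn subSS big_mkord; apply: eq_bigr => i _.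
by congr (X _ w `^ p); lia.
Qed.

(** Starting from the last zero, the reflected walk is a free walk with positive partial sums.
    Conversely, if the partial sums after time n - m are positive then there is no zero after n
    - m, so the last busy period contains these m steps, on which the reflected walk dominates
    the free walk. *)
Lemma busy_area_event (p a : R) n : 0 < p ->
  [set w | a <= last_busy_area V p n w] =
  \bigcup_(m in [set m | (m <= n)%N]) (blk U (n - m) @^-1` pos_area p m a).
Proof.
move=> p0; apply/seteqP; split => w /=.
  have [m mn [Tm Xm Xn]] := last_renewal V w n.
  rewrite (@last_area_sum p n m w Tm mn) => h; exists (n - m)%N => /=; first exact: leq_subr.
  have e : (n - (n - m) = m)%N by lia.
  rewrite e; have W := walk_psum Xm Xn; split.
    move=> i /andP[i0 im]; rewrite -W; last by lia.
    by rewrite lt_def reflected_walk_ge0 andbT Xn//; lia.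
  apply: (le_trans h); apply: ler_sum => i _.
  by rewrite -W//; have := ltn_ord i; lia.
move=> [k /= kn [kpos ka]].
have [m mn [Tm Xm Xn]] := last_renewal V w n.
have mk : (m <= n - k)%N.
  rewrite leqNgt; apply/negP => h; have := kpos (m - (n - k))%N; have -> : (0 < m - (n - k) <= k)%N by lia.
  move=> /(_ isT) /lt_le_trans /(_ (psum_le_walk (n - k) _ w)).
  by rewrite subnKC ?(ltnW h)// Xm ltxx.
rewrite (@last_area_sum p n m w Tm mn); apply: (le_trans ka).
have -> : (n - m = (n - k - m) + k)%N by lia.
rewrite big_split_ord /= -[leLHS]add0r; apply: lerD.
  by apply: sumr_ge0 => i _; exact: powR_ge0.
apply: ler_sum => i _.
have -> : (m + (n - k - m + i).+1 = n - k + i.+1)%N by have := ltn_ord i; lia.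
apply: ge0_ler_powR; rewrite ?nnegrE ?(ltW p0) ?reflected_walk_ge0 ?psum_le_walk//.
by apply/ltW/kpos; have := ltn_ord i; lia.
Qed.

End busy_event.


(** * Tails evaluated at their own variable *)

Section upsets.
Context d (T : measurableType d) (R : realType) (Q : probability T R).

Lemma bigcup_prob_le (F : nat -> set T) (A : set T) n : (forall i, measurable (F i)) ->
  measurable A -> (forall x, A x -> exists2 i, (i < n)%N & F i x) -> (Q A <= \sum_(i < n) Q (F i))%E.
Proof.
move=> mF mA AF; apply: content_subadditive => //.
by move=> x /AF[i ? ?]; rewrite -bigcup_mkord; exists i.
Qed.

(** If the up-set has a least element this is the hypothesis; otherwise it is the increasing
    union of the half-lines that start at its rational points. *)
Lemma upset_prob (f : T -> R) (L : set R) (s : \bar R) : (0 <= s)%E ->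
  measurable_fun setT f -> (forall a b, a <= b -> L a -> L b) ->
  (forall a, L a -> (Q [set x | (a <= f x)%R] <= s)%E) -> (Q (f @^-1` L) <= s)%E.
Proof.
move=> s0 mf up Ls.
have [[a [La lba]]|nomin] := pselect (exists a, L a /\ forall b, L b -> a <= b).
  have -> : f @^-1` L = [set x | a <= f x].
    by apply/seteqP; split => x /=; [exact: lba|move=> h; exact: up h La].
  exact: Ls.
(* an enumeration of the rationals; F k uses the first k of them *)
pose r (i : nat) : R := ratr (odflt (0 : rat) (choice.unpickle (i : nat))).
pose F k := [set x | exists2 i, (i < k)%N & L (r i) /\ r i <= f x].
have mfa a : measurable [set x | a <= f x].
  rewrite -[X in measurable X]setTI; have := mf measurableT _ (measurable_itv `[a, +oo[).
  by congr (measurable (_ `&` _)); apply/seteqP; split => x /=; rewrite in_itv/= andbT.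
have FE k : F k = set0 \/ exists2 a, L a & F k = [set x | a <= f x].
  elim: k => [|k [ih|[a La ih]]].
  - by left; apply/seteqP; split => x // [].
  - have [Lk|Lk] := pselect (L (r k)).
      right; exists (r k) => //; apply/seteqP; split => x /=; last by exists k.
      move=> [i]; rewrite ltnS leq_eqVlt => /orP[/eqP -> []//|ik [Li fi]].
      by have : F k x; [exists i|rewrite ih].
    left; apply/seteqP; split => x // [i]; rewrite ltnS leq_eqVlt => /orP[/eqP -> []//|ik [Li fi]].
    by have : F k x; [exists i|rewrite ih].
  - have [Lk|Lk] := pselect (L (r k)).
      right; exists (Num.min a (r k)); first by rewrite /Num.min; case: ifP.
      apply/seteqP; split => x /=.
        move=> [i]; rewrite ltnS leq_eqVlt ge_min => /orP[/eqP -> [_ ->]|ik [Li fi]]; first by rewrite orbT.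
        by have : F k x; [exists i|rewrite ih /= => ->].
      rewrite ge_min => /orP[h|h]; last by exists k.
      by have : F k x; [rewrite ih|move=> [i ik ?]; exists i => //; exact: ltnW].
    right; exists a => //; rewrite -ih; apply/seteqP; split => x /= [i].
      rewrite ltnS leq_eqVlt => /orP[/eqP -> []//|ik ?]; by exists i.
    by move=> ik ?; exists i => //; exact: ltnW.
have mF k : measurable (F k).
  by have [->|[a _ ->]] := FE k; [exact: measurable0|exact: mfa].
have QF k : (Q (F k) <= s)%E.
  by have [->|[a La ->]] := FE k; [rewrite measure0|exact: Ls].
have UF : \bigcup_k F k = f @^-1` L.
  apply/seteqP; split => x.
    by move=> [k _ [i ik [Li fi]]]; exact: up fi Li.
  move=> /= Lx; have [b Lb bx] : exists2 b, L b & b < f x.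
    apply: contrapT => N; apply: nomin; exists (f x); split => // b Lb.
    by rewrite leNgt; apply/negP => bx; apply: N; exists b.
  have [q] := rat_in_itvoo bx; rewrite in_itv/= => /andP[bq qx].
  exists (choice.pickle q).+1 => //; exists (choice.pickle q) => //.
  by rewrite /r choice.pickleK /=; split; [exact: up (ltW bq) Lb|exact: ltW].
have ndF : {homo F : n m / (n <= m)%N >-> (n <= m)%O}.
  move=> n m nm; apply/subsetPset => x [i ik h]; exists i => //.
  exact: leq_trans nm.
have := nondecreasing_cvg_mu (mu := Q) mF (bigcupT_measurable F mF) ndF.
by rewrite UF => cv; apply: (cvge_le _ cv); exact: nearW.
Qed.

End upsets.

Section block_product.
Context {R : realType} (Q : probability (@seqR R) R).
Hypothesis Qiid : iid_law Q.
Notation seqR := (@seqR R).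
Variable m : nat.

Definition up_tail (a : R) : R := fine (Q [set x : seqR | a <= psum m x]).
Definition dn_tail (a : R) : R := fine (Q [set x : seqR | - a <= - psum m x]).
(** Both tails are needed: a block sum may be atypical in either direction, and the cost of a
    block is the supremum over exponents of both signs. *)
Definition two_tail (a : R) : R := Num.min (up_tail a) (dn_tail a).

Lemma measurable_dn a : measurable [set x : seqR | - a <= - psum m x].
Proof. by apply: measurable_ge_fun; apply: measurableT_comp => //; exact: measurable_psum. Qed.

Lemma up_tailE a : Q [set x : seqR | a <= psum m x] = (up_tail a)%:E.
Proof. by rewrite fineK// fin_num_measure//; exact: measurable_psum_ge. Qed.

Lemma dn_tailE a : Q [set x : seqR | - a <= - psum m x] = (dn_tail a)%:E.
Proof. by rewrite fineK// fin_num_measure//; exact: measurable_dn. Qed.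

Lemma up_tail_le a b : a <= b -> up_tail b <= up_tail a.
Proof.
move=> ab; rewrite -lee_fin -!up_tailE; apply: le_measure; rewrite ?inE; try exact: measurable_psum_ge.
by move=> x /=; exact: le_trans.
Qed.

Lemma dn_tail_le a b : a <= b -> dn_tail a <= dn_tail b.
Proof.
move=> ab; rewrite -lee_fin -!dn_tailE; apply: le_measure; rewrite ?inE; try exact: measurable_dn.
by move=> x /=; rewrite !lerN2 => /le_trans; apply.
Qed.

Lemma two_tail_ge0 a : 0 <= two_tail a.
Proof. by rewrite le_min !fine_ge0. Qed.

Lemma two_tail_le1 a : two_tail a <= 1.
Proof.
rewrite ge_min -lee_fin -up_tailE probability_le1//; exact: measurable_psum_ge.
Qed.

Lemma measurable_two_tail : measurable_fun setT two_tail.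
Proof.
apply: measurable_minr.
- by apply: nonincreasing_measurable => // a b ab; exact: up_tail_le.
- by apply: nondecreasing_measurable => // a b ab; exact: dn_tail_le.
Qed.

(** Nonnegative exponents bound the upper tail and negative exponents the lower tail. *)
Lemma two_tail_chernoff t a :
  ((two_tail a)%:E <= mgf Q t ^+ m * (expR (- (t * a)))%:E)%E.
Proof.
have [t0|t0] := leP 0 t.
  apply: (@le_trans _ _ (up_tail a)%:E); first by rewrite lee_fin ge_min lexx.
  rewrite -up_tailE; apply: (le_trans _ (chernoff_psum Qiid t m (t * a))).
  apply: le_measure; rewrite ?inE; first exact: measurable_psum_ge.
    by apply: measurable_ge_fun; apply: measurable_funM => //; exact: measurable_psum.
  by move=> x /= h; exact: ler_wpM2l.
apply: (@le_trans _ _ (dn_tail a)%:E); first by rewrite lee_fin ge_min lexx orbT.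
rewrite -dn_tailE; apply: (le_trans _ (chernoff_psum Qiid t m (t * a))).
apply: le_measure; rewrite ?inE; first exact: measurable_dn.
  by apply: measurable_ge_fun; apply: measurable_funM => //; exact: measurable_psum.
by move=> x /=; rewrite lerN2 => h; exact: ler_wnM2l (ltW t0) _ _ h.
Qed.

Lemma measurable_two_psum : measurable_fun setT (fun x : seqR => two_tail (psum m x)).
Proof. by apply: (measurableT_comp measurable_two_tail); exact: measurable_psum. Qed.

Lemma measurable_le_fun (f : seqR -> R) a : measurable_fun setT f ->
  measurable [set x | f x <= a].
Proof.
move=> mf; have -> : [set x | f x <= a] = [set x | - a <= - f x].
  by apply/seteqP; split => x /=; rewrite lerN2.
by apply: measurable_ge_fun; exact: measurableT_comp.
Qed.

(** A tail function evaluated at its own variable is at most s with probability at most s,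
    because the set where it is at most s is a half-line. *)
Lemma two_tail_prob s : 0 <= s ->
  (Q [set x : seqR | (two_tail (psum m x) <= s)%R] <= (2 * s)%:E)%E.
Proof.
move=> s0.
pose A := psum m @^-1` [set a | up_tail a <= s] : set seqR.
pose B := (fun x => - psum m x) @^-1` [set a | dn_tail (- a) <= s] : set seqR.
have mA : measurable A.
  apply: (@measurable_le_fun (up_tail \o psum m)); apply: measurableT_comp; last exact: measurable_psum.
  by apply: nonincreasing_measurable => // a b ab; exact: up_tail_le.
have mB : measurable B.
  apply: (@measurable_le_fun (fun x => dn_tail (- - psum m x))).
  rewrite (_ : (fun x : seqR => dn_tail (- - psum m x)) = dn_tail \o psum m); last first.
    by apply/funext => x /=; rewrite opprK.
  apply: (@measurableT_comp _ _ _ _ _ _ dn_tail); last exact: measurable_psum.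
  by apply: nondecreasing_measurable => // a b ab; exact: dn_tail_le.
apply: (@le_trans _ _ (Q (A `|` B))).
  apply: le_measure; rewrite ?inE; first by apply: measurable_le_fun; exact: measurable_two_psum.
    exact: measurableU.
  by move=> x /=; rewrite ge_min => /orP[h|h]; [left|right; rewrite /B /= opprK].
apply: le_trans (measureU2 _ mA mB) _.
rewrite mulrDl mul1r EFinD; apply: leeD; apply: upset_prob; rewrite ?lee_fin//.
- exact: measurable_psum.
- by move=> a b ab; exact: le_trans (up_tail_le ab).
- by move=> a /= h; rewrite up_tailE lee_fin.
- by apply: measurableT_comp => //; exact: measurable_psum.
- by move=> a b ab /=; apply: le_trans; apply: dn_tail_le; rewrite lerN2.
- by move=> a /= h; have := dn_tailE (- a); rewrite opprK => ->; rewrite lee_fin.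
Qed.

Definition small_prod (r : nat) (t : R) : set seqR :=
  [set x : seqR | \prod_(j < r) two_tail (psum m (shift (j * m) x)) <= expR (- t)].

Lemma measurable_small_prod r t : measurable (small_prod r t).
Proof.
apply: measurable_le_fun; apply: measurable_prod => j _.
by apply: (measurableT_comp measurable_two_psum); exact: measurable_shift.
Qed.

Lemma determined_small_prod r t : determined (r * m) (small_prod r t).
Proof.
move=> x y xy; rewrite /small_prod /=; rewrite (eq_bigr (fun j : 'I_r => two_tail (psum m (shift (j * m) y))))//.
move=> j _; congr two_tail; apply: eq_bigr => i _; rewrite /shift; apply: xy.
have := ltn_ord i; have := ltn_ord j; nia.
Qed.

(** By induction on r. The last factor lies between exp(- i - 1) and exp(- i) for some i < N,
    with probability at most 2 exp(- i), and the product of the others is then at most exp(- t +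
    i + 1); or the last factor is at most exp(- N) <= exp(- t). Each of these N + 1 cases
    contributes at most a constant times exp(- t). *)
Lemma small_prod_bound r N t : t <= N%:R ->
  (Q (small_prod r t) <= ((2 * expR 1 * N.+1%:R) ^+ r * expR (- t))%:E)%E.
Proof.
elim: r t => [|r ih] t tN.
  rewrite expr0 mul1r; have [t0|t0] := leP t 0.
    apply: (@le_trans _ _ 1%E); first by apply: probability_le1; exact: measurable_small_prod.
    by rewrite lee_fin -[leLHS]expR0 ler_expR oppr_ge0.
  have -> : small_prod 0 t = set0.
    apply/seteqP; split => x //; rewrite /small_prod /= big_ord0 -[leLHS]expR0 ler_expR; lra.
  by rewrite measure0 lee_fin expR_ge0.
pose C := (2 * expR 1 * N.+1%:R : R) ^+ r.
have N1 : 1 <= N.+1%:R :> R by rewrite ler1n.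
have C1 : 1 <= C.
  apply: exprn_ege1; have : 1 <= expR 1 :> R by rewrite -[leLHS]expR0 ler_expR.
  move=> h; have : 1 * 1 <= expR 1 * N.+1%:R :> R by apply: ler_pM.
  lra.
pose E i := [set x : seqR | two_tail (psum m x) <= expR (- i%:R)].
have mE i : measurable (E i) by apply: measurable_le_fun; exact: measurable_two_psum.
pose F i := if (i < N)%N then small_prod r (t - i%:R - 1) `&` shift (r * m) @^-1` E i
            else shift (r * m) @^-1` E N.
have mS i : measurable (shift (r * m) @^-1` E i : set seqR).
  exact: measurable_preshift.
have mF i : measurable (F i).
  rewrite /F; case: ifP => // _; apply: measurableI => //; exact: measurable_small_prod.
apply: (@le_trans _ _ (\sum_(i < N.+1) Q (F i))%E).
  apply: bigcup_prob_le => //; first exact: measurable_small_prod.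
  move=> x; rewrite /small_prod /= big_ord_recr /=.
  set q := two_tail _; set pr := \prod_(j < r) _ => h.
  have pr0 : 0 <= pr by apply: prodr_ge0 => j _; exact: two_tail_ge0.
  have [qN|qN] := leP q (expR (- N%:R)).
    by exists N => //; rewrite /F ltnn.
  have q0 : 0 < q by apply: lt_trans qN; exact: expR_gt0.
  have q1 : q <= 1 by exact: two_tail_le1.
  have lq : 0 <= - ln q by rewrite oppr_ge0 ln_le0.
  have /andP[ti1 ti2] := truncn_itv lq; set i := Num.trunc _ in ti1 ti2.
  have lqN : - ln q < N%:R.
    by rewrite ltrNl -ltr_expR lnK ?posrE.
  have iN : (i < N)%N by rewrite -(ltr_nat R); exact: le_lt_trans lqN.
  exists i; first exact: ltnW.
  rewrite /F iN; split; last first.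
    by rewrite /E /= -/q -[leLHS]lnK ?posrE// ler_expR lerNr.
  rewrite /small_prod /= -/pr.
  have qi : expR (- i%:R - 1) < q.
    by rewrite -[ltRHS]lnK ?posrE// ltr_expR; move: ti2; rewrite -natr1; lra.
  have -> : - (t - i%:R - 1) = - t - (- i%:R - 1) :> R by lra.
  rewrite expRD [expR (- (_ - 1))]expRN ler_pdivlMr ?expR_gt0//.
  by apply: le_trans h; apply: ler_wpM2l => //; exact: ltW.
rewrite big_ord_recr /=.
have FN : (Q (F N) <= (2 * C * expR (- t))%:E)%E.
  rewrite /F ltnn (iid_law_shift Qiid)//; apply: le_trans (two_tail_prob (expR_ge0 _)) _.
  rewrite lee_fin -mulrA ler_pM2l//.
  by apply: (@le_trans _ _ (expR (- t))); [rewrite ler_expR lerN2|rewrite ler_peMl ?expR_ge0].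
have Fi (i : 'I_N) : (Q (F i) <= (2 * expR 1 * C * expR (- t))%:E)%E.
  rewrite /F ltn_ord (Qiid (measurable_small_prod _ _) (mE i) (determined_small_prod (t := _)))//.
  have h1 : t - i%:R - 1 <= N%:R by have := ler0n R i; lra.
  apply: le_trans (lee_pmul _ _ (ih _ h1) (two_tail_prob (expR_ge0 _))) _ => //.
  rewrite -EFinM lee_fin -/C.
  have -> : - (t - i%:R - 1) = - t + i%:R + 1 :> R by lra.
  rewrite !expRD expRN.
  have i0 := expR_gt0 (i%:R : R).
  rewrite le_eqVlt; apply/orP; left; apply/eqP; rewrite expRN; field.
  by rewrite !gt_eqF// ?expR_gt0.
apply: le_trans (leeD (lee_sum _ (fun i _ => Fi i)) FN) _.
rewrite sumEFin -EFinD lee_fin sumr_const card_ord exprSr -/C -[_ *+ N]mulr_natl.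
have e1 : 1 <= expR 1 :> R by rewrite -[leLHS]expR0 ler_expR.
have h : 2 * C * expR (- t) <= 2 * expR 1 * C * expR (- t).
  by rewrite ler_pM2r ?expR_gt0// mulrAC ler_peMr// mulr_ge0//; lra.
apply: (le_trans (lerD (lexx _) h)).
by rewrite -natr1 le_eqVlt; apply/orP; left; apply/eqP; ring.
Qed.

End block_product.


(** * Powers, and the area of a walk in terms of block sums *)

Section powers.
Context {R : realType}.

(** A convexity inequality with a leading constant close to 1: either w is small compared to a,
    or a is bounded by a multiple of w. *)
Lemma powR_split (p ep : R) : 0 < p -> 0 < ep -> exists2 C : R, 0 < C &
  forall a w, 0 <= a -> 0 <= w -> (a + w) `^ p <= (1 + ep) * a `^ p + C * w `^ p.
Proof.
move=> p0 ep0.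
(* k solves (1 + k)^p = 1 + ep *)
pose k := (1 + ep) `^ p^-1 - 1.
have k1 : (1 + k) `^ p = 1 + ep.
  by rewrite /k addrC subrK -powRrM mulVf ?gt_eqF// powRr1//; lra.
have k0 : 0 < k.
  rewrite ltNge; apply/negP => kn; have : (1 + k) `^ p <= 1 `^ p.
    apply: ge0_ler_powR; rewrite ?nnegrE ?(ltW p0)//; last by lra.
    by rewrite /k addrC subrK powR_ge0.
  by rewrite k1 powR1; lra.
exists ((1 + k^-1) `^ p); first by rewrite powR_gt0// addr_gt0// invr_gt0.
move=> a w a0 w0; have [wk|wk] := leP w (k * a).
  apply: (@le_trans _ _ (((1 + k) * a) `^ p)).
    apply: ge0_ler_powR; rewrite ?nnegrE ?(ltW p0)//; [lra|nra|nra].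
  rewrite powRM//; last by lra.
  by rewrite k1 lerDl mulr_ge0 ?powR_ge0.
apply: (@le_trans _ _ (((1 + k^-1) * w) `^ p)).
  have ak : a <= k^-1 * w by rewrite mulrC ler_pdivlMr// mulrC ltW.
  have ki : 0 < k^-1 by rewrite invr_gt0.
  apply: ge0_ler_powR; rewrite ?nnegrE ?(ltW p0)//; [lra|nra|nra].
rewrite powRM//; last by rewrite addr_ge0// invr_ge0 ltW.
by rewrite lerDr mulr_ge0 ?powR_ge0//; lra.
Qed.

(** Blocks with a small variation contribute little each, and the others are few. *)
Lemma powR_le_linear (p h w W : R) : 0 < p -> 0 < h -> 0 <= w <= W ->
  w `^ p <= h `^ p + w / h * W `^ p.
Proof.
move=> p0 h0 /andP[w0 wW]; have W0 := le_trans w0 wW.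
have [wh|wh] := leP w h.
  rewrite -[leLHS]addr0; apply: lerD; last by rewrite mulr_ge0 ?powR_ge0// divr_ge0// ltW.
  by apply: ge0_ler_powR; rewrite ?nnegrE ?(ltW p0)//; exact: ltW.
rewrite -[leLHS]add0r; apply: lerD; first exact: powR_ge0.
apply: (@le_trans _ _ (W `^ p)).
  by apply: ge0_ler_powR; rewrite ?nnegrE ?(ltW p0).
rewrite ler_peMl ?powR_ge0// ler_pdivlMr//; lra.
Qed.

Lemma sum_cst_ord n (c : R) : \sum_(i < n) c = n%:R * c.
Proof. by rewrite sumr_const card_ord mulr_natl. Qed.

(** A logarithm grows more slowly than every power, here than the power alpha / 2. *)
Lemma polynomial_le_expR (k : nat) (c eps alpha : R) : 0 < c -> 0 < eps -> 0 < alpha ->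
  exists N, forall n, (N <= n)%N -> (c * n.+1%:R) ^+ k <= expR (eps * n%:R `^ alpha).
Proof.
move=> c0 e0 a0; pose g := alpha / 2; have g0 : 0 < g by rewrite divr_gt0.
pose K := k%:R / g * (2 * c) `^ g.
have [N HN] := powR_large (K / eps) g0.
exists (maxn 1 N) => n; rewrite geq_max => /andP[n1 Nn].
have n0 : 0 < n%:R :> R by rewrite ltr0n.
have n2 : n.+1%:R <= 2 * n%:R :> R by rewrite -natr1; move: n1; rewrite -(ler_nat R); lra.
have z0 : 0 < c * n.+1%:R by rewrite mulr_gt0.
rewrite -[X in X ^+ k](@lnK R) ?posrE// -expRM_natl ler_expR.
have h1 : ln (c * n.+1%:R) <= (c * n.+1%:R) `^ g / g.
  rewrite ler_pdivlMr// mulrC -ln_powR; apply/ltW/ln_sublinear; exact: powR_gt0.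
have h2 : (c * n.+1%:R) `^ g <= (2 * c) `^ g * n%:R `^ g.
  rewrite -powRM//; last by rewrite mulr_ge0// ltW.
  apply: ge0_ler_powR; rewrite ?nnegrE ?(ltW g0) ?(ltW z0)//.
    by rewrite !mulr_ge0// ltW.
  by have := ler_wpM2l (ltW c0) n2; lra.
have h3 := HN n Nn; rewrite ler_pdivrMr// in h3.
have aE : n%:R `^ alpha = n%:R `^ g * n%:R `^ g :> R.
  by rewrite -powRD ?pnatr_eq0 ?gt_eqF ?implybT// -splitr.
apply: (@le_trans _ _ (k%:R * ((2 * c) `^ g * n%:R `^ g / g))).
  by apply: ler_wpM2l => //; apply: (le_trans h1); rewrite ler_pM2r// invr_gt0.
have -> : k%:R * ((2 * c) `^ g * n%:R `^ g / g) = K * n%:R `^ g by rewrite /K; ring.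
rewrite aE mulrA; apply: ler_wpM2r; first exact: powR_ge0.
by rewrite mulrC.
Qed.

End powers.

Section area.
Context {R : realType}.
Notation seqR := (@seqR R).
Implicit Types x : seqR.

Lemma psum_abs k x : `|psum k x| <= \sum_(i < k) `|x i|.
Proof. exact: ler_norm_sum. Qed.

Lemma sum_abs_le k l x : (k <= l)%N -> \sum_(i < k) `|x i| <= \sum_(i < l) `|x i|.
Proof.
move=> kl; rewrite -(subnKC kl) big_split_ord /= lerDl; exact: sumr_ge0.
Qed.

(** Inside a block the walk exceeds the smaller endpoint by at most the absolute sum of the
    increments of the block. These absolute sums add up to at most W, so most of them are below
    h; the last incomplete block is estimated by W. *)
Lemma area_blocks (p ep C2 W h : R) x (m r l : nat) :
  (forall a w, 0 <= a -> 0 <= w -> (a + w) `^ p <= (1 + ep) * a `^ p + C2 * w `^ p) ->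
  0 <= C2 -> 0 < p -> 0 < h -> (r * m <= l <= r * m + m)%N ->
  (forall i, (0 < i <= l)%N -> 0 < psum i x) -> \sum_(i < l) `|x i| <= W ->
  \sum_(i < l) psum i.+1 x `^ p <=
    (1 + ep) * (\sum_(j < r) m%:R * Num.min (psum (j * m) x) (psum (j.+1 * m) x) `^ p) +
    C2 * (m%:R * (r%:R * h `^ p + W / h * W `^ p)) + m%:R * W `^ p.
Proof.
move=> split C20 p0 h0 /andP[rl lr] pos absW.
pose w j := \sum_(t < m) `|x (j * m + t)%N|.
have w0 j : 0 <= w j by exact: sumr_ge0.
have W0 : 0 <= W by apply: le_trans absW; exact: sumr_ge0.
have sw : \sum_(j < r) w j <= W.
  apply: le_trans absW; rewrite -(sum_blocks r m (fun i => `|x i|)).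
  exact: sum_abs_le.
have wW j : (j < r)%N -> w j <= W.
  move=> jr; apply: le_trans sw; rewrite (bigD1 (Ordinal jr))//= lerDl; exact: sumr_ge0.
have pos0 i : (i <= l)%N -> 0 <= psum i x.
  by case: i => [|i] il; [rewrite /psum big_ord0|apply/ltW/pos].
pose e j := psum (j * m) x.
have near j t : (j < r)%N -> (t < m)%N -> psum (j * m + t).+1 x <= Num.min (e j) (e j.+1) + w j.
  move=> jr tm; rewrite -lerBlDr le_min; apply/andP; split; rewrite lerBlDr.
    rewrite -addnS psumD lerD2l; apply: le_trans (ler_norm _) _.
    apply: le_trans (psum_abs _ _) _.
    exact: (sum_abs_le (shift (j * m) x) tm).
  have -> : e j.+1 = psum (j * m + t).+1 x + psum (m - t.+1) (shift (j * m + t).+1 x).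
    by rewrite -psumD /e; congr (psum _ x); rewrite mulSn; lia.
  rewrite -addrA lerDl -lerBlDl sub0r.
  apply: (@le_trans _ _ (\sum_(i < m - t.+1) `|shift (j * m + t).+1 x i|)).
    by apply: le_trans (psum_abs _ _); rewrite -normrN ler_norm.
  have -> : w j = \sum_(i < t.+1 + (m - t.+1)) `|x (j * m + i)%N| by rewrite subnKC.
  rewrite big_split_ord /= -[leLHS]add0r; apply: lerD; first exact: sumr_ge0.
  by apply: ler_sum => i _; rewrite /shift addnA addnS.
have e0 j : (j < r)%N -> 0 <= Num.min (e j) (e j.+1).
  by move=> jr; rewrite le_min !pos0//; nia.
have -> : l = (r * m + (l - r * m))%N by lia.
rewrite big_split_ord /=; apply: lerD; last first.
  apply: (@le_trans _ _ (\sum_(i < l - r * m) W `^ p)).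
    apply: ler_sum => i _; have il := ltn_ord i.
    apply: ge0_ler_powR; rewrite ?nnegrE ?(ltW p0)//; first by apply: pos0; lia.
    apply: le_trans (ler_norm _) _; apply: le_trans (psum_abs _ _) _.
    by apply: le_trans absW; apply: sum_abs_le; lia.
  rewrite sum_cst_ord; apply: ler_wpM2r; first exact: powR_ge0.
  by rewrite ler_nat; lia.
rewrite (sum_blocks r m (fun i => psum i.+1 x `^ p)).
have blk j : (j < r)%N -> \sum_(t < m) psum (j * m + t).+1 x `^ p <=
    (1 + ep) * (m%:R * Num.min (e j) (e j.+1) `^ p) + C2 * (m%:R * (h `^ p + w j / h * W `^ p)).
  move=> jr; apply: (@le_trans _ _ (\sum_(t < m) ((1 + ep) * Num.min (e j) (e j.+1) `^ p + C2 * (h `^ p + w j / h * W `^ p)))).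
    apply: ler_sum => t _; apply: (@le_trans _ _ ((Num.min (e j) (e j.+1) + w j) `^ p)).
      apply: ge0_ler_powR; rewrite ?nnegrE ?(ltW p0)// ?addr_ge0 ?e0 ?near//.
      by apply: pos0; have := ltn_ord t; nia.
    apply: (le_trans (split _ _ (e0 j jr) (w0 j))); rewrite lerD2l.
    by apply: ler_wpM2l => //; apply: powR_le_linear => //; rewrite w0 wW.
  rewrite sum_cst_ord le_eqVlt; apply/orP; left; apply/eqP; ring.
apply: (le_trans (ler_sum _ (fun (j : 'I_r) _ => blk j (ltn_ord j)))).
rewrite big_split /= -mulr_sumr lerD2l -mulr_sumr; apply: ler_wpM2l => //.
rewrite -mulr_sumr; apply: ler_wpM2l => //.
rewrite big_split /= sum_cst_ord lerD2l -!mulr_suml.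
apply: ler_wpM2r; first exact: powR_ge0.
by apply: ler_wpM2r => //; rewrite invr_ge0 ltW.
Qed.

End area.


(** * Upper bound for positive stretches of the walk *)

Section upper.
Context {R : realType} (Q : probability (@seqR R) R).
Hypothesis Qiid : iid_law Q.
Notation seqR := (@seqR R).

(** The Legendre transform of the logarithmic moment generating function. *)
Definition cramer_rate (y : R) : \bar R :=
  ereal_sup (range (fun t : R => ((t * y)%:E - lne (mgf Q t))%E)).

Lemma cramer_rate_le m (q D : R) : (0 < m)%N -> 0 < q ->
  (forall t, (q%:E <= mgf Q t ^+ m * (expR (- (t * D)))%:E)%E) ->
  (cramer_rate (D / m%:R) <= (- ln q / m%:R)%:E)%E.
Proof.
move=> m0 q0 H; apply: ge_ereal_sup => _ [t _ <-].
have mp : 0 < m%:R :> R by rewrite ltr0n.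
have := H t; have := mgf_gt0 Q t; case: (mgf Q t) => [M| |]//= M0 h; last first.
  by rewrite /= leNye.
rewrite lte_fin in M0; rewrite ifN -?ltNge// -EFinB lee_fin.
move: h; rewrite -EFin_expe -EFinM lee_fin.
rewrite -ler_ln ?posrE ?mulr_gt0 ?exprn_gt0 ?expR_gt0//.
rewrite lnM ?posrE ?exprn_gt0 ?expR_gt0// lnXn// expRK -[ln M *+ m]mulr_natl => h.
rewrite ler_pdivlMr//.
have -> : (t * (D / m%:R) - ln M) * m%:R = t * D - m%:R * ln M by field; rewrite gt_eqF.
lra.
Qed.

(** Each factor is at most exp(- m times its rate) by Chernoff's bound; a factor 0 makes the
    claim trivial. *)
Lemma small_prod_of_rate (r m : nat) (lam B : R) (x : seqR) : (0 < m)%N -> 0 < lam ->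
  (B%:E <= \sum_(j < r) (m%:R / lam)%:E * cramer_rate (psum m (shift (j * m) x) / m%:R))%E ->
  small_prod Q m r (lam * B) x.
Proof.
move=> m0 l0 h; have mp : 0 < m%:R :> R by rewrite ltr0n.
pose q j := two_tail Q m (psum m (shift (j * m) x)).
rewrite /small_prod /=.
have [[j qj]|N] := pselect (exists j : 'I_r, q j = 0).
  by rewrite (bigD1 j)//= -/(q j) qj mul0r expR_ge0.
have q0 j : (j < r)%N -> 0 < q j.
  move=> jr; rewrite lt_def two_tail_ge0 andbT; apply/eqP => qj; apply: N.
  by exists (Ordinal jr).
have : (B%:E <= (\sum_(j < r) (- ln (q j)) / lam)%:E)%E.
  apply: (le_trans h); rewrite -sumEFin; apply: lee_sum => j _.
  have hj := cramer_rate_le m0 (q0 j (ltn_ord j)) (fun t => two_tail_chernoff Qiid m t _).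
  apply: le_trans (lee_wpmul2l _ hj) _; first by rewrite lee_fin divr_ge0// ltW.
  rewrite -EFinM lee_fin le_eqVlt; apply/orP; left; apply/eqP; field.
  by rewrite !gt_eqF.
rewrite lee_fin -mulr_suml ler_pdivlMr// mulrC sumrN => hB.
have -> : \prod_(j < r) two_tail Q m (psum m (shift (j * m) x)) = expR (\sum_(j < r) ln (q j)).
  by rewrite expR_sum; apply: eq_bigr => j _; rewrite lnK// posrE q0.
by rewrite ler_expR lerNr.
Qed.

Lemma abs_sum_prob (c A a : R) (l : nat) : 0 <= c ->
  (\int[Q]_x (expR (c * `|x 0%N|))%:E = A%:E)%E ->
  (Q [set x : seqR | (a <= \sum_(i < l) `|x i|)%R] <= (A ^+ l * expR (- (c * a)))%:E)%E.
Proof.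
move=> c0 HA; pose h (y : R) : R := expR (c * `|y|).
have mh : measurable_fun setT h.
  by apply: measurableT_comp => //; apply: measurable_funM => //; exact: measurableT_comp.
have ms : measurable_fun setT (fun x : seqR => \sum_(i < l) `|x i|).
  by apply: measurable_sum => i; apply: measurableT_comp => //; exact: measurable_coord.
have := integral_prod Qiid l mh (fun y => expR_ge0 _); rewrite HA -EFin_expe => E.
rewrite EFinM -E expRN; apply: markov_ge.
- by apply: measurable_prod => i _; apply: measurableT_comp mh _; exact: measurable_coord.
- by move=> x; apply: prodr_ge0 => i _; exact: expR_ge0.
- exact: expR_gt0.
- exact: measurable_ge_fun.
- by move=> x /= ax; rewrite /h -expR_sum -mulr_sumr ler_expR ler_wpM2l.
Qed.

Lemma one_add_exp_le (z : R) j : 1 <= z -> 1 + z ^+ j <= (2 * z) ^+ j.+1.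
Proof.
move=> z1; have zj : 1 <= z ^+ j by exact: exprn_ege1.
have j2 : 1 <= 2 ^+ j :> R by apply: exprn_ege1; rewrite ler1n.
rewrite exprMn exprS -mulrA; apply: (@le_trans _ _ (2 * z ^+ j)); first lra.
rewrite ler_pM2l//; apply: (@le_trans _ _ (z ^+ j.+1)); first by rewrite exprS ler_peMl// (le_trans ler01).
by rewrite ler_peMl// (le_trans ler01)// exprn_ege1.
Qed.

(** The bound is uniform in the length l of the stretch. If l is at least K x, the walk is
    positive after a long time in spite of its negative drift. If the absolute sum of the
    increments exceeds C x, exponential moments are violated. Otherwise [area_blocks] turns the
    area into a sum over blocks, to which the hypothesis on B applies after rescaling by lam,
    and [small_prod_bound] concludes. *)
Lemma pos_area_upper (p b B eps rho theta c A : R) :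
  let alpha := 1 / (1 + p) in
  0 < p -> 0 < b -> 0 < B -> 0 < eps ->
  0 <= theta -> 0 < rho < 1 -> (mgf Q theta <= rho%:E)%E ->
  0 < c -> (\int[Q]_x (expR (c * `|x 0%N|))%:E = A%:E)%E ->
  (forall (m : R) (r : nat) (D : nat -> R), 0 < m ->
    (forall j, (0 < j <= r)%N -> 0 < \sum_(i < j) D i) ->
    1 <= \sum_(j < r) m * Num.min (\sum_(i < j) D i) (\sum_(i < j.+1) D i) `^ p ->
    (B%:E <= \sum_(j < r) m%:E * cramer_rate (D j / m))%E) ->
  exists N, forall n, (N <= n)%N -> forall l,
    (Q (pos_area p l (n%:R * b)) <=
     (expR (- (n%:R `^ alpha * (B * b `^ alpha - eps))))%:E)%E.
Proof.
move=> alpha p0 b0 B0 eps0 th0 /andP[rho0 rho1] Mrho c0 HA HB.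
have p1 : 1 + p != 0 by rewrite gt_eqF//; lra.
have a0 : 0 < alpha by rewrite /alpha divr_gt0//; lra.
have a1 : alpha < 1 by rewrite /alpha ltr_pdivrMr; lra.
have [G GE] : exists v : R, v = B * b `^ alpha by eexists.
have G0 : 0 < G by rewrite GE mulr_gt0// powR_gt0.
have lr0 : 0 < - ln rho by rewrite oppr_gt0 ln_lt0// rho0.
(* rho^(K x) = exp(- G x) *)
have [K KE] : exists v : R, v = G / (- ln rho) by eexists.
have K0 : 0 < K by rewrite KE divr_gt0.
have A1 : 1 <= A.
  rewrite -lee_fin -HA; apply: (@le_trans _ _ (\int[Q]_x 1%:E)%E).
    by rewrite integral_cstQ.
  apply: ge0_le_integral => //.
  - apply/measurable_EFinP; apply: measurableT_comp => //; apply: measurable_funM => //.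
    by apply: measurableT_comp => //; exact: measurable_coord.
  - by move=> x _; rewrite lee_fin -[leLHS]expR0 ler_expR mulr_ge0// ltW.
have lA : 0 <= ln A by rewrite ln_ge0.
(* A^(K x) exp(- c C x) = exp(- G x) *)
have [C CE] : exists v : R, v = (K * ln A + G) / c by eexists.
have C0 : 0 < C by rewrite CE divr_gt0// ltr_wpDl// mulr_ge0// ltW.
(* loss of area, and errors of area_blocks: a factor 1 + e1 / 2, and b e1 / 4 for each of the
   two remainders *)
have [e1 e1E] : exists v : R, v = Num.min (1 / 2) (eps / (2 * G)) by eexists.
have e10 : 0 < e1 by rewrite e1E lt_min divr_gt0//= divr_gt0// mulr_gt0.
have e12 : e1 <= 1 / 2 by rewrite e1E ge_min lexx.
have e1G : e1 * G <= eps / 2.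
  have he : e1 <= eps / (2 * G) by rewrite e1E ge_min lexx orbT.
  have -> : eps / 2 = eps / (2 * G) * G by field; rewrite gt_eqF.
  by rewrite ler_pM2r.
have e20 : 0 < e1 / 2 by rewrite divr_gt0.
have [C2 C20 split] := powR_split p0 e20.
have [h hE] : exists v : R, v = (b * e1 / (4 * C2 * K)) `^ p^-1 by eexists.
have hq0 : 0 < b * e1 / (4 * C2 * K) by rewrite divr_gt0// !mulr_gt0.
have h0 : 0 < h by rewrite hE; exact: powR_gt0.
have hp : C2 * K * h `^ p = b * e1 / 4.
  rewrite hE -powRrM mulVf ?gt_eqF// powRr1 ?(ltW hq0)//.
  by field; rewrite !gt_eqF.
have [Y YE] : exists v : R, v = C2 * (C / h * C `^ p) + C `^ p by eexists.
have Y0 : 0 < Y.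
  rewrite YE.
  apply: addr_gt0; last exact: powR_gt0.
  by rewrite !mulr_gt0// ?invr_gt0// powR_gt0.
have [dl dlE] : exists v : R, v = b * e1 / (8 * Y) by eexists.
 have dl0 : 0 < dl by rewrite dlE divr_gt0// !mulr_gt0.
have dY : 2 * dl * Y = b * e1 / 4 by rewrite dlE; field; rewrite gt_eqF.
have [bb bbE] : exists v : R, v = b * (1 - e1) by eexists.
 have e1_lt1 : 0 < 1 - e1 by clear -e12; lra.
have bb0 : 0 < bb by rewrite bbE mulr_gt0.
have [BB BBE] : exists v : R, v = B * bb `^ alpha by eexists.
have BB0 : 0 < BB by rewrite BBE mulr_gt0// powR_gt0.
have BBG : G - eps / 2 <= BB.
  apply: (@le_trans _ _ ((1 - e1) * G)); first by clear -e1G; lra.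
  rewrite BBE bbE powRM ?(ltW b0)//; last exact: ltW.
  have -> : B * (b `^ alpha * (1 - e1) `^ alpha) = (1 - e1) `^ alpha * G by rewrite GE; ring.
  rewrite ler_pM2r//.
  have h1 : 0 < 1 - e1 <= 1 by rewrite e1_lt1 gerBl ltW.
  by have := ger_powR h1 (ltW a1); rewrite powRr1// ltW.
pose J := Num.bound (K / dl).
have [N1 HN1] := powR_large (1 / dl) a0.
have [N2 HN2] := powR_sublinear BB a1.
have cc0 : 0 < 4 * expR 1 :> R by rewrite mulr_gt0// expR_gt0.
have e20' : 0 < eps / 2 by rewrite divr_gt0.
have [N3 HN3] := polynomial_le_expR J.+1 cc0 e20' a0.
exists (maxn 1 (maxn N1 (maxn N2 N3))) => n.
rewrite !geq_max => /and4P[n1 nN1 nN2 nN3] l.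
have np : 0 < n%:R :> R by rewrite ltr0n.
have [x xE] : exists v : R, v = n%:R `^ alpha by eexists.
 have x0 : 0 < x by rewrite xE; exact: powR_gt0.
have nx : n%:R = x `^ (1 + p).
  by rewrite xE -powRrM /alpha mul1r mulVf ?powRr1.
rewrite -xE -GE.
have [lK|Kl] := leP (K * x) l%:R.
  apply: (@le_trans _ _ (Q [set y : seqR | (0 <= theta * psum l y)%R])).
    apply: le_measure; rewrite ?inE; first exact: measurable_pos_area.
      by apply: measurable_ge_fun; apply: measurable_funM => //; exact: measurable_psum.
    move=> y [pos _] /=; have [->|l0] := posnP l; first by rewrite /psum big_ord0 mulr0.
    by rewrite mulr_ge0// ltW// pos// l0 leqnn.
  apply: le_trans (chernoff_psum Qiid theta l 0) _; rewrite oppr0 expR0 mule1.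
  apply: (@le_trans _ _ (rho%:E ^+ l)%E).
    have := mgf_gt0 Q theta; move: Mrho; case: (mgf Q theta) => [M| |]//.
    rewrite lee_fin lte_fin => Mr M0; rewrite -!EFin_expe lee_fin.
    by apply: lerXn2r => //; rewrite nnegrE ltW.
  rewrite -EFin_expe lee_fin -[rho]lnK ?posrE// -expRM_natl ler_expR.
  have : K * x * (- ln rho) <= l%:R * (- ln rho) by rewrite ler_pM2r.
  have -> : K * x * (- ln rho) = G * x by rewrite KE mulrAC divfK// gt_eqF.
  by move: (mulr_gt0 x0 eps0); clear; lra.
pose m := (Num.trunc (dl * x)).+1.
have dx0 : 0 <= dl * x by rewrite mulr_ge0// ltW.
have m1 : dl * x <= m%:R by apply/ltW/truncnS_gt.
have m2 : m%:R <= 2 * dl * x.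
  have := HN1 n nN1; rewrite -xE ler_pdivrMr// => h1.
  by have /andP[+ _] := truncn_itv dx0; rewrite /m -natr1; move: h1; clear; lra.
have mp : 0 < m%:R :> R by rewrite ltr0n.
pose r := (l %/ m)%N.
have rml : (r * m <= l <= r * m + m)%N.
  by rewrite leq_divM /= {1}(divn_eq l m) leq_add2l ltnW// ltn_pmod.
have rmK : r%:R * m%:R <= K * x.
  apply/ltW/(le_lt_trans _ Kl); by rewrite -natrM ler_nat; case/andP: rml.
have rJ : (r <= J)%N.
  apply: ltnW; rewrite -(ltr_nat R); apply: le_lt_trans (archi_boundP _); last by rewrite divr_ge0// ltW.
  rewrite ler_pdivlMr// -(ler_pM2r x0) -mulrA; apply: le_trans rmK.
  exact: ler_wpM2l.
(* lam^(1+p) is a lower bound for the sum over blocks, so dividing space and time by lam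
   normalizes the area to 1 *)
have [lam lamE] : exists v : R, v = x * bb `^ alpha by eexists.
have lam0 : 0 < lam by rewrite lamE mulr_gt0// powR_gt0.
have lamp : lam `^ (1 + p) = n%:R * bb.
  rewrite lamE powRM ?powR_ge0 ?(ltW x0)// -nx -powRrM /alpha mul1r mulVf ?powRr1 ?(ltW bb0)//.
have lB : lam * B = x * BB by rewrite lamE BBE; ring.
pose E := [set y : seqR | C * x <= \sum_(i < l) `|y i|].
have sub : pos_area p l (n%:R * b) `<=` E `|` small_prod Q m r (lam * B).
  move=> y [pos area]; have [Ey|Ey] := leP (C * x) (\sum_(i < l) `|y i|); first by left.
  right; have hx0 : 0 < h * x by rewrite mulr_gt0.
  have := area_blocks split (ltW C20) p0 hx0 rml pos (ltW Ey).
  set S := \sum_(j < r) _ => /(le_trans area) areaS.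
  apply: small_prod_of_rate => //.
  have err : C2 * (m%:R * (r%:R * (h * x) `^ p + C * x / (h * x) * (C * x) `^ p)) + m%:R * (C * x) `^ p
      <= n%:R * b * (e1 / 2).
    rewrite !powRM ?(ltW h0) ?(ltW x0) ?(ltW C0)//.
    have -> : C * x / (h * x) = C / h by field; rewrite !gt_eqF.
    have nxx : n%:R = x * x `^ p.
      rewrite nx powRD; last by rewrite (gt_eqF x0) implybT.
      by rewrite powRr1 // ltW.
    have xp : 0 <= x `^ p := powR_ge0 _ _.
    have -> : C2 * (m%:R * (r%:R * (h `^ p * x `^ p) + C / h * (C `^ p * x `^ p))) + m%:R * (C `^ p * x `^ p) =
       (r%:R * m%:R * (C2 * h `^ p) + m%:R * Y) * x `^ p by rewrite YE; ring.
    have -> : n%:R * b * (e1 / 2) = (K * x * (C2 * h `^ p) + 2 * dl * x * Y) * x `^ p.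
      have -> : (K * x * (C2 * h `^ p) + 2 * dl * x * Y) = x * (C2 * K * h `^ p + 2 * dl * Y) by ring.
      by rewrite hp dY nxx; field.
    apply: ler_wpM2r => //; apply: lerD; last by rewrite ler_pM2r.
    by rewrite ler_pM2r// mulr_gt0// powR_gt0.
  have Slam : n%:R * bb <= S.
    have nb0 : 0 < n%:R * b by rewrite mulr_gt0.
    have h1 : n%:R * b * (1 - e1 / 2) <= (1 + e1 / 2) * S.
      by move: areaS err; clear; lra.
    have h2 : (1 + e1 / 2) * (n%:R * bb) <= n%:R * b * (1 - e1 / 2).
      have -> : (1 + e1 / 2) * (n%:R * bb) = n%:R * b * ((1 + e1 / 2) * (1 - e1)) by rewrite bbE; ring.
      rewrite ler_pM2l//; have h3 : 0 <= e1 * e1 by rewrite mulr_ge0// ltW.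
      by move: h3; clear; lra.
    by rewrite -(@ler_pM2l _ (1 + e1 / 2)); [exact: le_trans h2 h1|exact: addr_gt0].
  pose D j := psum m (shift (j * m) y) / lam.
  have De j : \sum_(i < j) D i = psum (j * m) y / lam.
    rewrite -mulr_suml; congr (_ / _); rewrite /psum (sum_blocks j m (fun i => y i)).
    by [].
  have := HB (m%:R / lam) r D (divr_gt0 mp lam0).
  rewrite (eq_bigr (fun j : 'I_r => ((m%:R / lam)%:E * cramer_rate (psum m (shift (j * m) y) / m%:R))%E)); last first.
    by move=> j _; congr (_ * cramer_rate _)%E; rewrite /D; field; rewrite !gt_eqF.
  apply.
    move=> j /andP[j0 jr]; rewrite De divr_gt0// pos// muln_gt0 j0 /=.
    by apply: leq_trans (proj1 (andP rml)); rewrite leq_mul2r jr orbT.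
  have -> : \sum_(j < r) m%:R / lam * Num.min (\sum_(i < j) D i) (\sum_(i < j.+1) D i) `^ p =
     S / lam `^ (1 + p).
    rewrite /S mulr_suml; apply: eq_bigr => j _; rewrite !De.
    have -> : Num.min (psum (j * m) y / lam) (psum (j.+1 * m) y / lam) =
       Num.min (psum (j * m) y) (psum (j.+1 * m) y) / lam.
      by rewrite minr_pMl// invr_ge0 ltW.
    rewrite powRM ?invr_ge0 ?(ltW lam0)//; last first.
      rewrite le_min; apply/andP; split; last first.
        apply/ltW/pos; rewrite muln_gt0 /=; apply: leq_trans (proj1 (andP rml)).
        by rewrite leq_mul2r ltn_ord orbT.
      have [j0|j0] := posnP j; first by rewrite j0 mul0n /psum big_ord0.
      apply/ltW/pos; rewrite muln_gt0 j0 /=; apply: leq_trans (proj1 (andP rml)).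
      by rewrite leq_mul2r ltnW ?orbT.
    have -> : lam^-1 `^ p = (lam `^ p)^-1 by rewrite -powRN -powR_inv1 ?(ltW lam0)// -powRrM mulN1r.
    rewrite powRD; last by rewrite (gt_eqF lam0) implybT.
    rewrite powRr1 ?(ltW lam0)// invfM.
    ring.
  by rewrite lamp ler_pdivlMr ?mul1r// mulr_gt0.
have mE : measurable E.
  apply: measurable_ge_fun; apply: measurable_sum => i; apply: measurableT_comp => //.
  exact: measurable_coord.
have mS : measurable (small_prod Q m r (lam * B)) by exact: measurable_small_prod.
apply: (@le_trans _ _ (Q (E `|` small_prod Q m r (lam * B)))).
  by apply: le_measure; rewrite ?inE//; [exact: measurable_pos_area|exact: measurableU].
apply: le_trans (measureU2 _ mE mS) _.
have QE : (Q E <= (expR (- (x * (G - eps / 2))))%:E)%E.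
  apply: le_trans (abs_sum_prob _ l (ltW c0) HA) _; rewrite lee_fin.
  rewrite -[A]lnK ?posrE ?(lt_le_trans ltr01)//.
  rewrite -expRM_natl -expRD ler_expR.
  have : l%:R * ln A <= K * x * ln A by apply: ler_wpM2r => //; exact: ltW.
  have -> : c * (C * x) = (K * ln A + G) * x by rewrite CE; field; rewrite gt_eqF.
  by move: (mulr_gt0 x0 eps0); clear; lra.
have tn : lam * B <= n%:R by rewrite lB mulrC xE; exact: HN2.
have QS := small_prod_bound Qiid m r tn.
apply: le_trans (leeD QE QS) _; rewrite -EFinD lee_fin.
have [Z ZE] : exists v : R, v = 2 * expR 1 * n.+1%:R by eexists.
rewrite -ZE.
have ex1 : 1 <= expR 1 :> R by rewrite -[leLHS]expR0 ler_expR.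
have Z1 : 1 <= Z.
  rewrite ZE.
  have n11 : 1 <= n.+1%:R :> R by rewrite ler1n.
  by apply: mulr_ege1 => //; apply: mulr_ege1 => //; rewrite ler1n.
have Zr : Z ^+ r <= Z ^+ J by apply: ler_weXn2l.
have ZJ : 1 + Z ^+ J <= expR (eps / 2 * x).
  have h3 := HN3 n nN3; rewrite -xE in h3; apply: le_trans h3.
  have -> : 4 * expR 1 * n.+1%:R = 2 * Z by rewrite ZE; ring.
  exact: one_add_exp_le.
have xB : expR (- (lam * B)) <= expR (- (x * (G - eps / 2))).
  by rewrite ler_expR lerN2 lB ler_pM2l.
have -> : - (x * (G - eps)) = - (x * (G - eps / 2)) + eps / 2 * x by field.
rewrite expRD.
have ep := expR_gt0 (- (x * (G - eps / 2))).
apply: (@le_trans _ _ (expR (- (x * (G - eps / 2))) * (1 + Z ^+ J))); last by rewrite ler_pM2l.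
rewrite [leRHS]mulrDr mulr1 lerD2l mulrC; apply: ler_pM => //.
by apply: exprn_ge0; exact: le_trans ler01 Z1.
Qed.

End upper.


(** * Paths of bounded variation and their area *)

Section bv_paths.
Context {R : realType}.
Local Notation mu := (@lebesgue_measure R).
Implicit Types (xi F : R -> R).

Lemma mu_itvoc (a b : R) : a <= b -> mu `]a, b]%classic = (b - a)%:E.
Proof.
move=> ab; rewrite lebesgue_measure_itv/= lte_fin; move: ab; rewrite le_eqVlt => /orP[/eqP ->|->//].
by rewrite ltxx subrr.
Qed.

Lemma integral_cst_itv (a b c : R) : a <= b ->
  (\int[mu]_(x in `]a, b]%classic) c%:E = (c * (b - a))%:E)%E.
Proof.
by move=> ab; rewrite EFinM -(mu_itvoc ab); exact: integral_cst.
Qed.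

Lemma itv_oc_split (a b c : R) : a <= b -> b <= c ->
  `]a, c]%classic = `]a, b]%classic `|` `]b, c]%classic.
Proof.
move=> ab bc; apply/seteqP; split => s /=; rewrite !in_itv/=.
  by move=> /andP[-> sc]; have [sb|sb] := leP s b; [left|right].
by move=> [/andP[-> /le_trans ->]//|/andP[/(le_lt_trans ab) -> ->]].
Qed.

(** The total variation of the path on [0, t] as a function of t. *)
Lemma bv_control T xi : 0 <= T -> bounded_variation 0 T xi ->
  exists F : R -> R, forall s t, 0 <= s -> s <= t -> t <= T -> `|xi t - xi s| <= F t - F s.
Proof.
move=> T0 bv; exists (fun t => fine (total_variation 0 t xi)) => s t s0 st tT.
have bvt x : 0 <= x -> x <= T -> total_variation 0 x xi \is a fin_num.
  move=> x0 xT; apply/bounded_variationP => //; exact: bounded_variationl bv.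
have fs := bvt s s0 (le_trans st tT); have ft := bvt t (le_trans s0 st) tT.
have E := total_variationD xi s0 st.
rewrite lerBrDl -lee_fin EFinD (fineK fs) (fineK ft) E leeD2l//.
exact: total_variation_ge.
Qed.

(** The path is the difference of the monotone functions F and F - xi. *)
Lemma bv_measurable T xi F : (forall s t, 0 <= s -> s <= t -> t <= T -> `|xi t - xi s| <= F t - F s) ->
  measurable_fun `[0, T] xi.
Proof.
have [T0|T0] := leP 0 T; last by move=> _; rewrite set_itv_ge ?bnd_simp -?ltNge//; exact: measurable_fun_set0.
move=> H; pose G x := F (clamp T x); pose K x := F (clamp T x) - xi (clamp T x).
have cl x : 0 <= clamp T x <= T by exact: clamp_itv.
apply: (eq_measurable_fun (fun x => G x - K x)).
  by move=> x; rewrite inE/= in_itv/= => xT; rewrite /G /K clamp_id//; lra.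
have HG s t : s <= t -> `|xi (clamp T t) - xi (clamp T s)| <= G t - G s.
  move=> st; have /andP[s0 _] := cl s; have /andP[_ tT] := cl t.
  by apply: H => //; exact: clamp_le.
apply: measurable_funB; apply: nondecreasing_measurable => // s t /HG h.
- by have := normr_ge0 (xi (clamp T t) - xi (clamp T s)); lra.
- by move: h; rewrite /K -/(G s) -/(G t); have := ler_norm (xi (clamp T t) - xi (clamp T s)); lra.
Qed.

(** Otherwise let - h be half of a negative value. The first time at which the path goes below -
    h is positive by right continuity at 0, and there the path attains its running infimum, so
    the reflected path vanishes before the hitting time. *)
Lemma path_ge0 xi t : cadlag xi -> xi 0 = 0 -> 0 <= t -> (t%:E < hitting_time xi)%E -> 0 <= xi t.
Proof.
move=> [rc _] x0 t0 tT; rewrite leNgt; apply/negP => xt.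
(* half of the negative value, so that the level - h lies strictly between 0 and xi t *)
pose h := - (xi t / 2); have h0 : 0 < h by rewrite /h; lra.
have near r c : 0 <= r -> c < xi r -> exists2 e, 0 < e & forall s, r <= s < r + e -> c < xi s.
  move=> r0 cr; have /cvgrPdist_lt/(_ (xi r - c)) := rc r r0; rewrite subr_gt0 => /(_ cr).
  move=> [e /= e0 He]; exists e => // s /andP[rs sr].
  move: rs; rewrite le_eqVlt => /orP[/eqP <-//|rs].
  have := He s; rewrite /= ltr0_norm ?subr_lt0// opprB => /(_ _ rs) H.
  by have := ltr_normlW (H _); rewrite ltrBlDl => /(_ sr); lra.
have [e e0 He] : exists2 e, 0 < e & forall s, 0 <= s < 0 + e -> - h < xi s.
  by apply: near => //; rewrite x0; lra.
pose A := [set s | 0 <= s <= t /\ xi s < - h].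
have At : A t by split; [rewrite t0 lexx|rewrite /h; lra].
have lbA : lbound A e.
  move=> s [/andP[s0 _] xs]; rewrite leNgt; apply/negP => se.
  by have := He s; rewrite s0 add0r se => /(_ isT); lra.
have hA : has_inf A by split; [exists t|exists e].
pose r := inf A; have re : e <= r by apply: lb_le_inf => //; exists t.
have rt : r <= t by apply: ge_inf => //; exists e.
have r0 : 0 < r by lra.
have before s : 0 <= s -> s < r -> - h <= xi s.
  move=> s0 sr; rewrite leNgt; apply/negP => xs.
  have : A s by split => //; rewrite s0 /=; lra.
  by move=> /(ge_inf (proj2 hA)); rewrite -/r; lra.
have xr : xi r <= - h.
  rewrite leNgt; apply/negP => xr; have [d d0 Hd] := near r _ (ltW r0) xr.
  have [s [/andP[s0 _] xs] sr] := inf_adherent d0 hA; rewrite -/r in sr.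
  have [rs|rs] := ltP s r; first by have := before s s0 rs; lra.
  by have := Hd s; rewrite rs sr => /(_ isT); lra.
have inf_r : inf [set Num.min (xi s) 0 | s in `[0, r]] = xi r.
  have lb : lbound [set Num.min (xi s) 0 | s in `[0, r]] (xi r).
    move=> _ [s /= + <-]; rewrite in_itv/= => /andP[s0]; rewrite le_eqVlt le_min => /orP[/eqP ->|sr].
      by rewrite lexx; lra.
    by have := before s s0 sr; lra.
  apply/eqP; rewrite eq_le; apply/andP; split.
    apply: ge_inf; first by exists (xi r).
    by exists r; [rewrite /= in_itv/= lexx ltW|rewrite min_l//; lra].
  by apply: lb_le_inf => //; exists (Num.min (xi r) 0); exists r => //; rewrite /= in_itv/= lexx ltW.
have : (hitting_time xi <= r%:E)%E.
  by apply: ereal_inf_lbound; exists r => //; split => //; rewrite /reflection inf_r subrr.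
by rewrite leNgt (le_lt_trans _ tT)// lee_fin.
Qed.

Lemma reflection_before xi t : cadlag xi -> xi 0 = 0 -> 0 <= t -> (t%:E < hitting_time xi)%E ->
  reflection xi t = xi t.
Proof.
move=> cx x0 t0 tT; rewrite /reflection.
have -> : [set Num.min (xi s) 0 | s in `[0, t]] = [set 0].
  apply/seteqP; split => [_ [s /= + <-]|_ ->].
    rewrite in_itv/= => /andP[s0 st]; rewrite min_r//; apply: path_ge0 => //.
    by apply: le_lt_trans tT; rewrite lee_fin.
  by exists 0; rewrite /= ?in_itv/= ?lexx ?t0// x0 minxx.
by rewrite inf1 subr0.
Qed.

Lemma path_gt0 xi t : cadlag xi -> xi 0 = 0 -> 0 < t -> (t%:E < hitting_time xi)%E -> 0 < xi t.
Proof.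
move=> cx x0 t0 tT; rewrite lt_def path_ge0 ?(ltW t0)// andbT; apply/eqP => xt.
have : (hitting_time xi <= t%:E)%E.
  by apply: ereal_inf_lbound; exists t => //; split => //; rewrite reflection_before ?(ltW t0).
by rewrite leNgt tT.
Qed.

Lemma hitting_time_ge0 xi : (0 <= hitting_time xi)%E.
Proof. by apply: le_ereal_inf_tmp => _ [t [t0 _] <-]; rewrite lee_fin ltW. Qed.

(** Treats finite and infinite hitting times simultaneously. *)
Lemma upto_exhaust (T : \bar R) : (0 <= T)%E -> exists t_ : nat -> R,
  [/\ {homo t_ : m n / (m <= n)%N >-> m <= n}, forall n, 0 <= t_ n,
      forall n, 0 < t_ n -> ((t_ n)%:E < T)%E &
      forall s, 0 < s -> (s%:E < T)%E -> exists n, s <= t_ n].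
Proof.
case: T => [T| |]// T0.
- rewrite lee_fin in T0; exists (fun n => T * (1 - n.+1%:R^-1)).
  have inv1 n : 0 < (n.+1%:R^-1 : R) <= 1 by rewrite invr_gt0 ltr0Sn invf_le1//= ler1n.
  split.
  + move=> m n mn; apply: ler_wpM2l => //; rewrite lerD2l lerN2 lef_pV2 ?posrE//.
    by rewrite ler_nat.
  + by move=> n; have /andP[? ?] := inv1 n; rewrite mulr_ge0// subr_ge0.
  + move=> n; have /andP[i0 i1] := inv1 n => tn.
    have Tp : 0 < T by rewrite lt_def T0 andbT; apply/eqP => T00; rewrite T00 mul0r ltxx in tn.
    by rewrite lte_fin gtr_pMr// gtrBl.
  + move=> s s0; rewrite lte_fin => sT; have Tp : 0 < T by lra.
    exists (Num.bound (T / (T - s))).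
    have := archi_boundP (divr_ge0 (ltW Tp) (ltW (_ : 0 < T - s))); rewrite subr_gt0 => /(_ sT).
    set n := Num.bound _ => hn.
    rewrite mulrBr mulr1 lerBrDr -lerBrDl ler_pdivrMr//.
    rewrite ltr_pdivrMr ?subr_gt0// in hn; rewrite mulrC.
    apply: (le_trans (ltW hn)); apply: ler_wpM2r; first by rewrite subr_ge0 ltW.
    by rewrite ler_nat.
- exists (fun n => n%:R); split => //.
  + by move=> m n; rewrite ler_nat.
  + by move=> n _; rewrite ltry.
  + move=> s s0 _; exists (Num.bound s); apply/ltW/archi_boundP; exact: ltW.
Qed.

(** Before the hitting time the reflected path is the path; the endpoints of the interval do not
    contribute, and the integral over the open interval is a limit of integrals over compact
    intervals. *)
Lemma area_truncate p xi eps : 0 < p -> BV_path xi -> xi 0 = 0 ->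
  (1 <= \int[mu]_(s in upto (hitting_time xi)) (reflection xi s `^ p)%:E)%E ->
  0 < eps < 1 -> exists t, [/\ 0 < t, (t%:E < hitting_time xi)%E &
    ((1 - eps)%:E <= \int[mu]_(s in `]0%R, t]%classic) (xi s `^ p)%:E)%E].
Proof.
move=> p0 [cx bv] x0 area /andP[e0 e1]; set T := hitting_time xi in area *.
have T0 : (0 <= T)%E by exact: hitting_time_ge0.
have [t_ [t_nd t_0 t_T t_ex]] := upto_exhaust T0.
pose F n := `]0, t_ n]%classic : set R.
have mF n : measurable (F n) by exact: measurable_itv.
pose D := \bigcup_n F n.
have DE s : D s <-> 0 < s /\ (s%:E < T)%E.
  split=> [[n _]|[s0 sT]].
    rewrite /F /= in_itv/= => /andP[s0 sn]; split => //; apply: le_lt_trans (t_T n _); rewrite ?lee_fin//.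
    exact: lt_le_trans sn.
  have [n sn] := t_ex s s0 sT; exists n => //; by rewrite /F /= in_itv/= s0.
have mD : measurable D by exact: bigcupT_measurable.
have mxi n : measurable_fun (F n) xi.
  have [G HG] := bv_control (t_0 n) (bv _ (t_0 n)).
  apply: measurable_funS (bv_measurable HG) => //.
  by apply: subset_itvr; rewrite bnd_simp.
have mf : measurable_fun D (fun s => (xi s `^ p)%:E).
  apply/measurable_EFinP; apply: (measurableT_comp (measurable_powR p)).
  by apply/measurable_fun_bigcup.
pose N := upto T `\` D.
have cN (B : set R) : B `<=` N -> countable B.
  move=> BN; apply: (@sub_countable _ _ _ [set 0; fine T]).
    apply: subset_card_le => s /BN[[s0 sT] nD].
    move: s0; rewrite le_eqVlt => /orP[/eqP <-|s0]; first by left.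
    right; case: (T) sT DE => [t| |] /= sT DE'.
    - apply/eqP; rewrite eq_le; move: (sT); rewrite lee_fin => -> /=.
      by rewrite leNgt; apply/negP => sT'; apply: nD; apply/DE'.
    - by exfalso; apply: nD; apply/DE'; split => //; rewrite ltry.
    - by [].
  exact: finite_set_countable.
have mN : measurable N by apply: countable_measurable; [exact: measurable_set1|exact: cN].
have UE : upto T = D `|` N.
  apply/seteqP; split => s; first by move=> us; have [|] := pselect (D s); [left|right].
  by move=> [/DE[s0 sT]|[]//]; split; exact: ltW.
have DU : upto T `\` N = D.
  rewrite UE setDUl setDv setU0; apply/seteqP; split => s; first by case.
  by move=> Ds; split => // -[_].
have refl s : D s -> reflection xi s = xi s.
  by move=> /DE[s0 sT]; apply: reflection_before => //; exact: ltW.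
have mr : measurable_fun (upto T) (fun s => (reflection xi s `^ p)%:E).
  rewrite UE; apply/measurable_funU => //; split.
    apply: (eq_measurable_fun (fun s => (xi s `^ p)%:E)) mf => s.
    by rewrite inE => /refl ->.
  move=> _ Y mY; apply: countable_measurable; [exact: measurable_set1|apply: cN; exact: subIsetl].
have mU : measurable (upto T) by rewrite UE; exact: measurableU.
have N0 : mu N = 0%E by apply: countable_lebesgue_measure0; exact: cN.
have negl : (\int[mu]_(s in upto T) (reflection xi s `^ p)%:E =
    \int[mu]_(s in D) (xi s `^ p)%:E)%E.
  apply: (etrans (@ge0_negligible_integral _ _ _ mu _ _ _ mN mU mr _ N0)).
    by move=> x _; rewrite lee_fin powR_ge0.
  rewrite DU; apply: eq_integral => s; by rewrite inE => /refl ->.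
rewrite negl in area.
have ndF : nondecreasing_seq F.
  move=> m n mn; apply/subsetPset; apply: subset_itvl; rewrite bnd_simp; exact: t_nd.
have mfn n : measurable_fun (F n) (fun s => (xi s `^ p)%:E).
  by apply: measurable_funS mD _ mf; exact: (bigcup_sup I).
have cv := ge0_nondecreasing_set_cvg_integral (mu := mu) ndF mF mfn (fun n s _ => powR_ge0 (xi s) p).
have [n Fn] : exists n, ((1 - eps)%:E < \int[mu]_(s in F n) (xi s `^ p)%:E)%E.
  apply: contrapT => N'; have : (\int[mu]_(s in D) (xi s `^ p)%:E <= (1 - eps)%:E)%E.
    apply: (cvge_le _ cv); apply: nearW => n /=; rewrite leNgt; apply/negP => h.
    by apply: N'; exists n.
  by move=> /(le_trans area); rewrite lee_fin; lra.
exists (t_ n); have tn : 0 < t_ n.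
  rewrite ltNge; apply/negP => tn; move: Fn; rewrite /F set_itv_ge ?bnd_simp -?leNgt//.
  by rewrite integral_set0 lte_fin; lra.
by split; [exact: tn|exact: t_T|exact: ltW].
Qed.

(** On a block the path exceeds its smaller endpoint by at most the increment of F, and these
    increments add up to a constant; so the error is small when the blocks are short. *)
Lemma area_riemann p (xi F : R -> R) t eps : 0 < p -> 0 < t ->
  (forall s, 0 <= s <= t -> 0 <= xi s) ->
  (forall r s, 0 <= r -> r <= s -> s <= t -> `|xi s - xi r| <= F s - F r) ->
  0 < eps -> exists2 J, (0 < J)%N & let D := t / J%:R in
  (\int[mu]_(s in `]0%R, t]%classic) (xi s `^ p)%:E <=
   ((1 + eps) * (\sum_(j < J) D * Num.min (xi (j%:R * D)) (xi (j.+1%:R * D)) `^ p) + eps)%:E)%E.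
Proof.
move=> p0 t0 xi0 HF e0.
have [C C0 split] := powR_split p0 e0.
pose W := F t - F 0.
have W0 : 0 <= W.
  by have := HF 0 t (lexx _) (ltW t0) (lexx _); have := normr_ge0 (xi t - xi 0); rewrite /W; lra.
pose h := (eps / (2 * C * t)) `^ p^-1.
have q0 : 0 < eps / (2 * C * t) by rewrite divr_gt0// !mulr_gt0.
have h0 : 0 < h by exact: powR_gt0.
have hp : C * t * h `^ p = eps / 2.
  rewrite /h -powRrM mulVf ?gt_eqF// powRr1 ?(ltW q0)//.
  by field; rewrite !gt_eqF.
pose J := (Num.bound (t * C * (W / h * W `^ p) / (eps / 2))).+1.
exists J => // D; have J0 : 0 < J%:R :> R by rewrite ltr0n.
have D0 : 0 < D by rewrite divr_gt0.
have JD : J%:R * D = t by rewrite /D mulrC divfK ?gt_eqF.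
have WW : 0 <= W / h * W `^ p by rewrite mulr_ge0 ?powR_ge0// divr_ge0// ltW.
have DW : C * (D * (W / h * W `^ p)) <= eps / 2.
  have X0 : 0 <= t * C * (W / h * W `^ p) / (eps / 2).
    by rewrite !mulr_ge0 ?invr_ge0 ?mulr_ge0 ?powR_ge0// ?ltW// invr_gt0.
  have h1 : t * C * (W / h * W `^ p) / (eps / 2) <= J%:R.
    apply: (le_trans (ltW (archi_boundP X0))); by rewrite ler_nat.
  rewrite ler_pdivrMr ?divr_gt0// in h1.
  rewrite /D; have -> : C * (t / J%:R * (W / h * W `^ p)) = t * C * (W / h * W `^ p) / J%:R by ring.
  by rewrite ler_pdivrMr// [leRHS]mulrC.
pose x j := j%:R * D; have xD j : x j.+1 = x j + D by rewrite /x -natr1 mulrDl mul1r.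
have xt j : (j <= J)%N -> x j <= t by move=> jJ; rewrite -JD /x ler_pM2r// ler_nat.
have x0 j : 0 <= x j by rewrite mulr_ge0// ltW.
pose w j := F (x j.+1) - F (x j).
have mxi := bv_measurable HF.
have mf (a b : R) : 0 <= a -> b <= t -> measurable_fun `]a, b]%classic (fun s => (xi s `^ p)%:E).
  move=> a0 bt; apply/measurable_EFinP; apply: (measurableT_comp (measurable_powR p)).
  apply: measurable_funS mxi => //.
  by move=> s /=; rewrite !in_itv/= => /andP[/ltW h1 h2]; rewrite (le_trans a0 h1) (le_trans h2 bt).
have blk j : (j < J)%N -> (\int[mu]_(s in `]x j, x j.+1]%classic) (xi s `^ p)%:E <=
   ((1 + eps) * (D * Num.min (xi (x j)) (xi (x j.+1)) `^ p) + C * (D * (h `^ p + w j / h * W `^ p)))%:E)%E.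
  move=> jJ; set m := Num.min _ _.
  have m0 : 0 <= m by rewrite le_min !xi0 ?x0 ?xt//; exact: ltnW.
  have Fmono a b : 0 <= a -> a <= b -> b <= t -> F a <= F b.
    by move=> a0 ab bt; have := HF a b a0 ab bt; have := normr_ge0 (xi b - xi a); lra.
  have xx : x j <= x j.+1 by rewrite xD lerDl ltW.
  have wW : 0 <= w j <= W.
    have := Fmono 0 (x j) (lexx _) (x0 j) (xt _ (ltnW jJ)).
    have := Fmono (x j.+1) t (x0 _) (xt _ jJ) (lexx _).
    have := Fmono (x j) (x j.+1) (x0 _) xx (xt _ jJ).
    by rewrite /w /W; lra.
  have -> : (1 + eps) * (D * m `^ p) + C * (D * (h `^ p + w j / h * W `^ p)) =
     ((1 + eps) * m `^ p + C * (h `^ p + w j / h * W `^ p)) * D by ring.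
  apply: (@le_trans _ _ (\int[mu]_(s in `]x j, x j.+1]%classic) ((1 + eps) * m `^ p + C * (h `^ p + w j / h * W `^ p))%:E)%E).
    apply: ge0_le_integral => //.
    - by move=> s _; rewrite lee_fin powR_ge0.
    - by apply: mf => //; exact: xt.
    - move=> s /=; rewrite in_itv/= => /andP[/ltW s1 s2].
      have s0 : 0 <= s by apply: le_trans s1.
      have st : s <= t by apply: le_trans (xt _ jJ).
      have w0 : 0 <= w j by case/andP: wW.
      have : xi s <= m + w j.
        rewrite -lerBlDr le_min; apply/andP; split; rewrite lerBlDr.
          have := HF (x j) s (x0 _) s1 st; have := Fmono s (x j.+1) s0 s2 (xt _ jJ).
          by have := ler_norm (xi s - xi (x j)); rewrite /w; lra.
        have := HF s (x j.+1) s0 s2 (xt _ jJ); have := Fmono (x j) s (x0 _) s1 st.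
        by have := ler_norm (- (xi (x j.+1) - xi s)); rewrite normrN /w; lra.
      move=> sm; rewrite lee_fin; apply: (@le_trans _ _ ((m + w j) `^ p)).
        by apply: ge0_ler_powR; rewrite ?nnegrE ?(ltW p0) ?xi0 ?s0 ?st// addr_ge0.
      apply: (le_trans (split _ _ m0 w0)); rewrite lerD2l; apply: ler_wpM2l; first exact: ltW.
      exact: powR_le_linear.
  by rewrite integral_cst_itv// xD addrAC subrr add0r.
have sum n : (n <= J)%N -> (\int[mu]_(s in `]0%R, x n]%classic) (xi s `^ p)%:E <=
   ((1 + eps) * (\sum_(j < n) D * Num.min (xi (x j)) (xi (x j.+1)) `^ p) +
    C * (D * (n%:R * h `^ p + (F (x n) - F 0) / h * W `^ p)))%:E)%E.
  elim: n => [|n ih] nJ.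
    rewrite /x mul0r set_itvoc0 integral_set0 big_ord0 subrr !mul0r addr0 !mulr0 addr0.
    by [].
  have -> : `]0%R, x n.+1]%classic = `]0%R, x n]%classic `|` `]x n, x n.+1]%classic.
    by apply: itv_oc_split; rewrite ?x0// xD lerDl ltW.
  rewrite ge0_integral_setU//.
  - apply: le_trans (leeD (ih (ltnW nJ)) (blk n nJ)) _.
    rewrite -EFinD lee_fin big_ord_recr /= -natr1 le_eqVlt; apply/orP; left; apply/eqP.
    by rewrite /w; ring.
  - rewrite (_ : _ `|` _ = `]0, x n.+1]%classic); first by apply: mf => //; exact: xt.
    by apply/esym/itv_oc_split; rewrite ?x0// xD lerDl ltW.
  - by move=> s _; rewrite lee_fin powR_ge0.
  - apply/disj_setPS => s [/=]; rewrite !in_itv/= => /andP[_ h1] /andP[h2 _].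
    by have := lt_le_trans h2 h1; rewrite ltxx.
have xJ : x J = t by exact: JD.
have := sum J (leqnn _); rewrite xJ => h1; apply: (le_trans h1).
rewrite lee_fin lerD2l -/W.
have -> : C * (D * (J%:R * h `^ p + W / h * W `^ p)) = C * (J%:R * D) * h `^ p + C * (D * (W / h * W `^ p)) by ring.
rewrite JD hp; lra.
Qed.

End bv_paths.


(** * The cost of a path, block by block *)

Section limits.
Context {R : realType}.

Lemma nondecreasing_limit (u : R -> R) : {homo u : x y / x <= y} ->
  exists l, (u t)%:E @[t --> +oo] --> l /\ forall t, ((u t)%:E <= l)%E.
Proof.
move=> nd; have [ub|nub] := pselect (has_ubound (range u)).
  exists (sup (range u))%:E; split.
    by apply: cvg_EFin; [exact: nearW|exact: nondecreasing_cvgr].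
  move=> t; rewrite lee_fin; apply: ub_le_sup => //; by exists t.
exists +oo%E; split; last by move=> t; exact: leey.
apply/cvgeryP/cvgryPge => A; have [x Ax] : exists x, A < u x.
  apply: contrapT => N; apply: nub; exists A => _ [x _ <-].
  by rewrite leNgt; apply/negP => h; apply: N; exists x.
exists x; split; first exact: num_real.
by move=> y xy; apply/ltW/(lt_le_trans Ax)/nd/ltW.
Qed.

Lemma value_at_ge (u : R -> R) (T : \bar R) t : {homo u : x y / x <= y} ->
  (t%:E < T)%E -> ((u t)%:E <= value_at u T)%E.
Proof.
move=> nd; case: T => [T| |] //=; first by rewrite lte_fin lee_fin => /ltW/nd.
by move=> _; have [l [ul tl]] := nondecreasing_limit nd; rewrite (cvg_lim _ ul).
Qed.

Lemma value_at_opp_le0 (v : R -> R) (T : \bar R) : {homo v : x y / x <= y} -> v 0 = 0 ->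
  (0 <= T)%E -> (value_at (fun t => - v t)%R T <= 0)%E.
Proof.
move=> nd v0; case: T => [T| |] //=.
  by rewrite !lee_fin oppr_le0 => T0; rewrite -v0; exact: nd.
move=> _; have [l [vl tl]] := nondecreasing_limit nd.
have nvl : (- v t)%:E @[t --> +oo] --> (- l)%E by exact: (@cvgeN R (pinfty_nbhs R) _ R (fun t => (v t)%:E) l vl).
rewrite (cvg_lim _ nvl)// oppe_le0.
by have := tl 0; rewrite v0.
Qed.

End limits.

(** The integral of a nonnegative function is a supremum over the simple functions below it, so
    it is monotone even for functions that are not measurable. The derivative of a path is an
    arbitrary function where it does not exist. *)
Lemma ge0_le_integral_any d (T : measurableType d) (R : realType) (m : {measure set T -> \bar R})
    (D : set T) (f g : T -> \bar R) :
  (forall x, D x -> (0 <= f x)%E) -> (forall x, D x -> (f x <= g x)%E) ->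
  (\int[m]_(x in D) f x <= \int[m]_(x in D) g x)%E.
Proof.
move=> f0 fg; rewrite !ge0_integralE//; last by move=> x Dx; exact: le_trans (f0 x Dx) (fg x Dx).
apply: ereal_sup_le => _ [h hf <-]; exists h => // x.
apply: (le_trans (hf x)); rewrite !patchE; case: ifPn => // xD; apply: fg.
by rewrite inE in xD.
Qed.

Section rate_function.
Context d (Omega : measurableType d) (R : realType) (P : probability Omega R).
Variable X : {RV P >-> R}.
Local Notation mu := (@lebesgue_measure R).
Local Notation M := ('M_P X).
Hypothesis M0 : M 0 = 1%E.
Hypothesis M_gt0 : forall t, (0 < M t)%E.

Lemma Lambda_star_ge t m y : M t = m%:E -> ((t * y - ln m)%:E <= Lambda_star X y)%E.
Proof.
move=> Mt; have m0 : 0 < m by have := M_gt0 t; rewrite Mt lte_fin.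
apply: ereal_sup_ubound; exists t => //.
by rewrite -[mmt_gen_fun _ _ _]/(M t) Mt lne_EFin.
Qed.

Lemma Lambda_star_ge0 y : (0 <= Lambda_star X y)%E.
Proof. by have := Lambda_star_ge y M0; rewrite mul0r ln1 subr0. Qed.

Lemma le_theta_plus t m : M t = m%:E -> (t%:E <= theta_plus X)%E.
Proof. by move=> Mt; apply: ereal_sup_ubound; exists t => //=; rewrite Mt ltry. Qed.

Lemma theta_plus_ge0 : (0 <= theta_plus X)%E.
Proof. exact: le_theta_plus M0. Qed.

Lemma theta_minus_le0 : (theta_minus X <= 0)%E.
Proof. by apply: ereal_inf_lbound; exists 0 => //=; rewrite M0 ltry. Qed.

(** A supremum of affine functions is lower semicontinuous. *)
Lemma measurable_Lambda_star : measurable_fun setT (Lambda_star X).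
Proof.
apply: lower_semicontinuous_measurable; apply/lower_semicontinuousP => a.
have -> : [set x | (a%:E < Lambda_star X x)%E] =
    \bigcup_t [set x | (a%:E < (t * x)%:E - lne (M t))%E].
  apply/seteqP; split => x /=.
    by move=> /ereal_sup_gt[_ [t _ <-] h]; exists t.
  by move=> [t _ /= h]; apply: (lt_le_trans h); apply: ereal_sup_ubound; exists t.
apply: bigcup_open => t _; case: (lne (M t)) => [l| |] /=.
- have -> : [set x | (a%:E < (t * x)%:E - l%:E)%E] = [set x | a + l < t * x].
    by apply/seteqP; split => x /=; rewrite -EFinB lte_fin ltrBrDr.
  have ct : continuous (fun x : R => t * x) by move=> x; exact: mulrl_continuous.
  have := @open_comp _ _ (fun x : R => t * x) [set y | a + l < y] (fun x _ => ct x) (@open_gt _ _).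
  exact.
- have -> : [set x : R | (a%:E < (t * x)%:E - +oo)%E] = set0 by apply/seteqP; split => x.
  exact: open0.
- have -> : [set x : R | (a%:E < (t * x)%:E - -oo)%E] = setT.
    by apply/seteqP; split => x //= _; rewrite /= ltry.
  exact: openT.
Qed.

Section path_cost.
Variables (xi a : R -> R) (u v : cumulative R R) (t c : R).
Hypothesis dec : BV_decomposition xi a u v.
Let T := hitting_time xi.
Hypothesis cost : (decomposition_cost X T a u v <= c%:E)%E.
Hypotheses (t0 : 0 < t) (tT : (t%:E < T)%E).

(** The derivative is replaced by a measurable density, which agrees with it almost everywhere,
    and the downward singular part, whose cost is nonnegative, is discarded. *)
Lemma cost_density : exists g : R -> R,
  [/\ measurable_fun setT g, mu.-integrable setT (EFin \o g),
    forall r s, 0 <= r -> r <= s -> s <= t ->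
      (\int[mu]_(x in `]r, s]%classic) (g x)%:E = (a s - a r)%:E)%E &
    (\int[mu]_(x in `]0%R, t]%classic) Lambda_star X (g x) + theta_plus X * (u t)%:E <= c%:E)%E].
Proof.
have [xiE ac uv0 _ _] := dec.
have [g [ig gE aeg]] := ac_FTC t0 (ac t (ltW t0)).
have mg : measurable_fun setT g.
  by have := measurable_int mu ig => /measurable_EFinP.
exists g; split => //.
have mLg : measurable_fun setT (Lambda_star X \o g) by exact: (measurableT_comp measurable_Lambda_star).
have T0 : (0 <= T)%E by exact: hitting_time_ge0.
have ndu : {homo u : x y / x <= y} by exact: cumulative_is_nondecreasing.
have ndv : {homo v : x y / x <= y} by exact: cumulative_is_nondecreasing.
apply: le_trans cost; rewrite /decomposition_cost -[leLHS]adde0; apply: leeD; last first.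
  apply: mule_le0; first exact: theta_minus_le0.
  by apply: value_at_opp_le0 => //; have [] := uv0 0 (lexx _).
apply: leeD; last first.
  by apply: lee_wpmul2l; [exact: theta_plus_ge0|exact: value_at_ge].
have [N [mN N0 Ng]] := aeg.
pose B := `]0, t[%classic `\` N.
have mB : measurable B by apply: measurableD.
have BE : (\int[mu]_(x in `]0%R, t]%classic) Lambda_star X (g x) = \int[mu]_(x in B) Lambda_star X (g x))%E.
  rewrite -integral_itv_bndo_bndc; last exact: measurable_funS mLg.
  apply: ge0_negligible_integral => //; first exact: measurable_funS mLg.
  by move=> x _; exact: Lambda_star_ge0.
rewrite BE; have BT : B `<=` upto T.
  move=> x [/=]; rewrite in_itv/= => /andP[x0 xt] _; split; first exact: ltW.
  by apply/ltW/(lt_trans _ tT); rewrite lte_fin.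
rewrite -(setIidr BT) integral_mkcondr; apply: ge0_le_integral_any.
- by move=> x _; apply: erestrict_ge0 => y _; exact: Lambda_star_ge0.
- move=> x _; rewrite patchE; case: ifPn => [|_]; last exact: Lambda_star_ge0.
  rewrite inE => -[/= xt nN].
  have -> : a^`()%classic x = g x.
    apply: contrapT => h; apply: nN; apply: Ng => /= h'; apply: h; apply: h'.
    by move: xt; rewrite in_itv.
  exact: lexx.
Qed.

(** For s >= 0 with a finite moment m, the increment of the absolutely continuous part on a
    block is the integral of the density g, and s g <= Lambda* (g) + ln m pointwise; an upward
    singular increment du satisfies s du <= theta_+ du because s <= theta_+; and a downward
    singular increment only decreases the left side. *)
Lemma block_costs (J : nat) : (0 < J)%N -> let D := t / J%:R in
  exists cj : nat -> R, [/\ forall j, (j < J)%N -> 0 <= cj j,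
    \sum_(j < J) D * cj j <= c &
    forall j, (j < J)%N -> forall s, 0 <= s ->
      ((expR (s * ((xi (j.+1%:R * D) - xi (j%:R * D)) / D)))%:E <= (expR (cj j))%:E * M s)%E].
Proof.
move=> J0 D; have [g [mg ig gE gc]] := cost_density.
have [xiE _ uv0 _ _] := dec.
have ndu : {homo u : x y / x <= y} by exact: cumulative_is_nondecreasing.
have ndv : {homo v : x y / x <= y} by exact: cumulative_is_nondecreasing.
have Jp : 0 < J%:R :> R by rewrite ltr0n.
have D0 : 0 < D by rewrite divr_gt0.
pose x j := j%:R * D; have xD j : x j.+1 = x j + D by rewrite /x -natr1 mulrDl mul1r.
have xJ : x J = t by rewrite /x /D mulrC divfK ?gt_eqF.
have xt j : (j <= J)%N -> x j <= t by move=> jJ; rewrite -xJ /x ler_pM2r// ler_nat.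
have x0 j : 0 <= x j by rewrite mulr_ge0// ltW.
have xx j : x j <= x j.+1 by rewrite xD lerDl ltW.
have mLg : measurable_fun setT (Lambda_star X \o g) by exact: (measurableT_comp measurable_Lambda_star).
pose r j := (\int[mu]_(y in `]x j, x j.+1]%classic) Lambda_star X (g y))%E.
pose C j := (r j + theta_plus X * (u (x j.+1) - u (x j))%:E)%E.
have r0 j : (0 <= r j)%E by apply: integral_ge0 => y _; exact: Lambda_star_ge0.
have C0 j : (0 <= C j)%E.
  apply: adde_ge0 => //; apply: mule_ge0; first exact: theta_plus_ge0.
  by rewrite lee_fin subr_ge0 ndu.
have sumr n : (\sum_(j < n) r j = \int[mu]_(y in `]0%R, x n]%classic) Lambda_star X (g y))%E.
  elim: n => [|n ih]; first by rewrite big_ord0 /x mul0r set_itvoc0 integral_set0.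
  rewrite big_ord_recr /= ih (itv_oc_split (x0 n) (xx n)) ge0_integral_setU//.
  - by apply: measurable_funTS; exact: mLg.
  - by move=> y _; exact: Lambda_star_ge0.
  - apply/disj_setPS => s [/=]; rewrite !in_itv/= => /andP[_ h1] /andP[h2 _].
    by have := lt_le_trans h2 h1; rewrite ltxx.
have sumC : (\sum_(j < J) C j <= c%:E)%E.
  rewrite big_split /= sumr xJ; apply: le_trans gc; apply: leeD2l.
  rewrite -ge0_sume_distrr; last by move=> j _; rewrite lee_fin subr_ge0 ndu.
  rewrite sumEFin; have -> : \sum_(i < J) (u (x i.+1) - u (x i)) = u t.
    rewrite -(big_mkord xpredT (fun i => u (x i.+1) - u (x i))) telescope_sumr// xJ /x mul0r.
    by have [-> _] := uv0 0 (lexx _); rewrite subr0.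
  exact: lexx.
have Cfin j : (j < J)%N -> C j \is a fin_num.
  move=> jJ; rewrite ge0_fin_numE//; apply: le_lt_trans (ltry c); apply: le_trans sumC.
  by rewrite (bigD1 (Ordinal jJ))//= leeDl// sume_ge0.
exists (fun j => fine (C j) / D); split.
- by move=> j _; rewrite divr_ge0 ?fine_ge0// ltW.
- rewrite -lee_fin; apply: le_trans sumC; rewrite -sumEFin le_eqVlt; apply/orP; left; apply/eqP.
  by apply: eq_bigr => j _; rewrite mulrC divfK ?gt_eqF// fineK// Cfin.
move=> j jJ s s0; have := M_gt0 s; case ME : (M s) => [m| |]// m0; last first.
  by rewrite gt0_muley ?leey// lte_fin expR_gt0.
rewrite lte_fin in m0; rewrite -EFinM lee_fin -[m]lnK ?posrE// -expRD ler_expR.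
have rfin : r j \is a fin_num.
  rewrite ge0_fin_numE//; apply: le_lt_trans (ltry (fine (C j))); rewrite fineK ?Cfin// leeDl//.
  apply: mule_ge0; first exact: theta_plus_ge0.
  by rewrite lee_fin subr_ge0 ndu.
have key : ((s * (a (x j.+1) - a (x j)))%:E <= r j + (ln m * D)%:E)%E.
  have mI : measurable (`]x j, x j.+1]%classic : set R) by exact: measurable_itv.
  have ig' : mu.-integrable `]x j, x j.+1]%classic (EFin \o g) by exact: integrableS ig.
  have ir : mu.-integrable `]x j, x j.+1]%classic (Lambda_star X \o g).
    apply/integrableP; split; first exact: measurable_funTS.
    have -> : (\int[mu]_(y in `]x j, x j.+1]%classic) `|(Lambda_star X \o g) y| = r j)%E.
      by apply: eq_integral => y _; rewrite gee0_abs// Lambda_star_ge0.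
    by rewrite -ge0_fin_numE.
  have ic : mu.-integrable `]x j, x j.+1]%classic (EFin \o cst (ln m)).
    apply/integrableP; split; first by apply/measurable_EFinP; exact: measurable_cst.
    have -> : (\int[mu]_(y in `]x j, x j.+1]%classic) `|(EFin \o cst (ln m)) y| =
        \int[mu]_(y in `]x j, x j.+1]%classic) `|ln m|%:E)%E by [].
    by rewrite integral_cst_itv// ltry.
  have -> : (ln m * D)%:E = (\int[mu]_(y in `]x j, x j.+1]%classic) (ln m)%:E)%E.
    by rewrite integral_cst_itv// xD addrAC subrr add0r.
  rewrite EFinM -gE ?x0 ?xt//.
  rewrite -integralZl//.
  rewrite -integralD//.
  apply: le_integral.
  - exact: mI.
  - exact: integrableZl.
  - exact: integrableD.
  - move=> y _; rewrite -leeBlDr// -EFinM -EFinB; exact: Lambda_star_ge.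
have hu : ((s * (u (x j.+1) - u (x j)))%:E <= theta_plus X * (u (x j.+1) - u (x j))%:E)%E.
  rewrite EFinM; apply: lee_wpmul2r; first by rewrite lee_fin subr_ge0 ndu.
  exact: le_theta_plus ME.
have h : s * (a (x j.+1) - a (x j)) + s * (u (x j.+1) - u (x j)) <= fine (C j) + ln m * D.
  rewrite -lee_fin !EFinD fineK ?Cfin//.
  by apply: le_trans (leeD key hu) _; rewrite /C addeAC.
have dv : 0 <= s * (v (x j.+1) - v (x j)) by rewrite mulr_ge0// subr_ge0 ndv.
have dxi : xi (x j.+1) - xi (x j) =
    (a (x j.+1) - a (x j)) + (u (x j.+1) - u (x j)) - (v (x j.+1) - v (x j)).
  by rewrite !xiE//; ring.
rewrite -/(x j) -/(x j.+1) mulrA ler_pdivrMr// mulrDl divfK ?gt_eqF// dxi.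
lra.
Qed.

End path_cost.
End rate_function.


(** * Polygonal paths *)

Section zero_cumulative.
Context {R : realType}.
Local Notation mu := (@lebesgue_measure R).

Lemma zero_nd : nondecreasing (cst 0 : R -> R). Proof. by []. Qed.
Lemma zero_rc : right_continuous (cst 0 : R -> R). Proof. by move=> x; exact: cvg_cst. Qed.

(** The singular parts of a Lipschitz path vanish. *)
Definition zero_cumulative : cumulative R R :=
  HB.pack (cst 0 : R -> R) (isCumulative.Build R _ R (cst 0) zero_nd zero_rc).

Lemma zero_stieltjes : lebesgue_stieltjes_measure zero_cumulative setT = 0%E.
Proof.
pose nu := lebesgue_stieltjes_measure zero_cumulative.
have nuE a b : a <= b -> nu `]a, b]%classic = 0%E.
  move=> ab; apply: etrans (measurable_mu_extE (wlength zero_cumulative) (is_ocitv a b)) _.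
  apply: etrans (wlength_itv_bnd _ _ _ ab) _; by rewrite /= subrr.
pose F n : set (measurableTypeR R) := `](- n%:R), n%:R]%classic.
have mF n : measurable (F n) by exact: measurable_itv.
have FT : setT `<=` \bigcup_n F n.
  move=> x _; exists (Num.bound `|x|).+1 => //.
  have h := archi_boundP (normr_ge0 x); rewrite /F /= in_itv/= -natr1.
  by apply/andP; split; have := ler_norm x; have := ler_norm (- x); rewrite normrN; lra.
have := measure_sigma_subadditive nu mF measurableT FT.
rewrite eseries0; last by move=> n _ _; apply: nuE; rewrite ge0_cp.
by move=> h; apply/eqP; rewrite eq_le h measure_ge0.
Qed.

Lemma zero_singular (m : set (measurableTypeR R) -> \bar R) : m set0 = 0%E ->
  mutually_singular (lebesgue_stieltjes_measure zero_cumulative) m.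
Proof. by move=> m0; exists setT; rewrite ?setCT ?zero_stieltjes. Qed.

End zero_cumulative.

Section lipschitz.
Context {R : realType}.
Variables (L : R) (f : R -> R).
Hypothesis L0 : 0 <= L.
Hypothesis lip : forall s t, s <= t -> `|f t - f s| <= L * (t - s).

Lemma lipschitz_continuous x : f y @[y --> x] --> f x.
Proof.
apply/cvgrPdist_lt => e e0; have L1 : 0 < L + 1 by rewrite ltr_wpDl.
near=> y; have h : `|x - y| < e / (L + 1).
  near: y; apply: (@cvgr_dist_lt _ _ _ (nbhs x) _ idfun x _ (e / (L + 1))) => //.
  by rewrite divr_gt0.
rewrite ltr_pdivlMr// in h.
have key : `|f x - f y| <= L * `|x - y|.
  have [xy|/ltW xy] := leP x y; last by rewrite (ger0_norm (_ : 0 <= x - y)) ?lip ?subr_ge0.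
  by rewrite distrC (distrC x y) (ger0_norm (_ : 0 <= y - x)) ?lip ?subr_ge0.
apply: le_lt_trans h; apply: (le_trans key); rewrite mulrC ler_wpM2l//.
by rewrite lerDl.
Unshelve. all: by end_near. Qed.

Lemma lipschitz_cadlag : cadlag f.
Proof.
split=> t t0; first by apply: cvg_within_filter; exact: lipschitz_continuous.
by apply: cvgP; apply: cvg_within_filter; exact: lipschitz_continuous.
Qed.

Lemma lipschitz_ac t : abs_continuous_on t f.
Proof.
move=> e e0; have L1 : 0 < L + 1 by rewrite ltr_wpDl.
exists (e / (L + 1)); first by rewrite divr_gt0.
move=> n l r lr _; rewrite ltr_pdivlMr// => h.
apply: (@le_lt_trans _ _ (\sum_(i < n) L * (r i - l i))).
  by apply: ler_sum => i _; apply: lip; have [_ []] := lr i.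
rewrite -mulr_sumr.
have : 0 <= \sum_(i < n) (r i - l i) by apply: sumr_ge0 => i _; have [_ [+ _]] := lr i; rewrite subr_ge0.
by nra.
Qed.

Lemma lipschitz_BV : BV_path f.
Proof.
split; first exact: lipschitz_cadlag.
by move=> t t0; apply: ac_bounded_variation => //; exact: lipschitz_ac.
Qed.

Lemma lipschitz_decomposition : BV_decomposition f f zero_cumulative zero_cumulative.
Proof.
split=> //; first by move=> t _; rewrite /= addr0 subr0.
- by move=> t _; exact: lipschitz_ac.
- by split; apply: zero_singular; rewrite measure0.
- by apply: zero_singular; rewrite measure0.
Qed.

End lipschitz.

Section polygon.
Context {R : realType}.
Variables (m : R) (r : nat) (D : nat -> R) (nu : R).
Hypotheses (m0 : 0 < m) (nu0 : nu < 0).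
Let e j := \sum_(i < j) D i.

(** The vertices are (j m, e j) for j <= r, and after the last vertex the path is a half-line of
    slope nu. As a sum of clamped ramps the path is Lipschitz term by term. *)
Definition polygon (t : R) : R :=
  \sum_(i < r) D i / m * clamp m (t - i%:R * m) + nu * Num.max (t - r%:R * m) 0.

Lemma polygon_lip s t : s <= t ->
  `|polygon t - polygon s| <= (\sum_(i < r) `|D i / m| + `|nu|) * (t - s).
Proof.
move=> st; have -> : polygon t - polygon s =
   \sum_(i < r) D i / m * (clamp m (t - i%:R * m) - clamp m (s - i%:R * m)) +
   nu * (Num.max (t - r%:R * m) 0 - Num.max (s - r%:R * m) 0).
  rewrite /polygon; under [in RHS]eq_bigr do rewrite mulrBr.
  by rewrite sumrB; ring.
rewrite mulrDl mulr_suml; apply: (le_trans (ler_normD _ _)); apply: lerD.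
  apply: (le_trans (ler_norm_sum _ _ _)); apply: ler_sum => i _; rewrite normrM.
  apply: ler_wpM2l => //; rewrite ger0_norm; last by rewrite subr_ge0 clamp_le// lerD2r.
  apply: le_trans (clamp_lip _ _) _; first by rewrite lerD2r.
  lra.
rewrite normrM; apply: ler_wpM2l => //; rewrite /Num.max.
by case: (ltrP (t - _) 0) => ?; case: (ltrP (s - _) 0) => ?; rewrite ger0_norm; lra.
Qed.

Lemma polygon_block j t : (j < r)%N -> j%:R * m <= t -> t <= j.+1%:R * m ->
  polygon t = e j + D j / m * (t - j%:R * m).
Proof.
move=> jr t1 t2; have [k rE] : exists k, r = (j + k.+1)%N by exists (r - j).-1; lia.
have tr : t <= r%:R * m by apply: (le_trans t2); rewrite ler_pM2r// ler_nat.
rewrite /polygon max_r ?subr_le0// mulr0 addr0 rE big_split_ord /= big_ord_recl /= addn0.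
rewrite [X in _ + (_ + X)]big1 ?addr0; last first.
  move=> i _; rewrite /clamp max_r; last first.
    rewrite subr_le0 (le_trans t2)// ler_pM2r// ler_nat /bump /=; lia.
  by rewrite min_l ?mulr0// ltW.
have tm : t - j%:R * m <= m by move: t2; rewrite -natr1 mulrDl mul1r; lra.
congr (_ + _); last by rewrite clamp_id//; apply/andP; split; lra.
rewrite /e; apply: eq_bigr => i _.
have ij : i.+1%:R * m <= j%:R * m by rewrite ler_pM2r// ler_nat.
rewrite /clamp min_r ?divfK ?gt_eqF// le_max; apply/orP; left.
by move: ij; rewrite -natr1 mulrDl mul1r; lra.
Qed.

Lemma polygon_tail t : r%:R * m <= t -> polygon t = e r + nu * (t - r%:R * m).
Proof.
move=> rt; rewrite /polygon max_l ?subr_ge0//; congr (_ + _); rewrite /e; apply: eq_bigr => i _.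
have ij : i.+1%:R * m <= r%:R * m by rewrite ler_pM2r// ler_nat.
rewrite /clamp min_r ?divfK ?gt_eqF// le_max; apply/orP; left.
by move: ij; rewrite -natr1 mulrDl mul1r; lra.
Qed.

Lemma block_index t : 0 <= t -> t < r%:R * m -> exists2 j, (j < r)%N & j%:R * m <= t < j.+1%:R * m.
Proof.
move=> t0 tr; have tm : 0 <= t / m by rewrite divr_ge0// ltW.
have /andP[h1 h2] := truncn_itv tm; set j := Num.trunc _ in h1 h2.
exists j; last by rewrite -ler_pdivlMr// -ltr_pdivrMr// h1 h2.
by rewrite -(ltr_nat R); apply: (le_lt_trans h1); rewrite ltr_pdivrMr.
Qed.

(** On a block the path is a convex combination of its endpoints. *)
Lemma polygon_between j t : (j < r)%N -> j%:R * m <= t -> t <= j.+1%:R * m ->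
  exists w, [/\ 0 <= w <= 1, (j%:R * m < t -> 0 < w) & polygon t = (1 - w) * e j + w * e j.+1].
Proof.
move=> jr t1 t2; exists ((t - j%:R * m) / m).
have t3 : t - j%:R * m <= m by move: t2; rewrite -natr1 mulrDl mul1r; lra.
split.
- apply/andP; split; first by rewrite divr_ge0 ?(ltW m0)// subr_ge0.
  by rewrite ler_pdivrMr// mul1r.
- by move=> h; rewrite divr_gt0// subr_gt0.
rewrite (polygon_block jr t1 t2) /e big_ord_recr /=; field.
by rewrite gt_eqF.
Qed.

Hypothesis r0 : (0 < r)%N.
Hypothesis e_gt0 : forall j, (0 < j <= r)%N -> 0 < e j.
Let rm := r%:R * m.

Lemma e_ge0 j : (j <= r)%N -> 0 <= e j.
Proof.
by case: j => [|j] jr; [rewrite /e big_ord0|apply/ltW/e_gt0].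
Qed.

Lemma rm_gt0 : 0 < rm. Proof. by rewrite mulr_gt0// ltr0n. Qed.

Lemma polygon_min j t : (j < r)%N -> j%:R * m <= t -> t <= j.+1%:R * m ->
  Num.min (e j) (e j.+1) <= polygon t.
Proof.
move=> jr t1 t2; have [w [/andP[w0 w1] _ ->]] := polygon_between jr t1 t2.
have h1 : Num.min (e j) (e j.+1) <= e j by rewrite ge_min lexx.
have h2 : Num.min (e j) (e j.+1) <= e j.+1 by rewrite ge_min lexx orbT.
move: h1 h2; generalize (Num.min (e j) (e j.+1)) => z h1 h2.
have := ler_wpM2l w0 h2; have w1' : 0 <= 1 - w by lra.
by have := ler_wpM2l w1' h1; lra.
Qed.

Lemma polygon_gt0 t : 0 < t -> t <= rm -> 0 < polygon t.
Proof.
move=> t0; rewrite le_eqVlt => /orP[/eqP ->|tr].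
  by rewrite polygon_tail// subrr mulr0 addr0 e_gt0// r0 leqnn.
have [j jr /andP[t1 t2]] := block_index (ltW t0) tr.
have [w [/andP[w0 w1] wp ->]] := polygon_between jr t1 (ltW t2).
have ej : 0 < e j.+1 by exact: e_gt0.
move: t1; rewrite le_eqVlt => /orP[/eqP t1|/wp wgt0].
  have j0 : (0 < j)%N by rewrite lt0n; apply/eqP => j0; move: t0; rewrite -t1 j0 mul0r ltxx.
  have ejp : 0 < e j by rewrite e_gt0// j0 ltnW.
  have [w00|w00] := eqVneq w 0; first by rewrite w00 subr0 mul1r mul0r addr0.
  have wgt0 : 0 < w by rewrite lt_def w00.
  have h1 := mulr_gt0 wgt0 ej; apply: ltr_wpDl => //; apply: mulr_ge0; last exact: ltW.
  by rewrite subr_ge0.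
have h1 := mulr_gt0 wgt0 ej; apply: ltr_wpDl => //; apply: mulr_ge0; first by rewrite subr_ge0.
by apply: e_ge0; exact: ltnW.
Qed.

Let tau := rm + e r / - nu.

Lemma polygon_ge0 t : 0 <= t -> t <= tau -> 0 <= polygon t.
Proof.
move=> t0 tt; have [tr|tr] := leP t rm.
  move: t0; rewrite le_eqVlt => /orP[/eqP <-|t0]; last by apply/ltW/polygon_gt0.
  have := @polygon_block 0%N 0 r0; rewrite mul0r => ->//; last by rewrite mul1r ltW.
  by rewrite /e big_ord0 subrr mulr0 addr0.
rewrite polygon_tail; last exact: ltW.
have : t - rm <= e r / - nu by rewrite /tau in tt; lra.
rewrite ler_pdivlMr ?oppr_gt0//; rewrite /rm; lra.
Qed.

Lemma polygon_reflection t : 0 <= t -> t <= tau -> reflection polygon t = polygon t.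
Proof.
move=> t0 tt; rewrite /reflection.
have -> : [set Num.min (polygon s) 0 | s in `[0, t]] = [set 0].
  apply/seteqP; split => [_ [s /= + <-]|_ ->].
    by rewrite in_itv/= => /andP[s0 st]; rewrite min_r// polygon_ge0// (le_trans st).
  exists 0; rewrite /= ?in_itv/= ?lexx ?t0// min_r// polygon_ge0//.
  exact: le_trans tt.
by rewrite inf1 subr0.
Qed.

Lemma tau_ge : rm <= tau.
Proof. by rewrite lerDl divr_ge0 ?oppr_ge0 ?(ltW nu0)// e_ge0. Qed.

(** The path is positive up to its last vertex, and the half-line reaches 0 at time tau. *)
Lemma polygon_hitting : exists2 T, rm <= T <= tau & hitting_time polygon = T%:E.
Proof.
have h1 : (hitting_time polygon <= tau%:E)%E.
  apply: ereal_inf_lbound; exists tau => //; split; first exact: lt_le_trans rm_gt0 tau_ge.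
  rewrite polygon_reflection ?(le_trans (ltW rm_gt0) tau_ge)// polygon_tail ?tau_ge//.
  have -> : tau - r%:R * m = e r / - nu by rewrite /tau -/rm addrAC subrr add0r.
  by rewrite invrN !mulrN mulrCA divff ?lt_eqF// mulr1 subrr.
have h2 : (rm%:E <= hitting_time polygon)%E.
  apply: le_ereal_inf_tmp => _ [t [t0 tz] <-]; rewrite lee_fin leNgt; apply/negP => tr.
  move: tz; rewrite polygon_reflection ?(ltW t0)//; last by rewrite (le_trans (ltW tr))// tau_ge.
  by move=> pz; have := polygon_gt0 t0 (ltW tr); rewrite pz ltxx.
case: (hitting_time polygon) h1 h2 => // T; rewrite !lee_fin => h1 h2.
by exists T => //; rewrite h1 h2.
Qed.

Lemma affine_derive1 (f : R -> R) (A B x0 l h t : R) : l < t < h ->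
  (forall s, l < s < h -> f s = A + B * (s - x0)) -> f^`()%classic t = B.
Proof.
move=> /andP[lt th] H; rewrite derive1E.
rewrite (@near_eq_derive _ _ _ _ (fun s => A + B * (s - x0))).
  have h1 : is_derive t 1 (fun s : R => A + B * (s - x0)) B.
    have h2 : is_derive t 1 (fun s : R => s - x0) 1.
      by apply: is_derive_eq; rewrite subr0.
    apply: is_derive_eq; rewrite add0r mul1r; exact: mulr1.
  exact: derive_val.
near=> s; apply: H; apply/andP; split; near: s.
  exact: lt_nbhsr.
exact: lt_nbhsl.
Unshelve. all: by end_near. Qed.

Lemma polygon_derive1 j t : (j < r)%N -> j%:R * m < t < j.+1%:R * m ->
  polygon^`()%classic t = D j / m.
Proof.
move=> jr tj; apply: (@affine_derive1 _ (e j) _ (j%:R * m) _ _ _ tj) => s /andP[s1 s2].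
by apply: polygon_block => //; exact: ltW.
Qed.

Lemma polygon_derive1_tail t : rm < t -> polygon^`()%classic t = nu.
Proof.
move=> tr; have tt : rm < t < t + 1 by rewrite tr ltrDl ltr01.
apply: (@affine_derive1 _ (e r) _ rm _ _ _ tt) => s /andP[s1 _].
by apply: polygon_tail; exact: ltW.
Qed.

End polygon.


(** * The cost of a polygonal path *)

Section polygon_rate.
Context d (Omega : measurableType d) (R : realType) (P : probability Omega R).
Variable X : {RV P >-> R}.
Local Notation mu := (@lebesgue_measure R).
Hypothesis M0 : 'M_P X 0 = 1%E.
Hypothesis M_gt0 : forall t, (0 < 'M_P X t)%E.
Variables (nu : R).
Hypotheses (nu0 : nu < 0) (nu_free : (Lambda_star X nu <= 0)%E).

Lemma integral_cst_restrict (A : set R) (c : \bar R) : measurable A ->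
  (\int[mu]_x ((cst c) \_ A) x = c * mu A)%E.
Proof. by move=> mA; rewrite -integral_mkcond; exact: integral_cst. Qed.

(** The polygonal path through the partial sums is admissible, since on each block it stays
    above the smaller endpoint. Its derivative is constant on the blocks and equal to nu after
    the last one, where the rate vanishes. The vertices, where the derivative may not exist,
    form a null set and get the value +oo. *)
Lemma B_star_le_blocks (p m : R) (r : nat) (D : nat -> R) : 0 < p -> 0 < m ->
  (forall j, (0 < j <= r)%N -> 0 < \sum_(i < j) D i) ->
  1 <= \sum_(j < r) m * Num.min (\sum_(i < j) D i) (\sum_(i < j.+1) D i) `^ p ->
  (B_star X p 0 <= \sum_(j < r) m%:E * Lambda_star X (D j / m))%E.
Proof.
move=> p0 m0 e_gt0 area.
have r0 : (0 < r)%N by rewrite lt0n; apply/eqP => r0; move: area; rewrite r0 big_ord0; lra.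
pose f := polygon m r D nu; pose L := \sum_(i < r) `|D i / m| + `|nu|.
have L0 : 0 <= L by rewrite addr_ge0// sumr_ge0.
have lip s t : s <= t -> `|f t - f s| <= L * (t - s) by exact: polygon_lip.
have [T /andP[T1 T2] TE] := polygon_hitting m0 nu0 r0 e_gt0.
set tau := _ + _ in T2.
have f0 : f 0 = 0.
  have := @polygon_block _ m r D nu m0 nu0 0%N 0 r0; rewrite mul0r /f => -> //; last by rewrite mul1r ltW.
  by rewrite big_ord0 subrr mulr0 addr0.
have bv := lipschitz_BV L0 lip.
pose x j : R := j%:R * m; have xD j : x j.+1 = x j + m by rewrite /x -natr1 mulrDl mul1r.
have x0 j : 0 <= x j by rewrite mulr_ge0// ltW.
have xx j : x j <= x j.+1 by rewrite xD lerDl ltW.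
have xr j : (j <= r)%N -> x j <= r%:R * m by move=> jr; rewrite /x ler_pM2r// ler_nat.
have Bset : B_set p 0 f.
  split => //; rewrite TE.
  pose I : set R := `]0, r%:R * m]%classic.
  have IT : I `<=` upto T%:E.
    move=> s; rewrite /I /= in_itv/= => /andP[s0 sr]; split; first exact: ltW.
    by rewrite lee_fin (le_trans sr).
  apply: (@le_trans _ _ (\int[mu]_(s in I) (f s `^ p)%:E)%E); last first.
    rewrite -(setIidr IT) integral_mkcondr; apply: ge0_le_integral_any.
      by move=> s _; apply: erestrict_ge0 => y _; rewrite lee_fin powR_ge0.
    move=> s [s0]; rewrite lee_fin => sT; rewrite patchE; case: ifPn => _; last by rewrite lee_fin powR_ge0.
    by rewrite [reflection f s](polygon_reflection m0 nu0 r0 e_gt0)// (le_trans sT).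
  have mf : measurable_fun setT (fun s => (f s `^ p)%:E).
    apply/measurable_EFinP; apply: (measurableT_comp (measurable_powR p)).
    by apply: continuous_measurable_fun => s; exact: (lipschitz_continuous L0 lip).
  have sum n : (n <= r)%N -> ((\sum_(j < n) m * Num.min (\sum_(i < j) D i) (\sum_(i < j.+1) D i) `^ p)%:E
     <= \int[mu]_(s in `]0%R, x n]%classic) (f s `^ p)%:E)%E.
    elim: n => [|n ih] nr; first by rewrite big_ord0 /x mul0r set_itvoc0 integral_set0.
    rewrite big_ord_recr /= EFinD (itv_oc_split (x0 n) (xx n)) ge0_integral_setU//.
    - apply: leeD; first by apply: ih; exact: ltnW.
      set mm := Num.min _ _.
      have -> : (m * mm `^ p)%:E = (\int[mu]_(s in `]x n, x n.+1]%classic) (mm `^ p)%:E)%E.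
        by rewrite integral_cst_itv// xD addrAC subrr add0r mulrC.
      apply: ge0_le_integral => //.
      - by move=> s _; rewrite lee_fin powR_ge0.
      - exact: measurable_funTS.
      - move=> s /=; rewrite in_itv/= => /andP[s1 s2]; rewrite lee_fin.
        have sm : mm <= f s by apply: polygon_min => //; exact: ltW.
        have mm0 : 0 <= mm by rewrite le_min !(e_ge0 e_gt0)//; exact: ltnW.
        by apply: ge0_ler_powR; rewrite ?nnegrE ?(ltW p0)// (le_trans mm0).
    - exact: measurable_funTS.
    - by move=> s _; rewrite lee_fin powR_ge0.
    - apply/disj_setPS => s [/=]; rewrite !in_itv/= => /andP[_ h1] /andP[h2 _].
      by have := lt_le_trans h2 h1; rewrite ltxx.
  by apply: le_trans (sum r (leqnn _)); rewrite lee_fin.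
apply: (@le_trans _ _ (path_rate X 0 f)).
  by apply: ereal_inf_lbound; exists f.
apply: (@le_trans _ _ (decomposition_cost X T%:E f (zero_cumulative : cumulative R R) (zero_cumulative : cumulative R R))).
  apply: ereal_inf_lbound; split => //.
  exists f, zero_cumulative, zero_cumulative; split; first exact: (lipschitz_decomposition L0 lip).
  by rewrite TE.
rewrite /decomposition_cost /= oppr0 !mule0 !adde0.
(* the null set of times at which the derivative may not exist *)
pose N : set R := range x.
have cN : countable N by apply: card_le_trans (card_image_le _ _) _; exact: countableP.
have mN : measurable N by apply: countable_measurable => // s; exact: measurable_set1.
have N0 : mu N = 0%E by exact: countable_lebesgue_measure0.
pose k (s : R) : \bar R := (\sum_(j < r) ((cst (Lambda_star X (D j / m))) \_ `]x j, x j.+1]%classic) s +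
   ((cst +oo) \_ N) s)%E.
have L_ge0 y : (0 <= Lambda_star X y)%E by exact: Lambda_star_ge0.
have k1 j s : (0 <= ((cst (Lambda_star X (D j / m))) \_ `]x j, x j.+1]%classic) s)%E.
  by apply: erestrict_ge0 => y _ /=.
have k2 s : (0 <= \sum_(j < r) ((cst (Lambda_star X (D j / m))) \_ `]x j, x j.+1]%classic) s)%E.
  by apply: sume_ge0 => j _.
have k3 s : (0 <= ((cst +oo) \_ N) s :> \bar R)%E by apply: erestrict_ge0 => y _ /=; rewrite leey.
have mcst (A : set R) (c : \bar R) : measurable A -> measurable_fun setT ((cst c) \_ A).
  by move=> mA; apply/(measurable_restrictT _ _).1 => //; exact: measurable_cst.
apply: (@le_trans _ _ (\int[mu]_s k s)%E).
  rewrite integral_mkcond; apply: ge0_le_integral_any => s _.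
    by apply: erestrict_ge0 => y _; exact: L_ge0.
  rewrite patchE; case: ifPn => [|_]; last by rewrite adde_ge0.
  rewrite inE => -[s0 _]; have [sN|sN] := pselect (N s).
    rewrite /k [X in (_ + X)%E]patchE ifT ?inE//= addey ?leey//.
    by rewrite -ltNye; apply: lt_le_trans (k2 s); rewrite ltNy0.
  have [sr|sr] := leP (r%:R * m) s.
    have sr' : r%:R * m < s.
      by rewrite lt_neqAle sr andbT; apply/eqP => rs; apply: sN; exists r.
    rewrite (polygon_derive1_tail D nu m0 sr').
    by apply: (le_trans nu_free); rewrite adde_ge0.
  have [j jr /andP[j1 j2]] := block_index m0 s0 sr.
  have j1' : x j < s by rewrite lt_neqAle j1 andbT; apply/eqP => rs; apply: sN; exists j.
  rewrite (polygon_derive1 D m0 nu0 jr); last by rewrite j2 andbT.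
  rewrite /k -[leLHS]adde0; apply: leeD => //.
  rewrite (bigD1 (Ordinal jr))//= patchE ifT; last by rewrite inE/= in_itv/= j1' ltW.
  by rewrite leeDl// sume_ge0.
rewrite ge0_integralD//; last 2 first.
- by apply: emeasurable_sum => j; apply: mcst; exact: measurable_itv.
- exact: mcst.
rewrite integral_cst_restrict// N0 mule0 adde0 ge0_integral_sum//; last first.
  by move=> j; apply: mcst; exact: measurable_itv.
apply: lee_sum => j _; rewrite integral_cst_restrict; last exact: measurable_itv.
by rewrite mu_itvoc// xD addrAC subrr add0r muleC.
Qed.

End polygon_rate.


(** * Moments of the increments *)

Section law_of_coordinate.
Context d (Omega : measurableType d) (R : realType) (P : probability Omega R).
Variable U : nat -> {RV P >-> R}.
Hypothesis U_iid : iid U.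
Variable Q : probability (@seqR R) R.
Hypothesis QP : forall a B, measurable B -> P (blk U a @^-1` B) = Q B.

(** The sequence law is built from the increments of index at least 1, which have the law of the
    increment of index 0. *)
Lemma coordinate_prob (A : set R) : measurable A ->
  Q [set x : seqR | A (x 0%N)] = P (U 0%N @^-1` A).
Proof.
move=> mA; have mB : measurable [set x : @seqR R | A (x 0%N)].
  by rewrite -[X in measurable X]setTI; exact: (@measurable_coord R 0%N measurableT A mA).
rewrite -(QP 0 mB); have [_ idd] := U_iid; exact: (idd 1%N 0%N A mA).
Qed.

Lemma coordinate_integral (h : R -> R) : measurable_fun setT h -> (forall y, 0 <= h y) ->
  (\int[Q]_x (h (x 0%N))%:E = \int[P]_w (h (U 0%N w))%:E)%E.
Proof.
move=> mh h0.
pose c0 : {RV Q >-> R} := HB.pack (fun x : @seqR R => x 0%N)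
  (isMeasurableFun.Build _ _ _ _ (fun x : @seqR R => x 0%N) (@measurable_coord R 0%N)).
have mf : measurable_fun setT (EFin \o h) by exact/measurable_EFinP.
have f0 y : (0 <= (EFin \o h) y)%E by rewrite lee_fin.
rewrite -[LHS](ge0_integral_distribution c0 mf f0) -[RHS](ge0_integral_distribution (U 0%N) mf f0).
by apply: eq_measure_integral => A mA _; exact: coordinate_prob.
Qed.

Lemma mgfE t : 'M_P (U 0%N) t = (\int[P]_w (expR (t * U 0%N w))%:E)%E.
Proof. by rewrite /mmt_gen_fun unlock; apply: eq_integral => w _ /=; rewrite mulrC. Qed.

Lemma mgf_coordinate t : mgf Q t = 'M_P (U 0%N) t.
Proof.
rewrite mgfE /mgf; apply: (@coordinate_integral (fun y => expR (t * y))).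
  by apply: measurableT_comp => //; exact: measurable_funM.
by move=> y; exact: expR_ge0.
Qed.

Lemma cramer_rateE y : cramer_rate Q y = Lambda_star (U 0%N) y.
Proof.
rewrite /cramer_rate /Lambda_star.
have -> : (fun t : R => ((t * y)%:E - lne (mgf Q t))%E) =
    (fun t : R => ((t * y)%:E - lne ('M_P (U 0%N) t))%E) by apply/funext => t; rewrite mgf_coordinate.
by [].
Qed.

End law_of_coordinate.

Section exponential_moments.
Context {R : realType}.

(** From u <= expR u - 1 <= u expR u, applied twice. *)
Lemma expR_abs_taylor (u : R) : expR u <= 1 + u + u ^+ 2 * expR `|u|.
Proof.
have h0 (y : R) : expR y - 1 <= y * expR y.
  have := expR_ge1Dx (- y); rewrite expRN -(ler_pM2r (expR_gt0 y)) mulVf ?gt_eqF ?expR_gt0//.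
  by lra.
have h1 : `|expR u - 1| <= `|u| * expR `|u|.
  have [u0|u0] := leP 0 u.
    by rewrite (ger0_norm u0) ger0_norm ?h0// subr_ge0 -[leLHS]expR0 ler_expR.
  rewrite (ltr0_norm u0) ler0_norm; last by rewrite subr_le0 -[leRHS]expR0 ler_expR ltW.
  have := expR_ge1Dx u => h2; apply: (@le_trans _ _ (- u)); first lra.
  by rewrite ler_peMr ?oppr_ge0 ?(ltW u0)// -[leLHS]expR0 ler_expR oppr_ge0 ltW.
have h2 : u * (expR u - 1) <= u ^+ 2 * expR `|u|.
  apply: le_trans (ler_norm _) _; rewrite normrM.
  have -> : u ^+ 2 = `|u| * `|u| by rewrite -expr2 real_normK// num_real.
  by rewrite -mulrA; apply: ler_wpM2l.
by have := h0 u; lra.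
Qed.

Lemma sqr_le_expR (y : R) : 0 <= y -> y ^+ 2 <= 4 * expR y.
Proof.
move=> y0; have h := expR_ge1Dx (y / 2).
have -> : expR y = expR (y / 2) ^+ 2 by rewrite expr2 -expRD -splitr.
rewrite !expr2; have h1 : y / 2 <= expR (y / 2) by lra.
have y2 : 0 <= y / 2 by rewrite divr_ge0.
have := ler_pM y2 y2 h1 h1; lra.
Qed.

End exponential_moments.

Section moments.
Context d (Omega : measurableType d) (R : realType) (P : probability Omega R).
Variable X : {RV P >-> R}.
Local Notation M t := (\int[P]_w (expR (t * X w))%:E)%E.
Hypothesis ME : forall t, 'M_P X t = M t.
Hypothesis tm : (theta_minus X < 0)%E.
Hypothesis tp : (0 < theta_plus X)%E.

Let mX : measurable_fun setT X. Proof. exact: measurable_funP. Qed.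
Let mexp t : measurable_fun setT (fun w => (expR (t * X w))%:E).
Proof. by apply/measurable_EFinP; apply: measurableT_comp => //; exact: measurable_funM. Qed.
Let mabs c : measurable_fun setT (fun w => (expR (c * `|X w|))%:E).
Proof.
by apply/measurable_EFinP; apply: measurableT_comp => //; apply: measurable_funM => //; exact: measurableT_comp.
Qed.

(** Exponents of both signs with finite moments exist by the assumptions on theta_+ and theta_-. *)
Lemma exponential_abs_moment : exists c A : R, 0 < c /\ (\int[P]_w (expR (c * `|X w|))%:E = A%:E)%E.
Proof.
have [_ [t1 /= M1 <-] t1p] := ereal_sup_gt tp; rewrite lte_fin in t1p.
have [_ [t2 /= M2 <-] t2n] := ereal_inf_lt tm; rewrite lte_fin in t2n.
rewrite ME in M1; rewrite ME in M2.
(* exp(c |X|) is at most exp(t1 X) + exp(t2 X) *)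
pose c := Num.min t1 (- t2); have c0 : 0 < c by rewrite lt_min t1p oppr_gt0.
have fin : (\int[P]_w (expR (c * `|X w|))%:E < +oo)%E.
  apply: (@le_lt_trans _ _ (M t1 + M t2)%E); last exact: lte_add_pinfty.
  rewrite -ge0_integralD//.
  apply: ge0_le_integral => //.
  - by apply: emeasurable_funD; exact: mexp.
  - move=> w _; rewrite -EFinD lee_fin.
    have [X0|X0] := leP 0 (X w).
      rewrite ger0_norm// -[leLHS]addr0; apply: lerD; last exact: expR_ge0.
      by rewrite ler_expR ler_wpM2r// /c ge_min lexx.
    rewrite ltr0_norm// -[leLHS]add0r; apply: lerD; first exact: expR_ge0.
    rewrite ler_expR mulrN -mulNr; apply: ler_wnM2r; first exact: ltW.
    by rewrite lerNr /c ge_min lexx orbT.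
exists c, (fine (\int[P]_w (expR (c * `|X w|))%:E)%E); split => //; rewrite fineK//.
by rewrite ge0_fin_numE// integral_ge0// => w _; rewrite lee_fin expR_ge0.
Qed.

Lemma integrable_RV : P.-integrable setT (EFin \o X).
Proof.
have [c [A [c0 HA]]] := exponential_abs_moment.
apply: (@le_integrable _ _ _ P _ _ _ (fun w => (c^-1)%:E * (expR (c * `|X w|))%:E)%E) => //.
- exact/measurable_EFinP.
- move=> w _; rewrite /= lee_fin.
  rewrite [leRHS]ger0_norm ?mulr_ge0 ?expR_ge0 ?invr_ge0 ?(ltW c0)//.
  rewrite mulrC ler_pdivlMr// mulrC; apply: le_trans (expR_ge1Dx _); lra.
- apply: integrableZl => //; apply/integrableP; split; first exact: mabs.
  rewrite (_ : (\int[P]_w `|(expR (c * `|X w|))%:E| = A%:E)%E) ?ltry//.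
  by rewrite -HA; apply: eq_integral => w _; rewrite gee0_abs// lee_fin expR_ge0.
Qed.

Lemma integral_cstP (r : R) : (\int[P]_w r%:E = r%:E)%E.
Proof.
apply: etrans (integral_cst P measurableT _) _.
by rewrite [X in (_ * X)%E](_ : _ = 1%E) ?mule1//; exact: (@probability_setT _ _ _ P).
Qed.

Lemma expectation_real : ('E_P[X])%E \is a fin_num.
Proof. by rewrite unlock; exact: integrable_fin_num integrable_RV. Qed.

Let mu := fine ('E_P[X])%E.

Lemma expectationE : ('E_P[X])%E = mu%:E.
Proof. by rewrite fineK ?expectation_real. Qed.

Lemma integrable_affine (a b : R) : P.-integrable setT (fun w => (a + b * X w)%:E).
Proof.
have ic : P.-integrable setT (EFin \o cst a) by exact: finite_measure_integrable_cst.
exact: (integrableD measurableT ic (integrableZl measurableT b integrable_RV)).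
Qed.

Lemma integral_affine (a b : R) : (\int[P]_w (a + b * X w)%:E = (a + b * mu)%:E)%E.
Proof.
have iX := integrable_RV.
have ic : P.-integrable setT (EFin \o cst a) by exact: finite_measure_integrable_cst.
have ib : P.-integrable setT (fun w => (b%:E * (EFin \o X) w)%E) by exact: integrableZl.
transitivity (\int[P]_w ((EFin \o cst a) w + b%:E * (EFin \o X) w))%E; first by [].
rewrite (integralD measurableT ic ib) (integralZl measurableT iX) EFinD EFinM -expectationE.
by congr (_ + _)%E; [exact: integral_cstP|rewrite unlock].
Qed.

(** A lower bound that also covers an infinite integral. *)
Lemma affine_le_integral (a b : R) (f : Omega -> R) : measurable_fun setT f ->
  (forall w, 0 <= f w) -> (forall w, a + b * X w <= f w) ->
  ((a + b * mu)%:E <= \int[P]_w (f w)%:E)%E.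
Proof.
move=> mf f0 af; have [fin|] := boolP (\int[P]_w (f w)%:E < +oo)%E; last first.
  by rewrite -leNgt leye_eq => /eqP ->; rewrite leey.
rewrite -integral_affine; apply: le_integral => //.
- exact: integrable_affine.
- apply/integrableP; split; first exact/measurable_EFinP.
  rewrite (_ : (\int[P]_w `|(f w)%:E| = \int[P]_w (f w)%:E)%E)//.
  by apply: eq_integral => w _; rewrite gee0_abs// lee_fin.
- by move=> w _; rewrite lee_fin.
Qed.

(** Jensen's inequality, from the tangent of the exponential at the mean. *)
Lemma Lambda_star_mean : (Lambda_star X mu <= 0)%E.
Proof.
apply: ge_ereal_sup => _ [t _ <-].
rewrite -[mmt_gen_fun _ _ _]/('M_P X t) ME.
have h : ((expR (t * mu))%:E <= M t)%E.
  have -> : expR (t * mu) = expR (t * mu) * (1 - t * mu) + expR (t * mu) * t * mu by ring.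
  apply: affine_le_integral.
  - by apply: measurableT_comp => //; exact: measurable_funM.
  - by move=> w; exact: expR_ge0.
  - move=> w; have -> : t * X w = t * mu + t * (X w - mu) by ring.
    rewrite expRD; have -> : expR (t * mu) * (1 - t * mu) + expR (t * mu) * t * X w =
      expR (t * mu) * (1 + t * (X w - mu)) by ring.
    by apply: ler_wpM2l; [exact: expR_ge0|exact: expR_ge1Dx].
case: (M t) h => [m| |]//; last by rewrite /= leNye.
rewrite lee_fin => h; have m0 : 0 < m by apply: lt_le_trans h; exact: expR_gt0.
by rewrite lne_EFin// -EFinB lee_fin subr_le0 -ler_expR lnK// posrE.
Qed.

(** For small theta the moment is 1 + theta mu + O(theta^2), and mu is negative. *)
Lemma moment_lt1 : mu < 0 -> exists theta rho, [/\ 0 <= theta, 0 < rho < 1 & (M theta <= rho%:E)%E].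
Proof.
move=> mu0; have [c [A [c0 HA]]] := exponential_abs_moment.
have A0 : 0 <= A by rewrite -lee_fin -HA integral_ge0// => w _; rewrite lee_fin expR_ge0.
pose K := 16 / c ^+ 2 * A.
have K0 : 0 <= K by rewrite mulr_ge0// divr_ge0// exprn_ge0// ltW.
have [th thE] : exists th, th = Num.min (c / 2) (- mu / (2 * (K + 1))) by eexists.
have K1 : 0 < 2 * (K + 1) by lra.
have th0 : 0 < th by rewrite thE lt_min !divr_gt0// oppr_gt0.
have thK : th * K <= - mu / 2.
  have h : th <= - mu / (2 * (K + 1)) by rewrite thE ge_min lexx orbT.
  rewrite ler_pdivlMr// in h.
  have h2 : th * (2 * (K + 1)) = 2 * (th * K) + 2 * th by ring.
  rewrite h2 in h; lra.
exists th, (Num.max (1 / 2) (1 + th * mu / 2)); split; first exact: ltW.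
  rewrite lt_max divr_gt0//= gt_max ltr_pdivrMr// mul1r ltr1n /=.
  by rewrite gtrDl ltr_pdivrMr// mul0r nmulr_llt0.
pose G w := (16 / c ^+ 2) * th ^+ 2 * expR (c * `|X w|).
have mG : measurable_fun setT G.
  by apply: measurable_funM => //; apply/measurable_EFinP; exact: mabs.
have HG : (\int[P]_w (G w)%:E = (th ^+ 2 * K)%:E)%E.
  have -> : th ^+ 2 * K = 16 / c ^+ 2 * th ^+ 2 * A by rewrite /K; ring.
  have q0 : 0 <= 16 / c ^+ 2 * th ^+ 2 by rewrite mulr_ge0// ?divr_ge0// ?exprn_ge0// ltW.
  by rewrite EFinM -HA -ge0_integralZl_EFin.
have iG : P.-integrable setT (EFin \o G).
  apply/integrableP; split; first exact/measurable_EFinP.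
  rewrite (_ : (\int[P]_w `|(EFin \o G) w| = (th ^+ 2 * K)%:E)%E) ?ltry//.
  rewrite -HG; apply: eq_integral => w _; rewrite gee0_abs// lee_fin mulr_ge0 ?expR_ge0//.
  by rewrite mulr_ge0// ?divr_ge0// ?exprn_ge0// ltW.
apply: (@le_trans _ _ (\int[P]_w (1 + th * X w + G w)%:E)%E).
  apply: ge0_le_integral => //.
  - apply/measurable_EFinP; apply: measurable_funD => //.
    by apply: measurable_funD => //; exact: measurable_funM.
  - move=> w _; rewrite lee_fin; apply: le_trans (expR_abs_taylor _) _; rewrite lerD2l.
    rewrite exprMn normrM (ger0_norm (ltW th0)) /G.
    have Xc : X w ^+ 2 <= 16 / c ^+ 2 * expR (c * `|X w| / 2).
      have y0 : 0 <= c * `|X w| / 2 by rewrite divr_ge0// mulr_ge0// ltW.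
      have h := sqr_le_expR y0.
      rewrite [leRHS]mulrAC ler_pdivlMr ?exprn_gt0//; move: h.
      have -> : (c * `|X w| / 2) ^+ 2 = X w ^+ 2 * c ^+ 2 / 4.
        rewrite !exprMn real_normK ?num_real// exprVn.
        by field.
      by lra.
    have thc : th * `|X w| <= c * `|X w| / 2.
      by rewrite mulrAC ler_wpM2r// thE ge_min lexx.
    have -> : expR (c * `|X w|) = expR (c * `|X w| / 2) * expR (c * `|X w| / 2).
      by rewrite -expRD -splitr.
    have h1 : expR (th * `|X w|) <= expR (c * `|X w| / 2) by rewrite ler_expR.
    have := ler_pM (sqr_ge0 (X w)) (expR_ge0 _) Xc h1 => h2.
    have := ler_wpM2l (sqr_ge0 th) h2; lra.
have -> : (\int[P]_w (1 + th * X w + G w)%:E = (1 + th * mu)%:E + (th ^+ 2 * K)%:E)%E.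
  rewrite -integral_affine -HG; exact: (integralD measurableT (integrable_affine 1 th) iG).
rewrite -EFinD lee_fin le_max; apply/orP; right.
have := ler_wpM2l (ltW th0) thK; rewrite expr2; lra.
Qed.

End moments.

(** Countable additivity. *)
Lemma positive_part_level d (Omega : measurableType d) (R : realType) (P : probability Omega R)
    (X : {RV P >-> R}) : (0 < P [set w | (0 < X w)%R])%E ->
  exists2 eta, 0 < eta & (0 < P [set w | (eta <= X w)%R])%E.
Proof.
move=> pos; apply: contrapT => N.
have mX : measurable_fun setT X by exact: measurable_funP.
have m_ge a : measurable [set w | a <= X w].
  rewrite -[X in measurable X]setTI; have := mX measurableT _ (measurable_itv `[a, +oo[).
  by congr (measurable (_ `&` _)); apply/seteqP; split => w /=; rewrite in_itv/= andbT.
have m_gt : measurable [set w | 0 < X w].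
  rewrite -[X in measurable X]setTI; have := mX measurableT _ (measurable_itv `]0, +oo[).
  by congr (measurable (_ `&` _)); apply/seteqP; split => w /=; rewrite in_itv/= andbT.
have sub : [set w | 0 < X w] `<=` \bigcup_n [set w | n.+1%:R^-1 <= X w].
  move=> w /= Xw; exists (Num.bound (X w)^-1) => //=.
  rewrite invf_ple ?posrE ?ltr0n//; apply/ltW/(lt_le_trans (archi_boundP _)); last by rewrite ler_nat.
  by rewrite invr_ge0 ltW.
have := measure_sigma_subadditive P (fun n => m_ge n.+1%:R^-1) m_gt sub.
rewrite eseries0; first by rewrite leNgt pos.
move=> n _ _; apply/eqP; rewrite eq_le measure_ge0 andbT leNgt; apply/negP => h.
by apply: N; exists n.+1%:R^-1 => //; rewrite invr_gt0 ltr0n.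
Qed.


(** * The walk follows a nearly optimal path *)

Section lower_assembly.
Context d (Omega : measurableType d) (R : realType) (P : probability Omega R).
Variable X : {RV P >-> R}.
Variable Q : probability (@seqR R) R.
Hypothesis Qiid : iid_law Q.
Hypothesis mgfQ : forall t, mgf Q t = 'M_P X t.

Lemma finite_lower_bound (n : nat) (f : nat -> R) : (forall j, (0 < j <= n)%N -> 0 < f j) ->
  exists2 e, 0 < e & forall j, (0 < j <= n)%N -> e <= f j.
Proof.
elim: n => [|n ih] f0; first by exists 1 => // -[].
have [j /andP[j0 jn]|e e0 He] := ih; first by rewrite f0// j0 ltnW.
exists (Num.min e (f n.+1)); first by rewrite lt_min e0 f0/=.
move=> j /andP[j0]; rewrite leq_eqVlt ge_min => /orP[/eqP ->|jn]; first by rewrite lexx orbT.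
by rewrite He// j0.
Qed.

(** Heights lowered by the factor q = 1 - 2 e raise the cost by the factor 1 / q^2 = 1 + O(e), so
    it suffices to take e small compared to dlt. *)
Lemma small_loss (c dlt : R) : 0 < dlt -> exists e, [/\ 0 < e, e <= 1 / 4 &
  forall q, q = 1 - 2 * e -> [/\ 0 < q, q <= 1 - e, q <= 1, (1 + e) * q ^+ 2 <= 1 - 2 * e &
    0 <= c -> (c + e) / q ^+ 2 <= c + dlt]].
Proof.
move=> dlt0; have q0 : 0 < 1 + 4 * (`|c| + dlt) by have := normr_ge0 c; lra.
exists (Num.min (1 / 4) (dlt / (1 + 4 * (`|c| + dlt)))); set e := Num.min _ _.
have e0 : 0 < e by rewrite lt_min divr_gt0//= divr_gt0.
have e4 : e <= 1 / 4 by rewrite ge_min lexx.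
have ec : e * (1 + 4 * (`|c| + dlt)) <= dlt by rewrite -ler_pdivlMr// ge_min lexx orbT.
have ee : 0 <= e * e by rewrite mulr_ge0// ltW.
clearbody e; split=> // q qE; split.
- by rewrite qE; lra.
- by rewrite qE; lra.
- by rewrite qE; lra.
- by rewrite expr2 mulrA -qE ler_piMl//; [|rewrite qE..]; lra.
- move=> c0; rewrite (ger0_norm c0) in ec.
  rewrite ler_pdivrMr; last by rewrite exprn_gt0// qE; lra.
  apply: (@le_trans _ _ ((c + dlt) * (1 - 4 * e))); first lra.
  by apply: ler_wpM2l; rewrite ?expr2 ?qE; lra.
Qed.

(** The path is stopped at t < T, cut into blocks, and lowered slightly by the slope e2, so that
    the partial sums Z of the slopes z stay positive and Cramer's bound applies with the slopes
    y_j = z_j + e2. *)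
Lemma pos_area_lower_path (p b c eps eta : R) :
  let alpha := 1 / (1 + p) in
  0 < p -> 0 < b -> 0 < eps -> 0 < eta -> (0 < Q [set x : @seqR R | (eta <= x 0%N)%R])%E ->
  (B_star X p 0 < c%:E)%E ->
  exists N, forall n, (N <= n)%N -> exists2 m, (m <= n)%N &
    ((expR (- (n%:R `^ alpha * (c * b `^ alpha + eps))))%:E <=
     Q (pos_area p m (n%:R * b)))%E.
Proof.
move=> alpha p0 b0 eps0 eta0 Qeta Bc.
have M0 : 'M_P X 0 = 1%E.
  rewrite -mgfQ /mgf; under eq_integral do rewrite mul0r expR0.
  exact: integral_cstQ.
have M_gt0 t : (0 < 'M_P X t)%E by rewrite -mgfQ; exact: mgf_gt0.
have a0 : 0 < alpha by rewrite /alpha divr_gt0//; lra.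
have ap : (1 + p) * alpha = 1 by rewrite /alpha mul1r divff// gt_eqF//; lra.
have [_ [xi [bv xi0 area] <-] rate] := ereal_inf_lt Bc.
have [cost [_ _ [a [u [v [dec costE]]]]] costc] := ereal_inf_lt rate.
have costc' : (decomposition_cost X (hitting_time xi) a u v <= c%:E)%E by rewrite -costE ltW.
have ba0 : 0 < b `^ alpha by exact: powR_gt0.
pose dlt := eps / (2 * b `^ alpha); have dlt0 : 0 < dlt by rewrite divr_gt0// mulr_gt0.
have [e [e0 e4 /(_ _ erefl)]] := small_loss c dlt0.
set q := 1 - 2 * e => -[q0 qe1 q1 q2 cq].
have [cx bvx] := bv.
have e1 : 0 < e < 1 by rewrite e0; lra.
have [t [t0 tT tarea]] := area_truncate p0 bv xi0 area e1.
have [F HF] := bv_control (ltW t0) (bvx t (ltW t0)).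
have before s : s <= t -> (s%:E < hitting_time xi)%E.
  by move=> st; apply: le_lt_trans tT; rewrite lee_fin.
have xi_ge0 s : 0 <= s <= t -> 0 <= xi s.
  by move=> /andP[s0 st]; apply: path_ge0 => //; exact: before.
have [J J0] := area_riemann p0 t0 xi_ge0 HF e0; set D := t / J%:R => riem.
have [cj [cj0 sumc Hcj]] := block_costs M0 M_gt0 dec costc' t0 tT J0.
rewrite -/D in sumc Hcj.
have Jp : 0 < J%:R :> R by rewrite ltr0n.
have D0 : 0 < D by rewrite divr_gt0.
pose x j := j%:R * D.
have xJ : x J = t by rewrite /x /D mulrC divfK ?gt_eqF.
clearbody D.
have xt j : (j <= J)%N -> x j <= t by move=> jJ; rewrite -xJ /x ler_pM2r// ler_nat.
have xi_gt0 j : (0 < j <= J)%N -> 0 < xi (x j).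
  move=> /andP[j0 jJ]; apply: path_gt0 => //; first by rewrite mulr_gt0// ltr0n.
  by apply: before; exact: xt.
have x_0 : xi (x 0%N) = 0 by rewrite /x mul0r.
have c0 : 0 <= c by apply: le_trans sumc; apply: sumr_ge0 => j _; rewrite mulr_ge0 ?cj0// ltW.
(* lowering by e2 costs at most a factor 1 - e in the heights, and e in the total cost *)
have [e2 [e20 e2t e2xi]] : exists e2, [/\ 0 < e2, t * e2 <= e &
    forall j, (0 < j <= J)%N -> J%:R * e2 <= e * (xi (x j) / D)].
  have [g g0 Hg] := @finite_lower_bound J (fun j => e * (xi (x j) / D) / J%:R)
    (fun j jJ => divr_gt0 (mulr_gt0 e0 (divr_gt0 (xi_gt0 j jJ) D0)) Jp).
  exists (Num.min (e / t) g); split.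
  - by rewrite lt_min g0 divr_gt0.
  - by rewrite mulrC -ler_pdivlMr// ge_min lexx.
  - move=> j jJ; rewrite mulrC -ler_pdivlMr//; apply: le_trans (Hg j jJ).
    by rewrite ge_min lexx orbT.
pose y j := (xi (x j.+1) - xi (x j)) / D.
pose z j := y j - e2.
have Ze j : \sum_(i < j) z i = xi (x j) / D - j%:R * e2.
  rewrite sumrB sum_cst_ord; congr (_ - _); rewrite -mulr_suml.
  by rewrite -(big_mkord xpredT (fun i => xi (x i.+1) - xi (x i))) telescope_sumr// x_0 subr0.
have Zge j : (j <= J)%N -> (1 - e) * (xi (x j) / D) <= \sum_(i < j) z i.
  move=> jJ; rewrite Ze; have [->|j0] := posnP j; first by rewrite x_0 !mul0r mulr0 subr0.
  have : j%:R * e2 <= J%:R * e2 by rewrite ler_pM2r// ler_nat.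
  by have := e2xi j; rewrite j0 jJ => /(_ isT); clear; lra.
have Zpos j : (0 < j <= J)%N -> 0 < \sum_(i < j) z i.
  move=> jJ; have /andP[_ jJ'] := jJ; apply: lt_le_trans (Zge j jJ').
  by apply: mulr_gt0; [exact: lt_le_trans qe1|rewrite divr_gt0// xi_gt0].
pose S := \sum_(j < J) Num.min (\sum_(i < j) z i) (\sum_(i < j.+1) z i) `^ p.
pose A := \sum_(j < J) D * Num.min (xi (x j)) (xi (x j.+1)) `^ p.
have Aq : q `^ 2 <= A.
  have h := le_trans tarea riem; rewrite lee_fin -/A in h.
  rewrite powR_mulrn ?(ltW q0)// -(@ler_pM2l _ (1 + e)); last by rewrite addr_gt0.
  by apply: (le_trans q2); rewrite /q; move: h; clear; lra.
have SD : (q `^ 2 / D) `^ (1 + p) <= S.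
  have Sge : (q / D) `^ p * (A / D) <= S.
    rewrite /A mulr_suml mulr_sumr; apply: ler_sum => j _.
    have jJ := ltn_ord j; set w := Num.min (xi _) _.
    have w0 : 0 <= w.
      by rewrite le_min !xi_ge0//; rewrite mulr_ge0 ?(ltW D0)//= xt// ltnW.
    have -> : (q / D) `^ p * (D * w `^ p / D) = (q / D * w) `^ p.
      rewrite [RHS]powRM ?divr_ge0 ?(ltW q0) ?(ltW D0)//; congr (_ * _).
      by rewrite mulrAC divff ?mul1r// gt_eqF.
    have qe : q / D <= (1 - e) / D by rewrite ler_pM2r ?invr_gt0.
    have mono s : 0 <= xi s -> w <= xi s -> q / D * w <= (1 - e) * (xi s / D).
      move=> s0 ws; have -> : (1 - e) * (xi s / D) = (1 - e) / D * xi s by ring.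
      by apply: ler_pM => //; rewrite divr_ge0// ltW.
    apply: ge0_ler_powR; rewrite ?nnegrE ?(ltW p0)//.
    - by rewrite mulr_ge0// divr_ge0// ltW.
    - rewrite le_min; apply/andP; split; last by apply/ltW/Zpos.
      have [j0|j0] := posnP j; first by rewrite j0 big_ord0.
      by apply/ltW/Zpos; rewrite j0 ltnW.
    - rewrite le_min; apply/andP; split.
        apply: le_trans (Zge j (ltnW jJ)); apply: mono; last by rewrite ge_min lexx.
        by rewrite xi_ge0// mulr_ge0 ?(ltW D0)//= xt// ltnW.
      apply: le_trans (Zge j.+1 jJ); apply: mono; last by rewrite ge_min lexx orbT.
      by rewrite xi_ge0// mulr_ge0 ?(ltW D0)//= xt.
  apply: le_trans Sge.
  have qD : 0 <= q `^ 2 / D by rewrite divr_ge0 ?powR_ge0// ltW.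
  rewrite [leLHS]powRD; last by rewrite mulf_neq0 ?implybT// ?invr_eq0 ?gt_eqF// powR_gt0.
  rewrite powRr1// mulrC; apply: ler_pM; rewrite ?powR_ge0//.
    apply: ge0_ler_powR; rewrite ?nnegrE ?(ltW p0)//; first by rewrite divr_ge0// ltW.
    by rewrite ler_pM2r ?invr_gt0// powR_mulrn ?(ltW q0)// expr2 ler_piMl// ltW.
  by rewrite ler_pM2r ?invr_gt0.
have S0 : 0 < S by apply: lt_le_trans SD; rewrite powR_gt0// divr_gt0// powR_gt0.
have Hc j : (j < J)%N -> 0 <= cj j + e2 /\
    exists2 k, (0 < k)%N & expR (- (k%:R * (cj j + e2))) <= tail Q (z j) k 0.
  move=> jJ; split; first by rewrite addr_ge0 ?cj0// ltW.
  apply: (cramer_lower Qiid e20 (cj0 j jJ)) => s s0.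
  by rewrite mgfQ; exact: Hcj.
have eps20 : 0 < eps / 2 by rewrite divr_gt0.
have [N HN] := pos_area_lower Qiid p0 b0 eps20 eta0 Qeta Zpos Hc S0.
exists N => n Nn; have [m mn Hm] := HN n Nn; exists m => //; apply: le_trans Hm.
rewrite lee_fin ler_expR lerN2 -/alpha -/S.
apply: ler_wpM2l; first exact: powR_ge0.
have bS : (b / S) `^ alpha <= b `^ alpha * (D / q `^ 2).
  have -> : b `^ alpha * (D / q `^ 2) = (b / (q `^ 2 / D) `^ (1 + p)) `^ alpha.
    have qD : 0 < q `^ 2 / D by rewrite divr_gt0// powR_gt0.
    rewrite powRM ?(ltW b0) ?invr_ge0 ?powR_ge0//.
    rewrite -[(_ `^ (1 + p))^-1]powRN -[in RHS]powRrM mulNr ap.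
    by rewrite powR_inv1 ?(ltW qD)// invf_div.
  apply: ge0_ler_powR; rewrite ?nnegrE ?(ltW a0)//.
  - by rewrite divr_ge0 ?(ltW b0) ?(ltW S0).
  - by rewrite divr_ge0 ?(ltW b0) ?powR_ge0.
  - by rewrite ler_pM2l// lef_pV2// posrE// powR_gt0// divr_gt0// powR_gt0.
have sc : \sum_(j < J) (cj j + e2) = (\sum_(j < J) D * cj j + t * e2) / D.
  rewrite big_split /= sum_cst_ord mulrDl -mulr_sumr -[in RHS]xJ /x; field.
  by rewrite gt_eqF.
have sc0 : 0 <= \sum_(j < J) (cj j + e2).
  by apply: sumr_ge0 => j _; rewrite addr_ge0 ?cj0// ltW.
apply: (@le_trans _ _ (b `^ alpha * ((c + e) / q ^+ 2) + eps / 2)).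
  rewrite lerD2r; apply: (le_trans (ler_wpM2r sc0 bS)).
  rewrite -mulrA ler_pM2l// sc powR_mulrn ?(ltW q0)//.
  have -> : D / q ^+ 2 * ((\sum_(j < J) D * cj j + t * e2) / D) = (\sum_(j < J) D * cj j + t * e2) / q ^+ 2.
    by field; rewrite !gt_eqF.
  by rewrite ler_pM2r ?invr_gt0 ?exprn_gt0// lerD.
have := ler_wpM2l (ltW ba0) (cq c0).
have -> : b `^ alpha * (c + dlt) = c * b `^ alpha + eps / 2.
  by rewrite /dlt; field; rewrite gt_eqF.
by clear; lra.
Qed.

End lower_assembly.


(** * The limit *)

Section extended_limits.
Context {R : realType}.

(** Convergence in the order topology, covering the limits +oo and -oo. *)
Lemma cvg_of_bounds (f : nat -> \bar R) (l : \bar R) :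
  (forall r : R, (r%:E < l)%E -> exists N, forall n, (N <= n)%N -> (r%:E <= f n)%E) ->
  (forall r : R, (l < r%:E)%E -> exists N, forall n, (N <= n)%N -> (f n <= r%:E)%E) ->
  f n @[n --> \oo] --> l.
Proof.
case: l => [l| |] lo hi.
- apply/fine_cvgP; split.
    have l1 : ((l - 1)%:E < l%:E)%E by rewrite lte_fin; lra.
    have l2 : (l%:E < (l + 1)%:E)%E by rewrite lte_fin; lra.
    have [N1 H1] := lo _ l1.
    have [N2 H2] := hi _ l2.
    exists (maxn N1 N2) => // n /=; rewrite geq_max => /andP[n1 n2].
    by have := H1 n n1; have := H2 n n2; case: (f n).
  apply/cvgrPdist_le => e e0.
  have l1 : ((l - e)%:E < l%:E)%E by rewrite lte_fin; lra.
  have l2 : (l%:E < (l + e)%:E)%E by rewrite lte_fin; lra.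
  have [N1 H1] := lo _ l1.
  have [N2 H2] := hi _ l2.
  exists (maxn N1 N2) => // n /=; rewrite geq_max => /andP[n1 n2].
  have := H1 n n1; have := H2 n n2; case: (f n) => [y| |]//=.
  by rewrite !lee_fin ler_distlC => -> ->.
- apply/cvgeyPge => A; have [N HN] := lo A (ltry A).
  by exists N.
- apply/cvgeNyPle => A; have [N HN] := hi A (ltNyr A).
  by exists N.
Qed.

Lemma real_between_l (x : \bar R) (c : R) : (x < c%:E)%E -> exists2 c', (x < c'%:E)%E & c' < c.
Proof.
case: x => [x| |]//; last by move=> _; exists (c - 1); rewrite ?ltNyr//; lra.
by rewrite lte_fin => xc; exists ((x + c) / 2); rewrite ?lte_fin; lra.
Qed.

Lemma real_between_r (x : \bar R) (c : R) : (c%:E < x)%E -> exists2 c', (c'%:E <= x)%E & c < c'.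
Proof.
case: x => [x| |]//; last by move=> _; exists (c + 1); rewrite ?leey//; lra.
by rewrite lte_fin => xc; exists ((x + c) / 2); rewrite ?lee_fin; lra.
Qed.

Lemma lne_scaled_ge (x y : R) (q : \bar R) : 0 < x -> ((expR (- (x * y)))%:E <= q)%E ->
  ((- y)%:E <= x^-1%:E * lne q)%E.
Proof.
move=> x0 h; have e0 := expR_gt0 (- (x * y)).
have -> : (- y)%:E = (x^-1%:E * lne (expR (- (x * y)))%:E)%E.
  by rewrite lne_EFin// expRK -EFinM; congr EFin; field; rewrite gt_eqF.
apply: lee_wpmul2l; first by rewrite lee_fin invr_ge0 ltW.
have q0 : (0 <= q)%E by apply: le_trans h; rewrite lee_fin ltW.
by rewrite lee_lne// in_itv/= leey andbT// lee_fin ltW.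
Qed.

Lemma lne_scaled_le (x y : R) (q : \bar R) : 0 < x -> (0 <= q)%E ->
  (q <= (expR (- (x * y)))%:E)%E -> (x^-1%:E * lne q <= (- y)%:E)%E.
Proof.
move=> x0 q0 h; have e0 := expR_gt0 (- (x * y)).
have -> : (- y)%:E = (x^-1%:E * lne (expR (- (x * y)))%:E)%E.
  by rewrite lne_EFin// expRK -EFinM; congr EFin; field; rewrite gt_eqF.
apply: lee_wpmul2l; first by rewrite lee_fin invr_ge0 ltW.
by rewrite lee_lne// in_itv/= leey andbT// lee_fin ltW.
Qed.

End extended_limits.

Theorem theorem2p3 (d : measure_display) (Omega : measurableType d)
  (R : realType) (P : probability Omega R)
  (U : nat -> {RV P >-> R}) (p alpha : R)
  (p_gt0 : 0 < p)
  (alphaE : alpha = 1 / (1 + p))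
  (* U 0 is the generic increment; U 1, U 2, ... drive the walk *)
  (U_iid : iid U)
  (mean_lt0 : ('E_P[U 0%N] < 0)%E)
  (theta_minus_lt0 : (theta_minus (U 0%N) < 0)%E)
  (theta_plus_gt0 : (0 < theta_plus (U 0%N))%E)
  (right_tail :
    (lne (P [set w | (n%:R <= U 0%N w)%R]) * (n%:R^-1)%:E)%E @[n --> \oo]
      --> (- theta_plus (U 0%N))%E)
  (left_tail :
    (lne (P [set w | (n%:R <= - U 0%N w)%R]) * (n%:R^-1)%:E)%E @[n --> \oo]
      --> theta_minus (U 0%N))
  (pos_part : (0 < P [set w | (0 < U 0%N w)%R])%E)
  (b : R) (b_ge0 : 0 <= b) :
  (((n%:R `^ alpha)^-1)%:E *
     lne (P [set w | (n%:R * b <= last_busy_area (fun k => U k) p n w)%R]))%E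
    @[n --> \oo]
    --> (- B_star (U 0%N) p 0 * (b `^ alpha)%:E)%E.
Proof.
have a0 : 0 < alpha by rewrite alphaE divr_gt0//; lra.
have [Q [Qiid QP]] := iid_canonical U_iid.
set B := B_star _ p 0.
pose E n := [set w | n%:R * b <= last_busy_area (fun k => U k) p n w].
have EE n : E n = \bigcup_(m in [set m | (m <= n)%N]) (blk U (n - m) @^-1` pos_area p m (n%:R * b)).
  exact: busy_area_event.
have mblk m n : measurable (blk U (n - m) @^-1` pos_area p m (n%:R * b)).
  rewrite -[X in measurable X]setTI; apply: (measurable_blk U (n - m)) => //.
  exact: measurable_pos_area.
have mE n : measurable (E n) by rewrite EE; apply: bigcup_measurable.
have PE m n : P (blk U (n - m) @^-1` pos_area p m (n%:R * b)) = Q (pos_area p m (n%:R * b)).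
  by apply: QP; exact: measurable_pos_area.
have xn n : (0 < n)%N -> 0 < n%:R `^ alpha :> R by move=> n0; rewrite powR_gt0// ltr0n.
rewrite -/(E _); move: b_ge0; rewrite le_eqVlt => /orP[/eqP b0|b0].
  (* both sides vanish: the area is nonnegative *)
  have -> : (- B * (b `^ alpha)%:E)%E = 0%E by rewrite -b0 powR0 ?gt_eqF// mule0.
  apply: cvg_near_cst; apply: nearW => n.
  have -> : [set w | n%:R * b <= last_busy_area (fun k => U k) p n w] = setT.
    apply/seteqP; split => w //= _; rewrite -b0 mulr0; apply: sumr_ge0 => i _; exact: powR_ge0.
  by rewrite [X in lne X](_ : _ = 1%E) ?lne1 ?mule0//; exact: (@probability_setT _ _ _ P).
have ba0 : 0 < b `^ alpha by exact: powR_gt0.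
have mgfQ := mgf_coordinate U_iid QP.
have M0 : 'M_P (U 0%N) 0 = 1%E.
  rewrite -mgfQ /mgf; under eq_integral do rewrite mul0r expR0.
  exact: integral_cstQ.
have M_gt0 t : (0 < 'M_P (U 0%N) t)%E by rewrite -mgfQ; exact: mgf_gt0.
have ME := mgfE U.
have [eta eta0 Peta] := positive_part_level pos_part.
have Qeta : (0 < Q [set x : @seqR R | (eta <= x 0%N)%R])%E.
  rewrite [ltRHS](_ : _ = P [set w | (eta <= U 0%N w)%R])//.
  have := coordinate_prob U_iid QP (measurable_itv `[eta, +oo[).
  by congr (Q _ = P _); apply/seteqP; split => w /=; rewrite in_itv/= andbT.
apply: cvg_of_bounds => r.
- move=> rB; have Bc : (B < (- r / b `^ alpha)%:E)%E.
    move: rB; case: (B) => [y| |].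
    + rewrite -EFinN -EFinM !lte_fin => h; rewrite ltr_pdivlMr//; lra.
    + by rewrite /= gt0_mulNye ?lte_fin.
    + by rewrite ltNyr.
  (* a level c' with B < c' < - r / b^alpha leaves room for the error eps *)
  have [c' Bc' c'c] := real_between_l Bc.
  have eps0 : 0 < - r - c' * b `^ alpha by rewrite ltr_pdivlMr// in c'c; lra.
  have [N HN] := pos_area_lower_path Qiid mgfQ p_gt0 b0 eps0 eta0 Qeta Bc'.
  exists (maxn 1 N) => n; rewrite geq_max => /andP[n1 Nn].
  have [m mn Hm] := HN n Nn; rewrite -alphaE in Hm.
  rewrite (_ : r = - (c' * b `^ alpha + (- r - c' * b `^ alpha))); last by lra.
  apply: lne_scaled_ge; first exact: xn.
  apply: (le_trans Hm); rewrite -PE; apply: le_measure; rewrite ?inE//; first exact: mE.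
  by rewrite -/(E n) EE => w hw; exists m.
- move=> Br; have [r0|r0] := leP 0 r.
    exists 1%N => n n1; apply: (@le_trans _ _ 0%E); last by rewrite lee_fin.
    apply: mule_ge0_le0; first by rewrite lee_fin invr_ge0 powR_ge0.
    by rewrite lne_le0; exact: (probability_le1 P (mE n)).
  have Bc : ((- r / b `^ alpha)%:E < B)%E.
    move: Br; case: (B) => [y| |].
    + rewrite -EFinN -EFinM !lte_fin => h; rewrite ltr_pdivrMr//; lra.
    + by rewrite ltry.
    + by rewrite /= gt0_mulye ?lte_fin.
  have [B' BB' rB'] := real_between_r Bc.
  have B'0 : 0 < B' by apply: lt_trans rB'; rewrite divr_gt0// oppr_gt0.
  have eps0 : 0 < (B' * b `^ alpha + r) / 2.
    by rewrite ltr_pdivrMr// in rB'; rewrite divr_gt0//; lra.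
  have [c [A [c0 HA]]] := exponential_abs_moment ME theta_minus_lt0 theta_plus_gt0.
  have HAQ : (\int[Q]_x (expR (c * `|x 0%N|))%:E = A%:E)%E.
    rewrite -HA; apply: (coordinate_integral U_iid QP (h := fun y => expR (c * `|y|))).
      by apply: measurableT_comp => //; apply: measurable_funM => //; exact: measurableT_comp.
    by move=> y; exact: expR_ge0.
  have muE := expectationE ME theta_minus_lt0 theta_plus_gt0.
  have mu0 : fine ('E_P[U 0%N])%E < 0 by rewrite -lte_fin -muE.
  have [th [rho [th0 rho01 Mrho]]] := moment_lt1 ME theta_minus_lt0 theta_plus_gt0 mu0.
  have Mrho' : (mgf Q th <= rho%:E)%E by rewrite mgfQ ME.
  have blocks (m : R) (k : nat) (D : nat -> R) : 0 < m ->
      (forall j, (0 < j <= k)%N -> 0 < \sum_(i < j) D i) ->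
      1 <= \sum_(j < k) m * Num.min (\sum_(i < j) D i) (\sum_(i < j.+1) D i) `^ p ->
      (B'%:E <= \sum_(j < k) m%:E * cramer_rate Q (D j / m))%E.
    move=> m0 Dpos area; apply: (le_trans BB').
    have := B_star_le_blocks M0 M_gt0 mu0
      (Lambda_star_mean ME theta_minus_lt0 theta_plus_gt0) p_gt0 m0 Dpos area.
    by under [X in (_ <= X)%E -> _]eq_bigr do rewrite -(cramer_rateE U_iid QP).
  have [N1 H1] := pos_area_upper Qiid p_gt0 b0 B'0 eps0 th0 rho01 Mrho' c0 HAQ blocks.
  have [N2 H2] := polynomial_le_expR 1 ltr01 eps0 a0.
  exists (maxn 1 (maxn N1 N2)) => n; rewrite !geq_max => /and3P[n1 nN1 nN2].
  rewrite (_ : r = - (- r)); last by rewrite opprK.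
  apply: lne_scaled_le; [exact: xn|exact: measure_ge0|].
  apply: (@le_trans _ _ (\sum_(m < n.+1) P (blk U (n - m) @^-1` pos_area p m (n%:R * b)))%E).
    apply: (@bigcup_prob_le _ _ _ P (fun m => blk U (n - m) @^-1` pos_area p m (n%:R * b))) => //.
    - exact: mE.
    - by move=> w; rewrite -[X in X w]/(E n) EE => -[m mn h]; exists m.
  apply: (@le_trans _ _ (\sum_(m < n.+1) (expR (- (n%:R `^ alpha * (B' * b `^ alpha - (B' * b `^ alpha + r) / 2))))%:E)%E).
    by apply: lee_sum => m _; rewrite PE; have := H1 n nN1 m; rewrite -alphaE.
  (* the n + 1 terms of the union are absorbed by half of the margin *)
  rewrite sumEFin sum_cst_ord lee_fin.
  have h := H2 n nN2; rewrite expr1 mul1r in h.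
  apply: (le_trans (ler_wpM2r (expR_ge0 _) h)); rewrite -expRD ler_expR; lra.
Qed.
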